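(* Suppose that $\Phi$ is an entire function of the form $\Phi=\gamma*f$, where $f$ is a bounded Borel function on $\mathbb{R}$. Then the kernel $K(z,w)=G(z,w)\Phi(z+\bar w)$ gives rise to a solution to Ward's equation if and only if there is a connected set $I\subset\mathbb{R}$ of positive measure such that $\Phi=\gamma*\chi_I$.
   Context: $G(z,w)=e^{z\bar w-|z|^2/2-|w|^2/2}$ is the Ginibre kernel, $\gamma(z)=\frac{1}{\sqrt{2\pi}}e^{-z^2/2}$ for $z\in\mathbb{C}$, and for a bounded function $g$ on $\mathbb{R}$, $(\gamma*g)(z)=\int_{-\infty}^{+\infty}\gamma(z-t)g(t)\,dt$, $z\in\mathbb{C}$. $\chi_I$ is the indicator function of $I$. $dA(z)=d^2z/\pi$ is Lebesgue measure divided by $\pi$; $\bar\partial=\frac12(\partial_x+i\partial_y)$; $\Delta=\partial\bar\partial$ is one quarter of the usual Laplacian. A kernel $K$ on $\mathbb{C}^2$ gives rise to a solution to Ward's equation if $R(z):=K(z,z)>0$ for all $z\in\mathbb{C}$ and, with $B(z,w)=|K(z,w)|^2/K(z,z)$ and $C(z)=\int_{\mathbb{C}}\frac{B(z,w)}{z-w}\,dA(w)$, one has $\bar\partial C(z)=R(z)-1-\Delta\log R(z)$ for all $z\in\mathbb{C}$. *)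

(* Defs.v *)
From HB Require Import structures.
From mathcomp Require Import all_boot all_order all_algebra.
From mathcomp Require Import all_classical all_reals all_analysis.
From mathcomp Require Import complex.

Set Implicit Arguments.
Unset Strict Implicit.
Unset Printing Implicit Defensive.

Import Order.TTheory GRing.Theory Num.Theory.
Import numFieldNormedType.Exports.

Local Open Scope complex_scope.
Local Open Scope classical_set_scope.
Local Open Scope ring_scope.

Local Notation Re := complex.Re.
Local Notation Im := complex.Im.

Section ComplexAnalysis.
Variable R : realType.
Implicit Types (z w : R[i]) (F : R[i] -> R[i]).

Definition cexp z : R[i] :=
  (expR (Re z))%:C * (cos (Im z) +i* sin (Im z)).

Definition entire F : Prop := forall z, derivable (F : R[i]^o -> R[i]^o) z 1.

Definition bounded_borel (f : R -> R[i]) : Prop :=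
  [/\ measurable_fun [set: R] (fun t => Re (f t)),
      measurable_fun [set: R] (fun t => Im (f t)) &
      exists M : R, forall t, `|f t| <= M%:C].

Definition pdx F z : R[i] :=
  derive1 (fun t : R => Re (F (t +i* Im z))) (Re z) +i*
  derive1 (fun t : R => Im (F (t +i* Im z))) (Re z).

Definition pdy F z : R[i] :=
  derive1 (fun t : R => Re (F (Re z +i* t))) (Im z) +i*
  derive1 (fun t : R => Im (F (Re z +i* t))) (Im z).

(* [derive1] is total, so the existence of the real partial derivatives of the
   real and imaginary parts is recorded separately. *)
Definition pderivable F z : Prop :=
  [/\ derivable (fun t : R => Re (F (t +i* Im z))) (Re z) 1,
      derivable (fun t : R => Im (F (t +i* Im z))) (Re z) 1,
      derivable (fun t : R => Re (F (Re z +i* t))) (Im z) 1 &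
      derivable (fun t : R => Im (F (Re z +i* t))) (Im z) 1].

Definition dpartial F z : R[i] := (pdx F z - 'i * pdy F z) / 2.

Definition dbar F z : R[i] := (pdx F z + 'i * pdy F z) / 2.

Definition laplace F : R[i] -> R[i] := dpartial (dbar F).

Definition laplacian_exists F : Prop :=
  forall z, pderivable F z /\ pderivable (dbar F) z.

Definition cintegrable d (T : measurableType d)
    (mu : {measure set T -> \bar R}) (h : T -> R[i]) : Prop :=
  mu.-integrable [set: T] (fun x => (Re (h x))%:E) /\
  mu.-integrable [set: T] (fun x => (Im (h x))%:E).

Definition cintegral d (T : measurableType d)
    (mu : {measure set T -> \bar R}) (h : T -> R[i]) : R[i] :=
  (\int[mu]_(x in [set: T]) Re (h x))%R +i*
  (\int[mu]_(x in [set: T]) Im (h x))%R.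

Definition leb2 := (@lebesgue_measure R \x @lebesgue_measure R)%E.

Definition dA_integrable F : Prop :=
  cintegrable leb2 (fun u : R * R => F (u.1 +i* u.2)).

Definition dA_integral F : R[i] :=
  cintegral leb2 (fun u : R * R => F (u.1 +i* u.2)) / (pi : R)%:C.

End ComplexAnalysis.

Section Ward.
Variable R : realType.
Implicit Types (z w : R[i]) (g : R -> R[i]) (K : R[i] -> R[i] -> R[i]).

Definition ginibre z w : R[i] :=
  cexp (z * w^* - `|z| ^+ 2 / 2 - `|w| ^+ 2 / 2).

Definition gauss z : R[i] := (Num.sqrt (2 * pi : R))^-1%:C * cexp (- z ^+ 2 / 2).

Definition gauss_conv g z : R[i] :=
  cintegral (@lebesgue_measure R) (fun t : R => gauss (z - t%:C) * g t).

Definition berezin K z w : R[i] := `|K z w| ^+ 2 / K z z.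

(* The value at [w = z] is [0] (division by zero), on a null set. *)
Definition cauchy_kernel K z w : R[i] := berezin K z w / (z - w).

Definition cauchy_transform K z : R[i] := dA_integral (cauchy_kernel K z).

Definition log_density K z : R[i] := (ln (Re (K z z)))%:C.

(* In [R[i]], [0 < x] means that [x] is real and positive. The integral and the
   derivatives being total operations, their existence is part of the
   definition. *)
Definition solves_ward K : Prop :=
  (forall z, 0 < K z z) /\
  [/\ forall z, dA_integrable (cauchy_kernel K z),
      forall z, pderivable (cauchy_transform K) z,
      laplacian_exists (log_density K) &
      forall z, dbar (cauchy_transform K) z =
                K z z - 1 - laplace (log_density K) z].

End Ward.

(* Main.v *)
Require Import Defs.
From HB Require Import structures.
From mathcomp Require Import all_boot all_order all_algebra.
From mathcomp Require Import all_classical all_reals all_analysis.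
From mathcomp Require Import measurable_realfun complex ring lra.
Import Order.TTheory GRing.Theory Num.Theory.
Import numFieldNormedType.Exports.
Local Open Scope complex_scope.
Local Open Scope classical_set_scope.
Local Open Scope ring_scope.

(** Write [f] for the weight and [gtrans f x] for [Phi (2 * x)], the integral of
    [f t] against the Gaussian density centred at [2 * x]. Since [K z z] is
    [gtrans f (Re z)], its positivity says that the Gaussian transform of the
    imaginary part of [f] vanishes. This transform is injective ([gtrans_inj]), so
    [f] is real almost everywhere ([ward_real_weight]).

    For a real weight, [`|K z w| ^+ 2] is a Gaussian in [Re z - Re w] times the
    power spectrum, at frequency [Im z - Im w], of [f] times a Gaussian. In the
    Cauchy transform [C], the integral over [Im w] pairs this spectrum with a Poisson
    kernel, and Parseval turns it into a double integral with an exponential weight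
    ([integral_pk_specnorm]). Symmetrizing that double integral removes the absolute
    value from the exponent; the squares then complete ([gam_split], [symmetrize]),
    and [Re w] can be integrated out. The outcome ([integral_re_kernel]) is
      [C z = P x - N x / gtrans f x], where [x = Re z],
    [P] has derivative [2 * gtrans f] and [N] is the Gaussian transform of
    [f * prim f], with [prim f] the primitive of [f].

    Let [T] be the Gaussian transform of [t * f t]. The derivative of [gtrans f] is
    [- 4 * x * gtrans f + 2 * T], and therefore everything in Ward's equation cancels
    except [(N / gtrans f)' = (T / gtrans f)']. So the equation holds if and only if,
    for some constant [c], the Gaussian transform of [f t * (t - c - prim f t)]
    vanishes, that is, by injectivity, if and only if
      [f t * (t - c - prim f t) = 0] for almost every [t]
    ([ward_gap], [gap_ward]). Now let [I] be the zero set of [t - c - prim f t]. Off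
    [I] the weight vanishes, so this continuous function has slope one there and
    cannot come back to zero once it has left it: [I] is an interval. Inside [I] the
    function [prim f] is [t - c], whence [f = 1] ([rigidity]). Conversely, the
    indicator of an interval clearly satisfies the last equation ([gap_indic]).

    Injectivity of the Gaussian transform is that of the two-sided Laplace transform
    on functions [H] of Gaussian decay ([laplace_inj]). It is proved without analytic
    continuation. Exponential polynomials approximate [expR (- t ^+ 2 / 16)] while
    staying below [expR (t ^+ 2 / 4)], so the integrals of [H] against
    [expR (tau * t - k * t ^+ 2 / 16)] vanish too; polynomials without constant term
    in [expR (- (t - s) ^+ 2 / 16)] approximate the indicator of an interval centred
    at [s], so the integral of [H] over every interval vanishes. The second of these
    approximations ([sublevel_integral0]) also gives the Fourier transform of the
    Poisson kernel from its Laplace transform ([poisson_formula]). *)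

Set Implicit Arguments.
Unset Strict Implicit.
Unset Printing Implicit Defensive.

Local Notation Re := complex.Re.
Local Notation Im := complex.Im.

(** * Real-valued Lebesgue integrals *)
Definition Rintegrable d (T : measurableType d) (R : realType)
  (mu : {measure set T -> \bar R}) (h : T -> R) := mu.-integrable setT (EFin \o h).

Section MeasureTools.
Context d (T : measurableType d) (R : realType) (mu : {measure set T -> \bar R}).

Lemma Rintegrable_meas (h : T -> R) : Rintegrable mu h -> measurable_fun setT h.
Proof. by move=> /integrableP[/measurable_EFinP]. Qed.

Lemma Rintegrable_le (g h : T -> R) : measurable_fun setT g ->
  (forall x, `|g x| <= h x) -> Rintegrable mu h -> Rintegrable mu g.
Proof.
move=> mg gh ih; apply: (le_integrable measurableT _ _ ih).
  exact/measurable_EFinP.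
move=> x _ /=; rewrite lee_fin; apply: le_trans (gh x) _; exact: ler_norm.
Qed.

Lemma RintegrableD (g h : T -> R) : Rintegrable mu g -> Rintegrable mu h ->
  Rintegrable mu (fun x => g x + h x).
Proof. by move=> ig ih; exact: (integrableD measurableT ig ih). Qed.

Lemma RintegrableB (g h : T -> R) : Rintegrable mu g -> Rintegrable mu h ->
  Rintegrable mu (fun x => g x - h x).
Proof. by move=> ig ih; exact: (integrableB measurableT ig ih). Qed.

Lemma RintegrableZ (c : R) (h : T -> R) : Rintegrable mu h ->
  Rintegrable mu (fun x => c * h x).
Proof. by move=> ih; exact: (integrableZl measurableT c ih). Qed.

Lemma Rintegrable_norm (h : T -> R) : Rintegrable mu h ->
  Rintegrable mu (fun x => `|h x|).
Proof. by move=> ih; exact: integrable_norm. Qed.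

Lemma Rintegrable_bounded (M : R) (b h : T -> R) : measurable_fun setT b ->
  (forall x, `|b x| <= M) -> Rintegrable mu h ->
  Rintegrable mu (fun x => b x * h x).
Proof.
move=> mb bM ih.
apply: (@Rintegrable_le _ (fun x => M * `|h x|)).
- exact: measurable_funM (Rintegrable_meas ih).
- by move=> x; rewrite normrM ler_wpM2r.
- exact/RintegrableZ/Rintegrable_norm.
Qed.

Lemma Rintegral_ae (g h : T -> R) : measurable_fun setT g -> measurable_fun setT h ->
  {ae mu, forall x, g x = h x} -> \int[mu]_x g x = \int[mu]_x h x.
Proof.
move=> mg mh gh; rewrite /Rintegral; congr fine.
apply: ae_eq_integral => //; [exact/measurable_EFinP|exact/measurable_EFinP|].
by apply: filterS gh => x /= -> _.
Qed.

Lemma Rintegral_dominated (h_ : nat -> T -> R) (h g : T -> R) :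
  (forall n, measurable_fun setT (h_ n)) -> Rintegrable mu g ->
  (forall n x, `|h_ n x| <= g x) ->
  (forall x, h_ n x @[n --> \oo] --> h x) ->
  Rintegrable mu h /\ \int[mu]_x h_ n x @[n --> \oo] --> \int[mu]_x h x.
Proof.
move=> mh_ ig hg hh.
have mh : measurable_fun setT h.
  by apply: (measurable_fun_cvg mh_) => x _; exact: hh.
have [|||||ih _ cvgh] := @dominated_convergence _ _ _ mu setT measurableT
  (fun n x => (h_ n x)%:E) (EFin \o h) (EFin \o g).
- by move=> n; exact/measurable_EFinP.
- exact/measurable_EFinP.
- by apply: nearW => x _; apply: cvg_EFin; [exact: nearW|exact: hh].
- exact: ig.
- by apply: nearW => x n _; rewrite /= lee_fin.
split => //.
rewrite /Rintegral.
apply: fine_cvg; rewrite fineK; last exact: integrable_fin_num.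
exact: cvgh.
Qed.

End MeasureTools.

(** * Iterated integrals, integrals with a parameter, reflections *)
Section Fubini.
Context d1 d2 (T1 : measurableType d1) (T2 : measurableType d2) (R : realType).
Variables (m1 : {sigma_finite_measure set T1 -> \bar R})
  (m2 : {sigma_finite_measure set T2 -> \bar R}).
Implicit Type h : T1 * T2 -> R.

Lemma Rintegral_fubini1 h : Rintegrable (m1 \x m2)%E h ->
  \int[(m1 \x m2)%E]_z h z = \int[m1]_x \int[m2]_y h (x, y).
Proof.
move=> ih; rewrite /Rintegral -(integral12_prod_meas1 ih); congr fine.
apply: ae_eq_integral => //.
- exact: measurable_fubini_F ih.
- apply: measurableT_comp => //; apply: measurableT_comp => //.
  exact: measurable_fubini_F ih.
- apply: filterS (ae_integrable1 ih) => x /= ix _.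
  by rewrite /fubini_F fineK//; exact: integrable_fin_num.
Qed.

Lemma Rintegral_fubini2 h : Rintegrable (m1 \x m2)%E h ->
  \int[(m1 \x m2)%E]_z h z = \int[m2]_y \int[m1]_x h (x, y).
Proof.
move=> ih; rewrite /Rintegral -(integral21_prod_meas1 ih); congr fine.
apply: ae_eq_integral => //.
- exact: measurable_fubini_G ih.
- apply: measurableT_comp => //; apply: measurableT_comp => //.
  exact: measurable_fubini_G ih.
- apply: filterS (ae_integrable2 ih) => x /= ix _.
  by rewrite /fubini_G fineK//; exact: integrable_fin_num.
Qed.

Lemma Rintegrable_fubini1 h : Rintegrable (m1 \x m2)%E h ->
  Rintegrable m1 (fun x => \int[m2]_y h (x, y)).
Proof.
move=> ih; have := integrable_fubini_F ih => iF.
apply/integrableP; split.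
  apply: measurableT_comp => //; apply: measurableT_comp => //.
  exact: measurable_fubini_F ih.
move/integrableP : iF => [_]; apply: le_lt_trans.
apply: ge0_le_integral => //.
- apply: measurableT_comp => //; apply: measurableT_comp => //; apply: measurableT_comp => //.
  exact: measurable_fubini_F ih.
- by apply: measurableT_comp => //; exact: measurable_fubini_F ih.
- move=> x _ /=; rewrite /Rintegral /fubini_F.
  by case: (\int[m2]_y (h (x, y))%:E)%E => [r| |] //=; rewrite normr0 ?leey.
Qed.

Lemma Rintegrable_fubini2 h : Rintegrable (m1 \x m2)%E h ->
  Rintegrable m2 (fun y => \int[m1]_x h (x, y)).
Proof.
move=> ih; have [_ iG] := (measurable_fubini_G ih, integral21_prod_meas1 ih).
apply/integrableP; split.
  apply: measurableT_comp => //; apply: measurableT_comp => //.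
  exact: measurable_fubini_G ih.
have mE : measurable_fun setT (EFin \o h) := measurable_int _ ih.
have := (integrable21ltyP m1 m2 mE).1 ih; apply: le_lt_trans.
apply: ge0_le_integral => //.
- apply: measurableT_comp => //; apply: measurableT_comp => //; apply: measurableT_comp => //.
  exact: measurable_fubini_G ih.
- apply: (measurable_fun_fubini_tonelli_G (fun z => `|(h z)%:E|%E)) => //.
  by apply: measurableT_comp => //.
- move=> y _ /=; apply: (@le_trans _ _ `|\int[m1]_x (h (x, y))%:E|%E).
    rewrite /Rintegral; case: (\int[m1]_x (h (x, y))%:E)%E => [r| |] //=; by rewrite normr0 ?leey.
  apply: le_abse_integral => //.
  exact: (measurable_fun_pair1 _ mE).
Qed.

(** Tonelli's theorem, with the finiteness of the iterated integral replaced by an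
    integrable bound for the inner integrals. *)
Lemma Rintegrable_prod h (b : T1 -> R) : measurable_fun setT h ->
  (forall x, Rintegrable m2 (fun y => h (x, y))) ->
  (forall x, \int[m2]_y `|h (x, y)| <= b x) ->
  Rintegrable m1 b ->
  Rintegrable (m1 \x m2)%E h.
Proof.
move=> mh ih hb ib; apply/integrable12ltyP; first exact/measurable_EFinP.
move/integrableP : (ib) => [mb]; apply: le_lt_trans.
apply: ge0_le_integral => //.
- by move=> x _; apply: integral_ge0.
- apply: (measurable_fun_fubini_tonelli_F (fun z => `|(h z)%:E|%E)) => //.
  by apply: measurableT_comp => //; exact/measurable_EFinP.
- exact: measurableT_comp.
- move=> x _ /=.
  have := hb x; rewrite /Rintegral => hbx.
  rewrite -(@fineK _ (\int[m2]_y `|(h (x, y))%:E|)%E).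
    by rewrite lee_fin; apply: le_trans hbx (ler_norm _).
  apply: integrable_fin_num => //.
  exact: (Rintegrable_norm (ih x)).
Qed.

Lemma Rintegrable_prod2 h (b : T2 -> R) : measurable_fun setT h ->
  (forall y, Rintegrable m1 (fun x => h (x, y))) ->
  (forall y, \int[m1]_x `|h (x, y)| <= b y) ->
  Rintegrable m2 b ->
  Rintegrable (m1 \x m2)%E h.
Proof.
move=> mh ih hb ib; apply/integrable21ltyP; first exact/measurable_EFinP.
move/integrableP : (ib) => [mb]; apply: le_lt_trans.
apply: ge0_le_integral => //.
- by move=> x _; apply: integral_ge0.
- apply: (measurable_fun_fubini_tonelli_G (fun z => `|(h z)%:E|%E)) => //.
  by apply: measurableT_comp => //; exact/measurable_EFinP.
- exact: measurableT_comp.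
- move=> x _ /=.
  have := hb x; rewrite /Rintegral => hbx.
  rewrite -(@fineK _ (\int[m1]_y `|(h (y, x))%:E|)%E).
    by rewrite lee_fin; apply: le_trans hbx (ler_norm _).
  apply: integrable_fin_num => //.
  exact: (Rintegrable_norm (ih x)).
Qed.

Lemma measurable_Rintegral h : measurable_fun setT h ->
  measurable_fun setT (fun x => \int[m2]_y h (x, y)).
Proof.
move=> mh; apply: measurableT_comp => //.
have mE : measurable_fun setT (fun z => (h z)%:E) by exact/measurable_EFinP.
rewrite (_ : (fun x => _) = fun x => (\int[m2]_y (EFin \o h)^\+ (x, y) -
    \int[m2]_y (EFin \o h)^\- (x, y))%E); last first.
  apply/funext => x; rewrite integralE.
  by congr (_ - _)%E; apply: eq_integral => y _; rewrite ?funeposE ?funenegE.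
apply: emeasurable_funB.
  by apply: measurable_fun_fubini_tonelli_F => //; exact: measurable_funepos.
by apply: measurable_fun_fubini_tonelli_F => //; exact: measurable_funeneg.
Qed.

Lemma Rintegral_mul (u : T1 -> R) (v : T2 -> R) :
  Rintegrable m1 u -> Rintegrable m2 v ->
  Rintegrable (m1 \x m2)%E (fun z => u z.1 * v z.2) /\
  \int[(m1 \x m2)%E]_z (u z.1 * v z.2) = (\int[m1]_x u x) * (\int[m2]_y v y).
Proof.
move=> iu iv.
have i : Rintegrable (m1 \x m2)%E (fun z => u z.1 * v z.2).
  apply: (@Rintegrable_prod _ (fun x => `|u x| * \int[m2]_y `|v y|)).
  - apply: measurable_funM.
      by apply: measurableT_comp; [exact: Rintegrable_meas iu|exact: measurable_fst].
    by apply: measurableT_comp; [exact: Rintegrable_meas iv|exact: measurable_snd].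
  - by move=> x /=; exact: (RintegrableZ (u x) iv).
  - move=> x /=; under eq_Rintegral do rewrite normrM.
    by rewrite RintegralZl//; exact: (Rintegrable_norm iv).
  - have := RintegrableZ (\int[m2]_y `|v y|) (Rintegrable_norm iu).
    by apply: eq_integrable => // x _; rewrite /= mulrC.
split => //; rewrite Rintegral_fubini1//=.
under eq_Rintegral do rewrite RintegralZl//.
by rewrite RintegralZr.
Qed.

End Fubini.

(** The functions to be differentiated below are defined on the whole line but are
    only dominated near each point: hence the window of radius one. *)
Lemma is_derive_Rintegral d (T : measurableType d) (R : realType)
    (mu : {measure set T -> \bar R}) (h h' : R -> T -> R) (G : T -> R) (a : R) :
  (forall x, Rintegrable mu (h x)) ->
  (forall (x : R) t, is_derive x (1 : R) (h ^~ t) (h' x t)) ->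
  (forall t, 0 <= G t) -> Rintegrable mu G ->
  (forall x t, a - 1 < x < a + 1 -> `|h' x t| <= G t) ->
  is_derive a (1 : R) (fun x : R => \int[mu]_t h x t) (\int[mu]_t h' a t).
Proof.
move=> ih dh G0 iG hG.
have aI : `](a - 1), (a + 1)[%classic a.
  by rewrite /= in_itv/= ltrBlDr ltrDl ltr01.
have ih' x : `](a - 1), (a + 1)[%classic x -> mu.-integrable setT (EFin \o h x).
  by move=> _; exact: ih.
have dh' x t : `](a - 1), (a + 1)[%classic x -> setT t -> derivable (h ^~ t) x 1.
  by move=> _ _; apply: ex_derive.
have hG' x t : `](a - 1), (a + 1)[%classic x -> setT t ->
    `|partial1of2 h x t| <= G t.
  move=> xI _; rewrite partial1of2E (@derive_val _ _ _ _ _ _ _ (dh x t)).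
  by apply: hG; move: xI; rewrite /= in_itv.
apply: DeriveDef.
  exact: (derivable_under_integral measurableT aI ih' dh' G0 iG hG').
rewrite -derive1E (differentiation_under_integral measurableT aI ih' dh' G0 iG hG').
apply: eq_Rintegral => t _.
by rewrite partial1of2E (@derive_val _ _ _ _ _ _ _ (dh a t)).
Qed.

(** Typed on the line with its Borel sets, so that pushforwards along it are defined. *)
Definition point_reflection (R : realType) (c x : R) : measurableTypeR R := c - x.

Lemma measurable_point_reflection (R : realType) (c : R) :
  measurable_fun setT (point_reflection c).
Proof. exact: measurable_funB. Qed.

Lemma lebesgue_measure_reflect (R : realType) (c : R) (A : set R) : measurable A ->
  pushforward lebesgue_measure (point_reflection c) A = lebesgue_measure A.
Proof.
move=> mA; apply/esym/lebesgue_measure_unique => //=.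
  exact: measurable_point_reflection.
move=> m _ [[a b]] _ <-.
rewrite /pushforward/= (_ : _ @^-1` _ = `[c - b, c - a[%classic); last first.
  by apply/seteqP; split=> x /=; rewrite /point_reflection !in_itv/= => /andP[? ?]; apply/andP; split; lra.
rewrite !lebesgue_measure_itv/= !lte_fin ltrD2l ltrN2; case: ifP => // _.
by rewrite -!EFinB; congr EFin; lra.
Qed.

Lemma integral_reflect (R : realType) (c : R) (h : R -> \bar R) : measurable_fun setT h ->
  (\int[@lebesgue_measure R]_x h x = \int[@lebesgue_measure R]_x h (c - x)%R)%E.
Proof.
have ge0 (g : R -> \bar R) : measurable_fun setT g -> (forall x, 0 <= g x)%E ->
  (\int[@lebesgue_measure R]_x g x = \int[@lebesgue_measure R]_x g (c - x)%R)%E.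
  move=> mg g0.
  rewrite [in RHS](_ : [set: _] = point_reflection c @^-1` setT)//.
  rewrite -[RHS]ge0_integral_pushforward//=.
    by apply: eq_measure_integral => //=; [exact: measurable_point_reflection | move=> m A mA _]; exact/esym/lebesgue_measure_reflect.
  exact: measurable_point_reflection.
move=> mh; rewrite integralE [RHS]integralE.
rewrite (ge0 _ (measurable_funepos mh))// (ge0 _ (measurable_funeneg mh))//.
by congr (_ - _)%E; apply: eq_integral => x _; rewrite ?funeposE ?funenegE.
Qed.

(** These two instances make the theorems on product measures apply to [leb2] itself,
    in particular as a factor of a further product. *)
HB.instance Definition _ (R : realType) := Measure.on (@leb2 R).

Lemma sigma_finite_leb2 (R : realType) : sigma_finite setT (@leb2 R).
Proof.
have /sigma_finiteP[F [TF ndF Foo]] := sigma_finiteT (@lebesgue_measure R).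
exists (fun n => F n `*` F n).
  rewrite -setXTT TF predeqE => -[x y]; split.
    move=> [/= [n _ Fnx] [k _ Fky]]; exists (maxn n k) => //; split.
    - by move: x Fnx; exact/subsetPset/ndF/leq_maxl.
    - by move: y Fky; exact/subsetPset/ndF/leq_maxr.
  by move=> [n _ []/= ? ?]; split; exists n.
move=> k; have [? ?] := Foo k; split; first exact: measurableX.
by rewrite /leb2 product_measure1E// lte_mul_pinfty// ge0_fin_numE.
Qed.

HB.instance Definition _ (R : realType) :=
  Measure_isSigmaFinite.Build _ _ _ (@leb2 R) (@sigma_finite_leb2 R).

(** * Vanishing exponential moments *)
Section VanishingMoments.
Context d (T : measurableType d) (R : realType) (mu : {measure set T -> \bar R}).

(** The factor [1 - (1 - y) ^+ N] is a polynomial in [y] without constant term; the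
    induction on [N] also needs the moments weighted by [(1 - y) ^+ N]. *)
Lemma integral_sub1X0 (H y : T -> R) : Rintegrable mu H -> measurable_fun setT y ->
  (forall t, 0 <= y t <= 1) ->
  (forall k, \int[mu]_t (y t ^+ k.+1 * H t) = 0) ->
  forall N, \int[mu]_t ((1 - (1 - y t) ^+ N) * H t) = 0.
Proof.
move=> iH my y01 yH0.
have my1 : measurable_fun setT (fun t => 1 - y t) by exact: measurable_funB.
have ipow k N : Rintegrable mu (fun t => y t ^+ k * (1 - y t) ^+ N * H t).
  apply: (@Rintegrable_bounded _ _ _ _ 1) => //.
    by apply: measurable_funM; exact: measurable_funX.
  move=> t; have /andP[y0 y1] := y01 t.
  rewrite ger0_norm ?mulr_ge0 ?exprn_ge0 ?subr_ge0//.
  by rewrite mulr_ile1 ?exprn_ge0 ?exprn_ile1 ?subr_ge0// lerBlDr lerDl.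
have ypow N k : \int[mu]_t (y t ^+ k.+1 * (1 - y t) ^+ N * H t) = 0.
  elim: N k => [|N IH] k.
    by under eq_Rintegral do rewrite expr0 mulr1.
  transitivity (\int[mu]_t (y t ^+ k.+1 * (1 - y t) ^+ N * H t
                  - y t ^+ k.+2 * (1 - y t) ^+ N * H t)).
    by apply: eq_Rintegral => t _; rewrite !exprS; ring.
  by rewrite RintegralB ?IH ?subrr//; exact: ipow.
elim=> [|N IH].
  under eq_Rintegral do rewrite expr0 subrr mul0r.
  by rewrite Rintegral_cst// mul0r.
have i1 : Rintegrable mu (fun t => (1 - (1 - y t) ^+ N) * H t).
  apply: (@Rintegrable_bounded _ _ _ _ 1) => //.
    by apply: measurable_funB => //; exact: measurable_funX.
  move=> t; have /andP[y0 y1] := y01 t.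
  rewrite ger0_norm ?subr_ge0 ?exprn_ile1 ?subr_ge0// ?lerBlDr ?lerDl//.
  by rewrite exprn_ge0// subr_ge0.
transitivity (\int[mu]_t ((1 - (1 - y t) ^+ N) * H t
                  + y t ^+ 1 * (1 - y t) ^+ N * H t)).
  by apply: eq_Rintegral => t _; rewrite !exprS; ring.
by rewrite RintegralD ?IH ?ypow ?addr0//; exact: ipow.
Qed.

Lemma sub1X_le_expR (x : R) N : 0 <= x <= 1 -> (1 - x) ^+ N <= expR (- (N%:R * x)).
Proof.
move=> /andP[x0 x1].
rewrite -mulrN expRM_natl; apply: lerXn2r; rewrite ?nnegrE ?subr_ge0 ?expR_ge0//.
by have := expR_ge1Dx (- x).
Qed.

Lemma bernoulli_sub (x : R) N : 0 <= x <= 1 -> 1 - N%:R * x <= (1 - x) ^+ N.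
Proof.
move=> /andP[x0 x1]; elim: N => [|N IH]; first by rewrite mul0r subr0 expr0.
rewrite exprS; apply: le_trans (ler_wpM2l _ IH); last by rewrite subr_ge0.
rewrite -natr1; have : 0 <= N%:R * x ^+ 2 by rewrite mulr_ge0// sqr_ge0.
by rewrite expr2; nra.
Qed.

Lemma expR_ge_sqr (x : R) : 0 <= x -> x ^+ 2 / 4 <= expR x.
Proof.
move=> x0; have := expR_ge1Dx (x / 2) => h.
have -> : expR x = expR (x / 2) ^+ 2 by rewrite -expRM_natl; congr expR; lra.
have : (x / 2) ^+ 2 <= expR (x / 2) ^+ 2.
  by rewrite lerXn2r ?nnegrE ?expR_ge0 ?divr_ge0//; lra.
by rewrite expr_div_n; lra.
Qed.

(** Let [y = expR (- phi)]. The function [1 - (1 - y ^+ n) ^+ N], a polynomial in [y]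
    without constant term, is close to one where [N * y ^+ n] is large and close to
    zero where it is small. With [N] about [n * expR (n * r)], this product is about
    [n * expR (n * (r - phi))]: the limit is the indicator of [phi <= r], and the
    factor [n] puts the level [phi = r] itself on the large side. *)
Lemma sublevel_integral0 (H phi : T -> R) (r : R) : Rintegrable mu H ->
  measurable_fun setT phi -> (forall t, 0 <= phi t) ->
  (forall k, \int[mu]_t (expR (- (k.+1%:R * phi t)) * H t) = 0) ->
  0 <= r -> \int[mu]_t ((phi t <= r)%R%:R * H t) = 0.
Proof.
move=> iH mphi phi0 hk r0.
pose N n := Num.trunc (n%:R * expR (n%:R * r)).
pose y n t := expR (- (n%:R * phi t)).
have my n : measurable_fun setT (y n).
  by apply: measurableT_comp => //; apply: measurableT_comp => //; exact: measurable_funM.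
have y01 n t : 0 <= y n t <= 1.
  by rewrite /y expR_ge0/= -expR0 ler_expR oppr_le0 mulr_ge0.
have cvg := fun hg hh => (@Rintegral_dominated _ _ _ mu
  (fun n t => (1 - (1 - y n.+1 t) ^+ N n.+1) * H t)
  (fun t => (phi t <= r)%R%:R * H t) (fun t => `|H t|)
  (fun n => measurable_funM (measurable_funB (measurable_cst _) (measurable_funX _ (measurable_funB (measurable_cst _) (my n.+1)))) (Rintegrable_meas iH))
  (Rintegrable_norm iH) hg hh).2.
have h0 : \int[mu]_x ((1 - (1 - y n.+1 x) ^+ N n.+1) * H x) @[n --> \oo] --> (0:R).
  apply: cvg_near_cst; apply: nearW => n.
  apply: integral_sub1X0 => // k.
  rewrite -[RHS](hk (n.+1 * k.+1).-1); apply: eq_Rintegral => t _.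
  rewrite -expRM_natl prednK ?muln_gt0//; congr (expR _ * _).
  by rewrite mulrN mulrA -natrM mulnC.
suff h1 : \int[mu]_x ((1 - (1 - y n.+1 x) ^+ N n.+1) * H x) @[n --> \oo] -->
    \int[mu]_t ((phi t <= r)%R%:R * H t).
  by rewrite -(cvg_lim (@Rhausdorff R) h1) (cvg_lim (@Rhausdorff R) h0).
apply: cvg.
- move=> n t; have /andP[y0 y1] := y01 n.+1 t.
  rewrite normrM ler_piMl// ger0_norm ?subr_ge0 ?exprn_ile1 ?subr_ge0// ?lerBlDr ?lerDl//.
  by rewrite exprn_ge0// subr_ge0.
- move=> t; apply: cvgM; last exact: cvg_cst.
  have Nub n : (N n)%:R <= n%:R * expR (n%:R * r).
    by rewrite Num.Theory.truncn_le// mulr_ge0 ?expR_ge0.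
  have Nlb n : n%:R * expR (n%:R * r) - 1 <= (N n)%:R.
    by rewrite lerBlDr natr1 ltW// Num.Theory.truncnS_gt.
  case: (leP (phi t) r) => [pr|rp]; rewrite ?mulr1n ?mulr0n.
  (* On [phi <= r]: [(1 - y) ^+ N] is at most [expR (- (N * y))], with [N * y >= n]. *)
  + rewrite -[X in _ --> X]subr0; apply: cvgB; first exact: cvg_cst.
    apply: (@squeeze_cvgr _ _ _ _ (fun=> 0) (@harmonic R)).
    * apply: nearW => n; have /andP[y0 y1] := y01 n.+1 t.
      rewrite exprn_ge0 ?subr_ge0//=; apply: le_trans (sub1X_le_expR _ (y01 _ _)) _.
      rewrite expRN lef_pV2 ?posrE ?expR_gt0 ?ltr0Sn//.
      apply: (@le_trans _ _ (expR n%:R)); first by rewrite -natr1 addrC expR_ge1Dx.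
      rewrite ler_expR.
      have : (n.+1%:R * expR (n.+1%:R * r) - 1) * y n.+1 t <= (N n.+1)%:R * y n.+1 t.
        exact: ler_wpM2r.
      have h1 : 1 <= expR (n.+1%:R * r) * y n.+1 t.
        by rewrite /y -expRD -expR0 ler_expR -mulrBr mulr_ge0// subr_ge0.
      have h2 : n.+1%:R <= n.+1%:R * (expR (n.+1%:R * r) * y n.+1 t) by rewrite ler_peMr.
      by move=> h3; move: h2; rewrite -natr1 in h3 *; lra.
    * exact: cvg_cst.
    * exact: cvg_harmonic.
  (* Above the level: Bernoulli bounds [1 - (1 - y) ^+ N] by [N * y <= n * expR (- n * e)]. *)
  + pose e := phi t - r; have e0 : 0 < e by rewrite subr_gt0.
    apply: (@squeeze_cvgr _ _ _ _ (fun=> 0) (fun n => 4 / e ^+ 2 * @harmonic R n)).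
    * apply: nearW => n; have /andP[y0 y1] := y01 n.+1 t.
      rewrite subr_ge0 exprn_ile1 ?subr_ge0//=; last by rewrite lerBlDr lerDl.
      apply: (@le_trans _ _ ((N n.+1)%:R * y n.+1 t)).
        by have := bernoulli_sub (N n.+1) (y01 n.+1 t); lra.
      apply: le_trans (ler_wpM2r y0 (Nub n.+1)) _.
      rewrite -[leLHS]mulrA /y -expRD -mulrBr -opprB mulrN -/e expRN.
      have n0 : (0 : R) < n.+1%:R by rewrite ltr0Sn.
      have := expR_ge_sqr (mulr_ge0 (ltW n0) (ltW e0)).
      rewrite exprMn => h.
      have h2 : (expR (n.+1%:R * e))^-1 <= (n.+1%:R ^+ 2 * e ^+ 2 / 4)^-1.
        by rewrite lef_pV2 ?posrE ?expR_gt0// !mulr_gt0// ?exprn_gt0.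
      apply: le_trans (ler_wpM2l (ltW n0) h2) _.
      rewrite le_eqVlt; apply/orP; left; apply/eqP; field.
      by rewrite !gt_eqF.
    * exact: cvg_cst.
    * rewrite -[X in _ --> X](mulr0 (4 / e ^+ 2)); apply: cvgM; first exact: cvg_cst.
      exact: cvg_harmonic.
Qed.
End VanishingMoments.

(** * Gaussians as limits of exponential polynomials *)
Section Gauss.
Context (R : realType).
Notation leb := (@lebesgue_measure R).

Lemma Rintegrable_gauss (c : R) : 0 < c -> Rintegrable leb (fun t : R => expR (- (c * t ^+ 2))).
Proof.
move=> c0; pose s := Num.sqrt (1 / (c * 2)).
have c20 : 0 < 1 / (c * 2) by rewrite divr_gt0// mulr_gt0.
have s0 : s != 0 by rewrite gt_eqF// sqrtr_gt0.
have := integrable_normal_pdf 0 s.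
rewrite (_ : (fun x => _) = EFin \o normal_pdf 0 s)// (normal_pdfE _ s0) => i1.
have := @RintegrableZ _ _ _ leb (normal_peak s)^-1 _ i1.
congr (Rintegrable _ _); apply/funext => t.
rewrite mulKf ?gt_eqF ?normal_peak_gt0// /normal_fun subr0; congr expR.
rewrite sqr_sqrtr ?(ltW c20)// -mulr_natr mulNr; congr (- _).
by field; rewrite gt_eqF.
Qed.

Lemma young_abs (c B t : R) : 0 < c -> B * `|t| <= B ^+ 2 / (4 * c) + c * t ^+ 2.
Proof.
move=> c0; rewrite -(real_normK (num_real t)).
have : 0 <= (B / (2 * c) - `|t|) ^+ 2 * c by rewrite mulr_ge0 ?sqr_ge0// ltW.
suff -> : (B / (2 * c) - `|t|) ^+ 2 * c = B ^+ 2 / (4 * c) + c * `|t| ^+ 2 - B * `|t| by rewrite subr_ge0.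
by field; rewrite gt_eqF.
Qed.

Lemma Rintegrable_gauss_exp (c B : R) : 0 < c ->
  Rintegrable leb (fun t : R => expR (B * `|t| - c * t ^+ 2)).
Proof.
move=> c0; have c20 : 0 < c / 2 by rewrite divr_gt0.
apply: (@Rintegrable_le _ _ _ leb _ (fun t => expR (B ^+ 2 / (4 * (c / 2))) * expR (- (c / 2 * t ^+ 2)))).
- apply: measurableT_comp => //; apply: measurable_funB => //.
    by apply: measurable_funM => //; exact: measurableT_comp.
  by apply: measurable_funM => //; exact: measurable_funX.
- move=> t; rewrite ger0_norm ?expR_ge0// -expRD ler_expR.
  by have := young_abs B t c20; lra.
- exact/RintegrableZ/Rintegrable_gauss.
Qed.

Definition csh (x : R) := (expR x + expR (- x)) / 2.
Definition snh (x : R) := (expR x - expR (- x)) / 2.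

Lemma csh_snh x : csh x ^+ 2 = 1 + snh x ^+ 2.
Proof.
rewrite /csh /snh; have : expR x * expR (- x) = 1 by rewrite -expRD subrr expR0.
by move=> h; rewrite !expr_div_n sqrrD sqrrB -mulrnAl; lra.
Qed.

(** For small [x], [expR x <= (1 - x)^-1] bounds the left-hand side by [(1 - x ^+ 2)^-1];
    for the other [x], [expR `|x|] suffices. *)
Lemma csh_le x : csh x <= expR (2 * x ^+ 2).
Proof.
have [hx|hx] := leP (2 * x ^+ 2) 1.
  have x1 : x ^+ 2 < 1 by lra.
  have xp : 0 < 1 + x by move: x1; rewrite expr2; nra.
  have xm : 0 < 1 - x by move: x1; rewrite expr2; nra.
  have e1 : expR x <= (1 - x)^-1.
    rewrite -[expR x]invrK lef_pV2 ?posrE ?invr_gt0 ?expR_gt0// -expRN.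
    exact: expR_ge1Dx.
  have e2 : expR (- x) <= (1 + x)^-1.
    by rewrite expRN lef_pV2 ?posrE ?expR_gt0//; exact: expR_ge1Dx.
  have e3 : ((1 - x)^-1 + (1 + x)^-1) / 2 = (1 - x ^+ 2)^-1.
    have n1 : 1 - x != 0 by rewrite gt_eqF.
    have n2 : 1 + x != 0 by rewrite gt_eqF.
    have n3 : 1 - x ^+ 2 != 0 by rewrite gt_eqF// subr_gt0.
    by field; apply/and3P.
  apply: (@le_trans _ _ (1 - x ^+ 2)^-1); first by rewrite /csh -e3; lra.
  apply: le_trans (expR_ge1Dx _).
  rewrite -[leRHS]invrK lef_pV2 ?posrE ?subr_gt0// ?invr_gt0; last by nra.
  rewrite -div1r ler_pdivrMr; last by nra.
  by have := sqr_ge0 x; nra.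
have h1 : `|x| <= 2 * x ^+ 2.
  rewrite -(real_normK (num_real x)); have := normr_ge0 x.
  by move: hx; rewrite -(real_normK (num_real x)); nra.
have h2 : expR x <= expR `|x| by rewrite ler_expR ler_norm.
have h3 : expR (- x) <= expR `|x| by rewrite ler_expR -normrN ler_norm.
apply: (@le_trans _ _ (expR `|x|)); first by rewrite /csh; lra.
by rewrite ler_expR.
Qed.

Lemma is_derive_snh0 : is_derive (0 : R) (1 : R) snh 1.
Proof.
have -> : snh = (fun x : R => 2^-1 *: (expR x - expR (- x))).
  by apply/funext => x; rewrite /snh mulrC.
apply: is_derive_eq; rewrite oppr0 expR0.
by rewrite /GRing.scale/=; lra.
Qed.

Lemma snh_seq (t : R) : n.+1%:R * snh (t / (4 * n.+1%:R)) @[n --> \oo] --> t / 4.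
Proof.
have [->|t0] := eqVneq t 0.
  have -> : (fun n : nat => n.+1%:R * snh (0 / (4 * n.+1%:R))) = (fun=> (0 : R) / 4).
    by apply/funext => n; rewrite !mul0r /snh oppr0 subrr mul0r mulr0.
  exact: cvg_cst.
pose u n : R := t / (4 * n.+1%:R).
have u0 n : u n != 0 by rewrite mulf_neq0// invr_neq0// mulf_neq0.
have cu : u n @[n --> \oo] --> (0 : R).
  rewrite -[X in _ --> X](mulr0 (t / 4)).
  have -> : u = (fun n => t / 4 * harmonic n).
    by apply/funext => n; rewrite /u/= invfM mulrA.
  by apply: cvgM; [exact: cvg_cst|exact: cvg_harmonic].
have h1 : h^-1 *: (snh (h *: 1 + 0) - snh 0) @[h --> (0:R)^'] --> (1:R).
  by rewrite -[X in _ --> X](@derive_val _ _ _ _ _ _ _ is_derive_snh0); exact: (@ex_derive _ _ _ _ _ _ _ is_derive_snh0).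
have h2 : (u n)^-1 * snh (u n) @[n --> \oo] --> (1 : R).
  move/cvgr_dnbhsP : h1 => /(_ u (conj u0 cu)).
  apply: cvg_trans; apply: near_eq_cvg; apply: nearW => n.
  by rewrite /snh oppr0 subrr mul0r subr0 addr0 [_ *: 1]mulr1.
rewrite -[X in _ --> X](mulr1 (t / 4)).
have -> : (fun n => n.+1%:R * snh (t / (4 * n.+1%:R))) =
          (fun n => t / 4 * ((u n)^-1 * snh (u n))).
  apply/funext => n; rewrite -/(u n) [RHS]mulrA.
  suff -> : t / 4 * (u n)^-1 = n.+1%:R by [].
  have n0 : (n.+1%:R : R) != 0 by [].
  by rewrite /u; move: (n.+1%:R : R) n0 => N N0; field; rewrite N0 t0.
by apply: cvgM => //; exact: cvg_cst.
Qed.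

(** An exponential polynomial ([qstepE]), equal to [1 - t ^+ 2 / (16 * m)] up to higher order
    in [m^-1] for [m = n.+1 ^ 2], so that its [m]-th power tends to a Gaussian. *)
Definition qstep n (t : R) : R := 1 - snh (t / (4 * n.+1%:R)) ^+ 2.

Lemma qstepE n t : qstep n t = 3 / 2
  - 4^-1 * expR (2 / (4 * n.+1%:R) * t) - 4^-1 * expR (- 2 / (4 * n.+1%:R) * t).
Proof.
rewrite /qstep /snh.
have -> : 2 / (4 * n.+1%:R) * t = 2%:R * (t / (4 * n.+1%:R)) by rewrite -mulrA (mulrC _ t).
have -> : - 2 / (4 * n.+1%:R) * t = 2%:R * - (t / (4 * n.+1%:R)) by rewrite -mulrA (mulrC _ t) mulNr mulrN.
rewrite !expRM_natl; move: (t / _) => x.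
have : expR x * expR (- x) = 1 by rewrite -expRD subrr expR0.
by rewrite !expr2; nra.
Qed.

(** Both [1 - snh ^+ 2] and its opposite are below [csh ^+ 2]. *)
Lemma qstep_le n t : `|qstep n t ^+ (n.+1 ^ 2)| <= expR (t ^+ 2 / 4).
Proof.
set x := t / (4 * n.+1%:R).
have h : `|qstep n t| <= expR (4 * x ^+ 2).
  have h1 : `|qstep n t| <= csh x ^+ 2.
    by rewrite csh_snh /qstep -/x ler_norml; have := sqr_ge0 (snh x); lra.
  apply: le_trans h1 _.
  have -> : expR (4 * x ^+ 2) = expR (2 * x ^+ 2) ^+ 2.
    by rewrite -expRM_natl; congr expR; lra.
  rewrite lerXn2r ?nnegrE ?expR_ge0 ?csh_le//.
  by rewrite /csh divr_ge0// addr_ge0 ?expR_ge0.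
rewrite normrX; apply: le_trans (lerXn2r _ _ _ h) _; rewrite ?nnegrE ?expR_ge0//.
rewrite -expRM_natl ler_expR le_eqVlt; apply/orP; left; apply/eqP.
have n0 : (n.+1%:R : R) != 0 by [].
by rewrite natrX /x; move: (n.+1%:R : R) n0 => N N0; field.
Qed.

(** With [u] of order [1 / N], the power [(1 - u) ^+ N] is squeezed between
    [expR (- (N * u / (1 - u)))] and [expR (- (N * u))]. *)
Lemma cvg_qstep t : qstep n t ^+ (n.+1 ^ 2) @[n --> \oo] --> expR (- (t ^+ 2 / 16)).
Proof.
pose w n : R := (n.+1%:R * snh (t / (4 * n.+1%:R))) ^+ 2.
pose N n : R := (n.+1 ^ 2)%:R.
have N0 n : 0 < N n by rewrite ltr0n expn_gt0.
have qE n : qstep n t = 1 - w n / N n.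
  have h (a s : R) : a != 0 -> (a * s) ^+ 2 / a ^+ 2 = s ^+ 2 by move=> a0; field.
  by rewrite /qstep /w /N natrX h.
have cw : w n @[n --> \oo] --> t ^+ 2 / 16.
  have -> : t ^+ 2 / 16 = (t / 4) ^+ 2 by field.
  by rewrite expr2; apply: cvgM; exact: snh_seq.
have cwN : w n / N n @[n --> \oo] --> (0 : R).
  rewrite -[X in _ --> X](mulr0 (t ^+ 2 / 16)); apply: cvgM => //.
  apply: (@squeeze_cvgr _ _ _ _ (fun=> 0) (@harmonic R)).
  - apply: nearW => n; rewrite invr_ge0 ltW//= lef_pV2 ?posrE// ler_nat.
    by rewrite -[leqLHS]expn1 leq_pexp2l.
  - exact: cvg_cst.
  - exact: cvg_harmonic.
have e1 : expR (- w n) @[n --> \oo] --> expR (- (t ^+ 2 / 16)).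
  exact: (cvg_comp _ _ (cvgN cw) (@continuous_expR R _)).
have e2 : expR (- (w n / (1 - w n / N n))) @[n --> \oo] --> expR (- (t ^+ 2 / 16)).
  have c1 : 1 - w n / N n @[n --> \oo] --> (1 : R).
    by rewrite -[X in _ --> X]subr0; apply: cvgB => //; exact: cvg_cst.
  have c2 : (1 - w n / N n)^-1 @[n --> \oo] --> (1 : R).
    by rewrite -[X in _ --> X]invr1; apply: cvgV.
  have := cvg_comp _ _ (cvgN (cvgM cw c2)) (@continuous_expR R _).
  rewrite mulr1 => h; exact: h.
apply: squeeze_cvgr e2 e1.
have /cvgrPdist_lt/(_ 1 ltr01) := cwN; apply: filterS => n; rewrite sub0r normrN => wN1.
have w0 : 0 <= w n / N n by rewrite divr_ge0 ?sqr_ge0// ltW.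
rewrite ger0_norm// in wN1.
have wNn : N n * (w n / N n) = w n by rewrite mulrC divfK// gt_eqF.
rewrite qE; apply/andP; split; last first.
  rewrite -[X in expR (- X)]wNn; apply: sub1X_le_expR; rewrite w0; exact: ltW.
have -> : - (w n / (1 - w n / N n)) = (n.+1 ^ 2)%:R * - (w n / N n / (1 - w n / N n)).
  by rewrite mulrN mulrA -/(N n) wNn.
rewrite expRM_natl lerXn2r ?nnegrE ?expR_ge0 ?subr_ge0 ?(ltW wN1)//.
move: (w n / N n) w0 wN1 => u u0 u1.
rewrite expRN -[leRHS]invrK lef_pV2 ?posrE ?expR_gt0 ?invr_gt0 ?subr_gt0//.
apply: le_trans (expR_ge1Dx _).
rewrite le_eqVlt; apply/orP; left; apply/eqP; field.
by rewrite gt_eqF// subr_gt0.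
Qed.

End Gauss.

(** * Injectivity of the Laplace transform *)
Section LaplaceInj.
Context (R : realType).
Notation leb := (@lebesgue_measure R).

Lemma measurable_expR_lin (c : R) : measurable_fun setT (fun t : R => expR (c * t)).
Proof. by apply: measurableT_comp => //; exact: measurable_funM. Qed.

Lemma measurable_qstep n : measurable_fun setT (@qstep R n).
Proof.
rewrite (_ : qstep n = fun t => 3 / 2
  - 4^-1 * expR (2 / (4 * n.+1%:R) * t) - 4^-1 * expR (- 2 / (4 * n.+1%:R) * t)); last first.
  by apply/funext => t; rewrite qstepE.
by apply: measurable_funB; [apply: measurable_funB => //|]; apply: measurable_funM => //;
  exact: measurable_expR_lin.
Qed.

(** The powers of [qstep] are exponential polynomials, against which [G] integrates to
    zero; dominated convergence passes to their limit, the factor [expR (t ^+ 2 / 4)] of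
    the bound [qstep_le] being absorbed by the decay of [G]. *)
Lemma laplace_gauss_step (G : R -> R) : measurable_fun setT G ->
  (forall tau, Rintegrable leb (fun t : R => expR (t ^+ 2 / 4) * (expR (tau * t) * G t))) ->
  (forall tau, \int[leb]_t (expR (tau * t) * G t) = 0) ->
  forall tau, \int[leb]_t (expR (- (t ^+ 2 / 16)) * (expR (tau * t) * G t)) = 0.
Proof.
move=> mG iG hG tau.
have meG s : measurable_fun setT (fun t : R => expR (s * t) * G t).
  by apply: measurable_funM => //; exact: measurable_expR_lin.
have iG0 s : Rintegrable leb (fun t : R => expR (s * t) * G t).
  apply: (@Rintegrable_le _ _ _ leb _ _ (meG s) _ (Rintegrable_norm (iG s))) => t.
  rewrite [leRHS]normrM ger0_norm ?expR_ge0// ler_peMl// -expR0 ler_expR.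
  by rewrite divr_ge0// sqr_ge0.
have poly n N s : Rintegrable leb (fun t : R => qstep n t ^+ N * (expR (s * t) * G t)) /\
    \int[leb]_t (qstep n t ^+ N * (expR (s * t) * G t)) = 0.
  elim: N s => [|N IH] s.
    split; first by apply: eq_integrable (iG0 s) => // t _; rewrite /= expr0 mul1r.
    by under eq_Rintegral do rewrite expr0 mul1r; exact: hG.
  pose a := 2 / (4 * n.+1%:R) : R; pose b := - 2 / (4 * n.+1%:R) : R.
  have e t : qstep n t ^+ N.+1 * (expR (s * t) * G t) =
      3 / 2 * (qstep n t ^+ N * (expR (s * t) * G t))
      - 4^-1 * (qstep n t ^+ N * (expR ((a + s) * t) * G t))
      - 4^-1 * (qstep n t ^+ N * (expR ((b + s) * t) * G t)).
    by rewrite exprS {1}qstepE -/a -/b !mulrDl !expRD; ring.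
  have [i0 z0] := IH s; have [ia za] := IH (a + s); have [ib zb] := IH (b + s).
  have I1 := RintegrableB (RintegrableZ (3 / 2) i0) (RintegrableZ 4^-1 ia).
  split.
    apply: eq_integrable (RintegrableB I1 (RintegrableZ 4^-1 ib)) => // t _.
    by rewrite /= e.
  under eq_Rintegral do rewrite e.
  rewrite (RintegralB measurableT I1 (RintegrableZ 4^-1 ib)).
  rewrite (RintegralB measurableT (RintegrableZ (3 / 2) i0) (RintegrableZ 4^-1 ia)).
  by rewrite !RintegralZl// z0 za zb !mulr0 !subr0.
have mq n : measurable_fun setT (fun t : R => qstep n t ^+ (n.+1 ^ 2) * (expR (tau * t) * G t)).
  by apply: measurable_funM => //; apply: measurable_funX; exact: measurable_qstep.
have [||_ h1] := @Rintegral_dominated _ _ _ leb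
  (fun n (t : R) => qstep n t ^+ (n.+1 ^ 2) * (expR (tau * t) * G t))
  (fun t : R => expR (- (t ^+ 2 / 16)) * (expR (tau * t) * G t))
  (fun t : R => `|expR (t ^+ 2 / 4) * (expR (tau * t) * G t)|) mq (Rintegrable_norm (iG tau)).
- move=> n t; rewrite normrM [leRHS]normrM ler_wpM2r//.
  by rewrite (le_trans (qstep_le n t))// ler_norm.
- by move=> t; apply: cvgM; [exact: cvg_qstep|exact: cvg_cst].
rewrite -(cvg_lim (@Rhausdorff R) h1); apply: lim_near_cst => //.
by apply: nearW => n; exact: (poly n _ tau).2.
Qed.

(** One Gaussian factor is gained at each step. The hypothesis of the next step asks only
    for the decay of [H], which the factors already gained do not spoil. *)
Lemma laplace_gauss (A B : R) (H : R -> R) : measurable_fun setT H ->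
  (forall t, `|H t| <= A * expR (B * `|t| - t ^+ 2 / 2)) ->
  (forall tau, \int[leb]_t (expR (tau * t) * H t) = 0) ->
  forall (k : nat) tau,
  \int[leb]_t (expR (tau * t) * (expR (- (k%:R * (t ^+ 2 / 16))) * H t)) = 0.
Proof.
move=> mH hH h0.
have mE (k : nat) : measurable_fun setT (fun t : R => expR (- (k%:R * (t ^+ 2 / 16)))).
  apply: measurableT_comp => //; apply: measurableT_comp => //; apply: measurable_funM => //.
  by apply: measurable_funM => //; exact: measurable_funX.
elim=> [|k IH] tau.
  by under eq_Rintegral do rewrite mul0r oppr0 expR0 mul1r; exact: h0.
pose G t := expR (- (k%:R * (t ^+ 2 / 16))) * H t.
have mG : measurable_fun setT G := measurable_funM (mE k) mH.
have iG s : Rintegrable leb (fun t : R => expR (t ^+ 2 / 4) * (expR (s * t) * G t)).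
  apply: (@Rintegrable_le _ _ _ leb _ (fun t : R => A * expR ((`|s| + B) * `|t| - 4^-1 * t ^+ 2))).
  - apply: measurable_funM; last by apply: measurable_funM => //; exact: measurable_expR_lin.
    by apply: measurableT_comp => //; apply: measurable_funM => //; exact: measurable_funX.
  - move=> t; rewrite /G !normrM !(ger0_norm (expR_ge0 _)).
    have e1 : expR (- (k%:R * (t ^+ 2 / 16))) <= 1.
      by rewrite -expR0 ler_expR oppr_le0 mulr_ge0// divr_ge0// sqr_ge0.
    have e2 : expR (s * t) <= expR (`|s| * `|t|) by rewrite ler_expR -normrM ler_norm.
    have e3 := hH t.
    apply: (@le_trans _ _ (expR (t ^+ 2 / 4) * (expR (`|s| * `|t|) *
      (1 * (A * expR (B * `|t| - t ^+ 2 / 2)))))).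
      rewrite ler_wpM2l ?expR_ge0// ler_pM ?mulr_ge0 ?expR_ge0//.
      by rewrite ler_pM ?expR_ge0.
    rewrite mul1r (mulrCA _ A) (mulrCA _ A) -!expRD le_eqVlt; apply/orP; left.
    by apply/eqP; congr (_ * expR _); lra.
  - exact/RintegrableZ/Rintegrable_gauss_exp.
rewrite -(laplace_gauss_step mG iG IH tau); apply: eq_Rintegral => t _.
rewrite -natr1 mulrDl mul1r opprD expRD /G.
by ring.
Qed.

(** For [tau = k * s / 8] the Gaussian moments of [H] are, up to a constant factor, its
    moments against the powers of [expR (- ((t - s) ^+ 2 / 16))]; the sublevel sets of the
    exponent are the intervals centred at [s]. So [H] has integral zero over every
    interval, and Lebesgue differentiation concludes. *)
Lemma laplace_inj (A B : R) (H : R -> R) : measurable_fun setT H ->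
  (forall t, `|H t| <= A * expR (B * `|t| - t ^+ 2 / 2)) ->
  (forall tau, \int[leb]_t (expR (tau * t) * H t) = 0) ->
  {ae leb, forall t, H t = 0}.
Proof.
move=> mH hH h0.
have iH : Rintegrable leb H.
  apply: (@Rintegrable_le _ _ _ leb _ (fun t : R => A * expR (B * `|t| - 2^-1 * t ^+ 2))) => //.
    by move=> t; rewrite (mulrC 2^-1); exact: hH.
  exact/RintegrableZ/Rintegrable_gauss_exp.
have hlap := laplace_gauss mH hH h0.
have ball0 s r : 0 <= r -> \int[leb]_t (((t - s) ^+ 2 / 16 <= r)%R%:R * H t) = 0.
  move=> r0; apply: (@sublevel_integral0 _ _ _ leb _ (fun t : R => (t - s) ^+ 2 / 16)) => //.
  - by apply: measurable_funM => //; apply: measurable_funX; exact: measurable_funB.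
  - by move=> t; rewrite divr_ge0// sqr_ge0.
  - move=> k.
    have := hlap k.+1 (k.+1%:R * s / 8); set c := expR (- (k.+1%:R * (s ^+ 2 / 16))).
    move=> h; rewrite -[RHS](mulr0 c) -h -RintegralZl//.
      apply: eq_Rintegral => t _; rewrite mulrA mulrA -!expRD mulrA.
      by rewrite /c -!expRD; congr (expR _ * _); field.
    apply: (@Rintegrable_le _ _ _ leb _ (fun t : R => A * expR ((`|k.+1%:R * s / 8| + B) * `|t| - 2^-1 * t ^+ 2))).
    + apply: measurable_funM; first exact: measurable_expR_lin.
      apply: measurable_funM => //; apply: measurableT_comp => //; apply: measurableT_comp => //.
      apply: measurable_funM => //.
      by apply: measurable_funM => //; exact: measurable_funX.
    + move=> t; move: (k.+1%:R * s / 8) => x; rewrite !normrM !(ger0_norm (expR_ge0 _)).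
      have e1 : expR (- (k.+1%:R * (t ^+ 2 / 16))) <= 1.
        by rewrite -expR0 ler_expR oppr_le0 mulr_ge0// divr_ge0// sqr_ge0.
      have e2 : expR (x * t) <= expR (`|x| * `|t|) by rewrite ler_expR -normrM ler_norm.
      have e3 := hH t.
      apply: (@le_trans _ _ (expR (`|x| * `|t|) * (1 * (A * expR (B * `|t| - t ^+ 2 / 2))))).
        by rewrite ler_pM ?mulr_ge0 ?expR_ge0// ler_pM ?expR_ge0.
      rewrite mul1r (mulrCA _ A) -!expRD le_eqVlt; apply/orP; left.
      by apply/eqP; congr (_ * expR _); lra.
    + exact/RintegrableZ/Rintegrable_gauss_exp.
have itv0 (a b : R) : a <= b -> \int[leb]_(t in `[a, b]) H t = 0.
  move=> ab; rewrite Rintegral_mkcond.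
  rewrite -[RHS](ball0 ((a + b) / 2) ((b - a) ^+ 2 / 64)) ?divr_ge0 ?sqr_ge0//.
  apply: eq_Rintegral => t _; rewrite patchE.
  have -> : (t \in `[a, b]%classic) = ((t - (a + b) / 2) ^+ 2 / 16 <= (b - a) ^+ 2 / 64).
    rewrite mem_setE in_itv/=.
    have -> : ((t - (a + b) / 2) ^+ 2 / 16 <= (b - a) ^+ 2 / 64) = (0 <= (t - a) * (b - t)).
      by apply/idP/idP => h; rewrite !expr2 in h *; nra.
    apply/andP/idP => [[h1 h2]|h]; first by rewrite mulr_ge0// subr_ge0.
    by split; rewrite leNgt; apply/negP => h'; nra.
  by case: ifP; rewrite ?mul1r ?mul0r.
have iHs (D : set R) : measurable D -> leb.-integrable D (EFin \o H).
  by move=> mD; apply: integrableS iH.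
have lH : locally_integrable [set: R] H.
  by apply: open_integrable_locally => //; exact: openT.
have := FTC1Ny (fun y => iHs _ (measurable_itv _)) lH.
apply: (@filterS _ _ (ae_filter_ringOfSetsType leb)) => x [_ <-].
have -> : (fun x : R => \int[leb]_(t in [set` `]-oo, x]]) H t) =
          (fun=> \int[leb]_(t in [set` `]-oo, 0%R]]) H t); last by rewrite derive1_cst.
have key (u v : R) : u <= v -> \int[leb]_(t in [set` `]-oo, v]]) H t = \int[leb]_(t in [set` `]-oo, u]]) H t.
  move=> uv; apply/eqP; rewrite -subr_eq0 Rintegral_itvB//; last exact: iHs.
  by rewrite Rintegral_itv_obnd_cbnd ?itv0//; exact: iHs.
by apply/funext => y; have [/key|/ltW/key] := leP y 0.
Qed.
End LaplaceInj.

(** * The Poisson kernel *)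
Section Poisson.
Context (R : realType).
Notation leb := (@lebesgue_measure R).

(** The Poisson kernel of the half plane, at height [l], without the factor [pi^-1]. *)
Definition pk (l b : R) : R := l / (l ^+ 2 + b ^+ 2).

Lemma pk_den_gt0 l b : 0 < l -> 0 < l ^+ 2 + b ^+ 2 :> R.
Proof. by move=> l0; rewrite ltr_pwDl ?exprn_gt0// sqr_ge0. Qed.

Lemma pk_ge0 l b : 0 < l -> 0 <= pk l b.
Proof. by move=> l0; rewrite divr_ge0 ?ltW// ?pk_den_gt0. Qed.

Lemma continuous_pk l : 0 < l -> continuous (pk l).
Proof.
move=> l0 b; apply: cvgM; first exact: cvg_cst.
apply: cvgV; first by rewrite gt_eqF// pk_den_gt0.
apply: cvgD; first exact: cvg_cst.
exact: exprn_continuous.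
Qed.

Lemma measurable_pk l : 0 < l -> measurable_fun setT (pk l).
Proof. by move=> l0; apply: continuous_measurable_fun; exact: continuous_pk. Qed.

Lemma integral_pk_ereal l : 0 < l -> (\int[leb]_b (pk l b)%:E = (pi : R)%:E)%E.
Proof.
move=> l0.
rewrite (@ge0_symfun_integralT _ (pk l)).
- rewrite -set_itvcy (@ge0_continuous_FTC2y _ (pk l) (fun b => atan (b / l)) 0 (pi / 2)).
  + by rewrite mul0r atan0 sube0 -EFinM; congr EFin; field.
  + by move=> b _; exact: pk_ge0.
  + by apply: continuous_subspaceT => b; exact: continuous_pk.
  + have h : b / l @[b --> +oo] --> +oo.
      by apply: gt0_cvgMly; [rewrite invr_gt0|exact: cvg_id].
    exact: (cvg_comp _ _ h (@cvgy_atan R)).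
  + move=> x x0; apply: ex_derive.
  + apply: cvg_at_right_filter; apply: continuous_comp; last exact: continuous_atan.
    by apply: cvgM; [exact: cvg_id|exact: cvg_cst].
  + move=> x _; rewrite derive1E derive_val /GRing.scale/= /pk; field.
    by rewrite !gt_eqF// ?pk_den_gt0.
- by move=> b; exact: pk_ge0.
- exact: continuous_pk.
- by move=> b; rewrite /pk/= sqrrN.
Qed.

Lemma Rintegrable_pk l : 0 < l -> Rintegrable leb (pk l).
Proof.
move=> l0; apply/integrableP; split; first by apply/measurable_EFinP; exact: measurable_pk.
under eq_integral => b _ do rewrite /= ger0_norm ?pk_ge0//.
by rewrite integral_pk_ereal// ltry.
Qed.

Lemma integral_pk l : 0 < l -> \int[leb]_b pk l b = pi.
Proof. by move=> l0; rewrite /Rintegral integral_pk_ereal//. Qed.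

Definition lapcos_prim (m b v : R) := - (expR (- m * v) / m)
  + expR (- m * v) * (b * sin (v * b) - m * cos (v * b)) / (m ^+ 2 + b ^+ 2).

Lemma lapcos_primE (m b v : R) : 0 < m ->
  is_derive (v : R) (1 : R) (lapcos_prim m b) (expR (- m * v) * (1 + cos (v * b))).
Proof.
move=> m0; rewrite /lapcos_prim.
apply: is_derive_eq; rewrite /GRing.scale/=.
field.
by rewrite !gt_eqF// ?pk_den_gt0.
Qed.

Lemma continuous_derive (f : R -> R) (x d : R) : is_derive x (1 : R) f d -> {for x, continuous f}.
Proof. by move=> h; apply/differentiable_continuous/derivable1_diffP; exact: ex_derive. Qed.

Lemma cvg_lapcos_prim (m b : R) : 0 < m -> lapcos_prim m b v @[v --> +oo] --> (0 : R).
Proof.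
move=> m0; set C := m^-1 + (`|b| + m) / (m ^+ 2 + b ^+ 2).
have ce : expR (- m * v) @[v --> +oo] --> (0 : R).
  have h : m * v @[v --> +oo] --> +oo by apply: gt0_cvgMry; [|exact: cvg_id].
  have := cvg_comp _ _ h (@cvgr_expR R).
  by apply: cvg_trans; apply: near_eq_cvg; apply: nearW => v /=; rewrite mulNr.
have cC : C * expR (- m * v) @[v --> +oo] --> (0 : R).
  by rewrite -[X in _ --> X](mulr0 C); apply: cvgM => //; exact: cvg_cst.
have cN : - (C * expR (- m * v)) @[v --> +oo] --> (0 : R).
  by rewrite -[X in _ --> X]oppr0; exact: cvgN.
apply: squeeze_cvgr cN cC; apply: nearW => v; rewrite -ler_norml /C /lapcos_prim.
have s1 : `|sin (v * b)| <= 1 by rewrite ler_norml sin_geN1 sin_le1.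
have c1 : `|cos (v * b)| <= 1 by rewrite ler_norml cos_geN1 cos_le1.
have D0 := pk_den_gt0 b m0.
set E := expR (- m * v); have E0 : 0 <= E := expR_ge0 _.
apply: le_trans (ler_normD _ _) _.
rewrite normrN [`|_ / m|]ger0_norm ?divr_ge0 ?(ltW m0)// mulrDl (mulrC E) lerD2l.
rewrite !normrM (ger0_norm E0) [`|_^-1|]ger0_norm ?invr_ge0 ?(ltW D0)//.
rewrite [leRHS]mulrC mulrA ler_wpM2r ?invr_ge0 ?(ltW D0)// ler_wpM2l//.
apply: le_trans (ler_normB _ _) _; rewrite !normrM (gtr0_norm m0) lerD//.
  by rewrite ler_piMr.
by rewrite ler_piMr// ltW.
Qed.

Lemma continuous_expabs (m : R) : continuous (fun v : R => expR (- m * `|v|)).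
Proof.
move=> v; apply: (@continuous_comp _ _ _ (fun v => - m * `|v|) expR); last exact: continuous_expR.
by apply: cvgM; [exact: cvg_cst|exact: norm_continuous].
Qed.

Lemma continuous_cosM (b : R) : continuous (fun v : R => cos (v * b)).
Proof.
move=> v; apply: (@continuous_comp _ _ _ (fun v : R => v * b) (cos : R -> R)); last exact: continuous_cos.
by apply: cvgM; [exact: cvg_id|exact: cvg_cst].
Qed.

(** The summand [1] makes the integrand nonnegative, so that its integrability and its
    value come together from the fundamental theorem on a half-line. *)
Lemma integral_lapcos1_ereal (m b : R) : 0 < m ->
  (\int[leb]_v (expR (- m * `|v|) * (1 + cos (v * b)))%:E = (2 * (m^-1 + pk m b))%:E)%E.
Proof.
move=> m0; pose f v := expR (- m * `|v|) * (1 + cos (v * b)).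
have f0 v : 0 <= f v.
  by rewrite mulr_ge0 ?expR_ge0// addrC -lerBlDr sub0r cos_geN1.
have cf : continuous f.
  move=> v; apply: cvgM; first exact: continuous_expabs.
  by apply: cvgD; [exact: cvg_cst|exact: continuous_cosM].
rewrite (@ge0_symfun_integralT _ f)//; last first.
  by move=> v; rewrite /f/= normrN (mulNr v) cosN.
rewrite -set_itvcy (@ge0_continuous_FTC2y _ f (lapcos_prim m b) 0 0)//.
- rewrite -EFinB -EFinM; congr EFin; rewrite /lapcos_prim /pk mulr0 mul0r expR0 sin0 cos0.
  by field; rewrite !gt_eqF// pk_den_gt0.
- exact: continuous_subspaceT.
- exact: cvg_lapcos_prim.
- by apply: cvg_at_right_filter; exact: (continuous_derive (lapcos_primE b 0 m0)).
- move=> v; rewrite in_itv/= andbT => v0.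
  rewrite derive1E (@derive_val _ _ _ _ _ _ _ (lapcos_primE b v m0)) /f gtr0_norm//.
Qed.

Lemma Rintegrable_lapcos1 (m b : R) : 0 < m ->
  Rintegrable leb (fun v : R => expR (- m * `|v|) * (1 + cos (v * b))).
Proof.
move=> m0; apply/integrableP; split.
  apply/measurable_EFinP; apply: measurable_funM.
    by apply: continuous_measurable_fun; exact: continuous_expabs.
  by apply: measurable_funD => //; apply: continuous_measurable_fun; exact: continuous_cosM.
have f0 v : 0 <= expR (- m * `|v|) * (1 + cos (v * b)).
  by rewrite mulr_ge0 ?expR_ge0// addrC -lerBlDr sub0r cos_geN1.
under eq_integral => v _ do rewrite /= (ger0_norm (f0 v)).
by rewrite integral_lapcos1_ereal// ltry.
Qed.

Lemma Rintegrable_expabs (m : R) : 0 < m -> Rintegrable leb (fun v : R => expR (- m * `|v|)).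
Proof.
move=> m0; have := RintegrableZ 2^-1 (Rintegrable_lapcos1 0 m0).
by apply: eq_integrable => // v _ /=; congr EFin; rewrite mulr0 cos0; field.
Qed.

Lemma integral_expabs (m : R) : 0 < m -> \int[leb]_v expR (- m * `|v|) = 2 / m.
Proof.
move=> m0; transitivity (\int[leb]_v (2^-1 * (expR (- m * `|v|) * (1 + cos (v * 0))))).
  by apply: eq_Rintegral => v _; rewrite mulr0 cos0; field.
rewrite RintegralZl//; last exact: Rintegrable_lapcos1.
rewrite /Rintegral integral_lapcos1_ereal//= /pk; field.
by rewrite !gt_eqF// ?pk_den_gt0//  ?exprn_gt0.
Qed.

Lemma Rintegrable_lapcos (m b : R) : 0 < m ->
  Rintegrable leb (fun v : R => expR (- m * `|v|) * cos (v * b)).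
Proof.
move=> m0; have := RintegrableB (Rintegrable_lapcos1 b m0) (Rintegrable_expabs m0).
by apply: eq_integrable => // v _ /=; congr EFin; rewrite mulrDr mulr1 addrC addKr.
Qed.

Lemma integral_lapcos (m b : R) : 0 < m ->
  \int[leb]_v (expR (- m * `|v|) * cos (v * b)) = 2 * pk m b.
Proof.
move=> m0; transitivity (\int[leb]_v (expR (- m * `|v|) * (1 + cos (v * b)) - expR (- m * `|v|))).
  by apply: eq_Rintegral => v _; rewrite mulrDr mulr1 addrC addKr.
rewrite RintegralB//; [|exact: Rintegrable_lapcos1|exact: Rintegrable_expabs].
rewrite integral_expabs// /Rintegral integral_lapcos1_ereal//=.
by rewrite mulrDr addrC addKr.
Qed.

(** The semigroup property of the Poisson kernel at the origin, by partial fractions;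
    these need [l != m]. *)
Lemma integral_pk2 (l m : R) : 0 < l -> l < m ->
  \int[leb]_b (pk l b * pk m b) = pi / (l + m).
Proof.
move=> l0 lm; have m0 : 0 < m := lt_trans l0 lm.
have lm2 : 0 < m ^+ 2 - l ^+ 2 by rewrite subr_sqr mulr_gt0 ?subr_gt0 ?addr_gt0.
transitivity (\int[leb]_b ((m / (m ^+ 2 - l ^+ 2)) * pk l b - (l / (m ^+ 2 - l ^+ 2)) * pk m b)).
  apply: eq_Rintegral => b _; rewrite /pk; field.
  by rewrite !gt_eqF// ?pk_den_gt0.
rewrite RintegralB//; [|exact: (RintegrableZ _ (Rintegrable_pk l0))|exact: (RintegrableZ _ (Rintegrable_pk m0))].
rewrite (RintegralZl _ measurableT (Rintegrable_pk l0)) (RintegralZl _ measurableT (Rintegrable_pk m0)).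
rewrite !integral_pk//; field.
by rewrite !gt_eqF// addr_gt0.
Qed.

End Poisson.

(** * The Fourier transform of the Poisson kernel *)
Section PoissonFormula.
Context (R : realType).
Notation leb := (@lebesgue_measure R).

Lemma measurable_cos : measurable_fun setT (cos : R -> R).
Proof. by apply: continuous_measurable_fun; exact: continuous_cos. Qed.

Lemma normr_cos_le1 (x : R) : `|cos x| <= 1.
Proof. by rewrite ler_norml cos_geN1 cos_le1. Qed.

Definition cosint (l v : R) := \int[leb]_b (cos (v * b) * pk l b).

Lemma Rintegrable_cospk (l v : R) : 0 < l -> Rintegrable leb (fun b : R => cos (v * b) * pk l b).
Proof.
move=> l0; apply: (@Rintegrable_bounded _ _ _ leb 1 (fun b : R => cos (v * b))).
- by apply: measurableT_comp; [exact: measurable_cos|exact: measurable_funM].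
- by move=> b; exact: normr_cos_le1.
- exact: Rintegrable_pk.
Qed.

Lemma continuous_cosint (l : R) : 0 < l -> continuous (cosint l).
Proof.
move=> l0 v; apply/(@cvg_nbhsP _ R^o) => u uv.
have [||||_] := @Rintegral_dominated _ _ _ leb (fun n (b : R) => cos (u n * b) * pk l b)
  (fun b : R => cos (v * b) * pk l b) (pk l).
- by move=> n; exact: Rintegrable_meas (Rintegrable_cospk (u n) l0).
- exact: Rintegrable_pk.
- by move=> n b; rewrite normrM (ger0_norm (pk_ge0 _ l0)) ler_piMl ?pk_ge0// normr_cos_le1.
- move=> b; apply: cvgM; last exact: cvg_cst.
  apply: continuous_cvg; first exact: continuous_cos.
  by apply: cvgM; [exact: uv|exact: cvg_cst].
exact.
Qed.

Lemma cosint_bound (l v : R) : 0 < l -> `|cosint l v| <= pi.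
Proof.
move=> l0; apply: le_trans (le_normr_Rintegral measurableT (Rintegrable_cospk v l0)) _.
rewrite -(integral_pk l0); apply: le_Rintegral => //.
- exact: Rintegrable_norm (Rintegrable_cospk v l0).
- exact: Rintegrable_pk.
- by move=> b _; rewrite normrM (ger0_norm (pk_ge0 _ l0)) ler_piMl ?pk_ge0// normr_cos_le1.
Qed.

(** By Fubini the left-hand side is twice the integral of [pk l * pk m]. *)
Lemma laplace_cosint (l m : R) : 0 < l -> l < m ->
  \int[leb]_v (expR (- m * `|v|) * cosint l v) = 2 * pi / (l + m).
Proof.
move=> l0 lm; have m0 := lt_trans l0 lm.
pose h (z : R * R) := expR (- m * `|z.1|) * (cos (z.1 * z.2) * pk l z.2).
have ih : Rintegrable (leb \x leb)%E h.
  apply: (@Rintegrable_prod _ _ _ _ _ leb leb h (fun v => expR (- m * `|v|) * pi)).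
  - apply: measurable_funM.
      apply: (measurableT_comp (continuous_measurable_fun (@continuous_expabs R m))).
      exact: measurable_fst.
    apply: measurable_funM.
      apply: measurableT_comp; first exact: measurable_cos.
      by apply: measurable_funM; [exact: measurable_fst|exact: measurable_snd].
    by apply: measurableT_comp; [exact: measurable_pk|exact: measurable_snd].
  - move=> v; have := RintegrableZ (expR (- m * `|v|)) (Rintegrable_cospk v l0).
    exact.
  - move=> v; rewrite -(integral_pk l0) -RintegralZl//; last exact: Rintegrable_pk.
    apply: le_Rintegral => //.
    + by have := Rintegrable_norm (RintegrableZ (expR (- m * `|v|)) (Rintegrable_cospk v l0)).
    + by have := RintegrableZ (expR (- m * `|v|)) (Rintegrable_pk l0).
    + move=> b _; rewrite normrM (ger0_norm (expR_ge0 _)) ler_wpM2l ?expR_ge0//.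
      by rewrite normrM (ger0_norm (pk_ge0 _ l0)) ler_piMl ?pk_ge0// normr_cos_le1.
  - apply: eq_integrable (RintegrableZ pi (Rintegrable_expabs m0)) => // v _.
    by rewrite /= mulrC.
transitivity (\int[leb]_v \int[leb]_b h (v, b)).
  by apply: eq_Rintegral => v _; rewrite /h /= RintegralZl//; exact: Rintegrable_cospk.
rewrite -Rintegral_fubini1// Rintegral_fubini2//.
transitivity (\int[leb]_b (2 * (pk l b * pk m b))).
  apply: eq_Rintegral => b _; rewrite /h/=.
  under eq_Rintegral do rewrite mulrA mulrC.
  by rewrite RintegralZl ?integral_lapcos//; [ring|exact: Rintegrable_lapcos].
rewrite RintegralZl//.
  by rewrite integral_pk2// mulrA.
apply: (@Rintegrable_bounded _ _ _ leb l^-1); last exact: Rintegrable_pk.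
- exact: measurable_pk.
- move=> b; rewrite ger0_norm ?pk_ge0// /pk ler_pdivrMr ?pk_den_gt0//.
  by rewrite mulrDr expr2 mulKf ?gt_eqF// lerDl mulr_ge0 ?sqr_ge0// invr_ge0 ltW.
Qed.

Lemma cosintN (l v : R) : cosint l (- v) = cosint l v.
Proof. by apply: eq_Rintegral => b _; rewrite mulNr cosN. Qed.

(** Both sides are even and have the same Laplace transform at every [m > l]. So the
    difference [D], weighted by [expR (- l * `|v|)], has vanishing moments against the
    powers of [expR (- `|v|)] and thus integral zero over every [[- r, r]]; being
    continuous and even, it vanishes. *)
Lemma poisson_formula (l v : R) : 0 < l -> cosint l v = pi * expR (- l * `|v|).
Proof.
move=> l0.
pose D v := cosint l v - pi * expR (- l * `|v|).
pose H v := expR (- l * `|v|) * D v.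
have DN x : D (- x) = D x by rewrite /D cosintN normrN.
have HN x : H (- x) = H x by rewrite /H DN normrN.
have cD : continuous D.
  move=> x; apply: cvgB; first exact: continuous_cosint.
  by apply: cvgM; [exact: cvg_cst|exact: continuous_expabs].
have cH : continuous H.
  by move=> x; apply: cvgM; [exact: continuous_expabs|exact: cD].
have bD x : `|D x| <= pi + pi.
  apply: le_trans (ler_normB _ _) _; apply: lerD; first exact: cosint_bound.
  rewrite normrM (ger0_norm (pi_ge0 R)) (ger0_norm (expR_ge0 _)) ler_piMr ?pi_ge0//.
  by rewrite -expR0 ler_expR mulNr oppr_le0 mulr_ge0// ltW.
have ieD m : 0 < m -> Rintegrable leb (fun x : R => expR (- m * `|x|) * D x).
  move=> m0; have := @Rintegrable_bounded _ _ _ leb _ _ _ (continuous_measurable_fun cD) bD (Rintegrable_expabs m0).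
  by apply: eq_integrable => // x _; rewrite /= mulrC.
have iH : Rintegrable leb H := ieD l l0.
have lapH (k : nat) : \int[leb]_x (expR (- (k.+1%:R * `|x|)) * H x) = 0.
  have k0 : 0 < k.+1%:R :> R by [].
  have lk : l < l + k.+1%:R by rewrite ltrDl.
  have m0 := lt_trans l0 lk.
  transitivity (\int[leb]_x (expR (- (l + k.+1%:R) * `|x|) * cosint l x
                        - pi * expR (- (l + (l + k.+1%:R)) * `|x|))).
    apply: eq_Rintegral => x _; rewrite /H /D !opprD !mulrDl !expRD !mulNr; ring.
  have lm0 : 0 < l + (l + k.+1%:R) by rewrite addr_gt0.
  rewrite RintegralB//.
  - rewrite laplace_cosint// RintegralZl ?integral_expabs//; last exact: Rintegrable_expabs.
    by rewrite mulrCA mulrA subrr.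
  - have bc x : `|cosint l x| <= pi := cosint_bound x l0.
    have := @Rintegrable_bounded _ _ _ leb _ _ _ (continuous_measurable_fun (continuous_cosint l0)) bc (Rintegrable_expabs m0).
    by apply: eq_integrable => // x _; rewrite /= mulrC.
  - exact/RintegrableZ/Rintegrable_expabs.
have sub0 r : 0 <= r -> \int[leb]_(x in `[- r, r]) H x = 0.
  move=> r0; have mn : measurable_fun setT (fun x : R => `|x|) by exact: measurableT_comp.
  have := @sublevel_integral0 _ _ _ leb H (fun x : R => `|x|) r iH mn (fun x => normr_ge0 x) lapH r0.
  move=> h; rewrite -[RHS]h//; rewrite Rintegral_mkcond; apply: eq_Rintegral => x _.
  rewrite patchE mem_setE in_itv/= -ler_norml.
  by case: ifP => _; rewrite ?mul1r ?mul0r.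
have iHs (E : set R) : measurable E -> leb.-integrable E (EFin \o H).
  by move=> mE; apply: integrableS iH.
pose G x := \int[leb]_(t in [set` `]-oo, x]]) H t.
have dG x : is_derive x (1 : R) G (H x).
  have [||||dG1 dG2] := @continuous_FTC1 R H -oo%O x (x + 1); rewrite ?ltrDl ?ltNyr//.
  - exact: iHs.
  - exact: cH.
  - by apply: DeriveDef => //; rewrite -derive1E.
have key r : 0 < r -> H r = 0.
  move=> r0.
  have dK : is_derive r (1 : R) (fun x => G x - G (- x)) (H r + H r).
    have h1 : is_derive (- r) (1 : R) G (H r) by rewrite -(HN r); exact: dG.
    have h2 : is_derive r (1 : R) (G \o -%R) (H r * - 1) by exact: is_derive1_comp.
    by have := is_deriveB (dG r) h2; rewrite mulrN1 opprK.
  have K0 : \near r, (fun x => G x - G (- x)) r = (fun=> 0 : R) r.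
    have : \near r, 0 < r by exact: lt_nbhsr.
    apply: filterS => x x0; rewrite /G Rintegral_itvB//.
    - rewrite Rintegral_itv_obnd_cbnd ?sub0// ?ltW//; exact: iHs.
    - exact: iHs.
    - by rewrite bnd_simp; lra.
  have := near_eq_is_derive K0 dK => -[_].
  by rewrite derive_cst; lra.
have expD x : H x = 0 -> D x = 0.
  by move/eqP; rewrite mulf_eq0 gt_eqF ?expR_gt0//= => /eqP.
suff : D v = 0 by move/eqP; rewrite subr_eq0 => /eqP.
have [v0|v0|->] := ltgtP v 0.
- by apply: expD; rewrite -HN key// oppr_gt0.
- exact/expD/key.
- rewrite /D normr0 mulr0 expR0 mulr1 /cosint.
  by under eq_Rintegral do rewrite mul0r cos0 mul1r; rewrite integral_pk// subrr.
Qed.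
End PoissonFormula.

(** * Power spectra against a Poisson kernel *)
Section Spectral.
Context (R : realType).
Notation leb := (@lebesgue_measure R).

Lemma Rintegrable_monotone (g_ : nat -> R -> R) (g : R -> R) (C : R) :
  (forall n, Rintegrable leb (g_ n)) -> (forall n x, 0 <= g_ n x) ->
  (forall x m n, (m <= n)%N -> g_ m x <= g_ n x) ->
  (forall x, g_ n x @[n --> \oo] --> g x) ->
  (forall n, \int[leb]_x g_ n x <= C) ->
  Rintegrable leb g /\ \int[leb]_x g x <= C.
Proof.
move=> ig g0 nd cg gC.
have mg : measurable_fun setT g.
  by apply: (measurable_fun_cvg (fun n => Rintegrable_meas (ig n))) => x _; exact: cg.
have gge0 x : 0 <= g x.
  rewrite -(cvg_lim (@Rhausdorff R) (cg x)); apply: limr_ge; last exact: nearW.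
  by apply/cvg_ex; exists (g x); exact: cg.
have mc : (\int[leb]_x (g x)%:E <= C%:E)%E.
  have := @cvg_monotone_convergence _ _ _ leb setT measurableT (fun n x => (g_ n x)%:E)
    (fun n => (measurable_EFinP _ _).2 (Rintegrable_meas (ig n))) (fun n x _ => g0 n x) .
  move=> /(_ (fun x _ m n mn => nd x m n mn)) h.
  have e : (\int[leb]_x (limn (fun n => (g_ n x)%:E)) = \int[leb]_x (g x)%:E)%E.
    apply: eq_integral => x _; apply/cvg_lim => //.
    by apply: cvg_EFin; [exact: nearW|exact: cg].
  rewrite -e -(cvg_lim _ h)//; apply: lime_le; first by apply/cvg_ex; eexists; exact: h.
  apply: nearW => n; rewrite -[X in (X <= _)%E]fineK ?lee_fin; first exact: gC.
  exact: integrable_fin_num (ig n).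
have ig' : Rintegrable leb g.
  apply/integrableP; split; first exact/measurable_EFinP.
  under eq_integral => x _ do rewrite /= (ger0_norm (gge0 x)).
  by apply: le_lt_trans mc _; rewrite ltry.
by split => //; rewrite -lee_fin /Rintegral fineK//; exact: integrable_fin_num ig'.
Qed.

Lemma measurable_sin : measurable_fun setT (sin : R -> R).
Proof. by apply: continuous_measurable_fun; exact: continuous_sin. Qed.

Lemma normr_sin_le1 (x : R) : `|sin x| <= 1.
Proof. by rewrite ler_norml sin_geN1 sin_le1. Qed.

(** The squared modulus of the Fourier transform of [k], in the variable [th]. *)
Definition specnorm (k th : R -> R) (b : R) : R :=
  (\int[leb]_t (k t * cos (th t * b))) ^+ 2 + (\int[leb]_t (k t * sin (th t * b))) ^+ 2.

Section SpecNorm.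
Variables (k th : R -> R).
Hypotheses (ik : Rintegrable leb k) (mth : measurable_fun setT th).

Let mk : measurable_fun setT k := Rintegrable_meas ik.

Lemma Rintegrable_kcos b : Rintegrable leb (fun t : R => k t * cos (th t * b)).
Proof.
have h : measurable_fun setT (fun t : R => cos (th t * b)).
  by apply: measurableT_comp; [exact: measurable_cos|exact: measurable_funM].
have := @Rintegrable_bounded _ _ _ leb 1 _ _ h (fun t => normr_cos_le1 _) ik.
by apply: eq_integrable => // t _; rewrite /= mulrC.
Qed.

Lemma Rintegrable_ksin b : Rintegrable leb (fun t : R => k t * sin (th t * b)).
Proof.
have h : measurable_fun setT (fun t : R => sin (th t * b)).
  by apply: measurableT_comp; [exact: measurable_sin|exact: measurable_funM].
have := @Rintegrable_bounded _ _ _ leb 1 _ _ h (fun t => normr_sin_le1 _) ik.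
by apply: eq_integrable => // t _; rewrite /= mulrC.
Qed.

Lemma specnorm_ge0 b : 0 <= specnorm k th b.
Proof. by rewrite addr_ge0// sqr_ge0. Qed.

(** The squares of the two integrals are double integrals, which the addition formula for
    the cosine combines. *)
Lemma specnormE b : Rintegrable (@leb2 R)
    (fun z : R * R => k z.1 * k z.2 * cos ((th z.1 - th z.2) * b)) /\
  specnorm k th b = \int[(@leb2 R)]_z (k z.1 * k z.2 * cos ((th z.1 - th z.2) * b)).
Proof.
have [ic ec] := Rintegral_mul (Rintegrable_kcos b) (Rintegrable_kcos b).
have [is_ es] := Rintegral_mul (Rintegrable_ksin b) (Rintegrable_ksin b).
have e (z : R * R) : k z.1 * k z.2 * cos ((th z.1 - th z.2) * b) =
   k z.1 * cos (th z.1 * b) * (k z.2 * cos (th z.2 * b)) +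
   k z.1 * sin (th z.1 * b) * (k z.2 * sin (th z.2 * b)).
  by rewrite mulrBl cosB; ring.
split.
  by apply: eq_integrable (RintegrableD ic is_) => // z _; rewrite /= e.
under eq_Rintegral do rewrite e.
by rewrite (RintegralD measurableT ic is_) ec es /specnorm !expr2.
Qed.

Let ikk : Rintegrable (@leb2 R) (fun z : R * R => k z.1 * k z.2).
Proof. exact: (Rintegral_mul ik ik).1. Qed.

Let L1 := \int[leb]_t `|k t|.

Lemma integral_normkk : \int[(@leb2 R)]_z `|k z.1 * k z.2| = L1 ^+ 2.
Proof.
have [_ h] := Rintegral_mul (Rintegrable_norm ik) (Rintegrable_norm ik).
by rewrite expr2 -h; apply: eq_Rintegral => z _; rewrite normrM.
Qed.

Lemma specnorm_le b : specnorm k th b <= L1 ^+ 2.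
Proof.
have [i ->] := specnormE b; rewrite -integral_normkk.
apply: le_trans (ler_norm _) _.
apply: le_trans (le_normr_Rintegral measurableT i) _.
apply: le_Rintegral => //; [exact: Rintegrable_norm i|exact: Rintegrable_norm ikk|].
by move=> z _; rewrite [leLHS]normrM ler_piMr// normr_cos_le1.
Qed.

Lemma measurable_thdiff : measurable_fun setT (fun z : R * R => th z.1 - th z.2).
Proof.
apply: measurable_funB.
  by apply: measurableT_comp; [exact: mth|exact: measurable_fst].
by apply: measurableT_comp; [exact: mth|exact: measurable_snd].
Qed.

Lemma measurable_kk : measurable_fun setT (fun z : R * R => k z.1 * k z.2).
Proof.
apply: measurable_funM.
  by apply: measurableT_comp; [exact: mk|exact: measurable_fst].
by apply: measurableT_comp; [exact: mk|exact: measurable_snd].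
Qed.

Lemma Rintegrable_kkexp (l : R) : 0 < l ->
  Rintegrable (@leb2 R) (fun z : R * R => k z.1 * k z.2 * expR (- l * `|th z.1 - th z.2|)).
Proof.
move=> l0.
have hb : measurable_fun setT (fun z : R * R => expR (- l * `|th z.1 - th z.2|)).
  apply: measurableT_comp => //; apply: measurable_funM => //.
  by apply: measurableT_comp => //; exact: measurable_thdiff.
have := @Rintegrable_bounded _ _ _ (@leb2 R) 1 _ _ hb _ ikk.
move=> h1; have {}h1 := h1 _; apply: eq_integrable (h1 _) => //.
  by move=> z _; rewrite /= mulrC.
by move=> z; rewrite ger0_norm ?expR_ge0// -expR0 ler_expR mulNr oppr_le0
  mulr_ge0// ltW.
Qed.

(** Parseval: by Fubini, the cosine in [specnormE] is integrated against the Poisson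
    kernel, which [poisson_formula] evaluates. *)
Lemma integral_pk_specnorm (l : R) : 0 < l ->
  Rintegrable leb (fun b : R => pk l b * specnorm k th b) /\
  \int[leb]_b (pk l b * specnorm k th b) =
  pi * \int[(@leb2 R)]_z (k z.1 * k z.2 * expR (- l * `|th z.1 - th z.2|)).
Proof.
move=> l0.
pose h (u : R * (R * R)) := pk l u.1 * (k u.2.1 * k u.2.2 * cos ((th u.2.1 - th u.2.2) * u.1)).
have mh : measurable_fun setT h.
  apply: measurable_funM.
    by apply: measurableT_comp; [exact: measurable_pk|exact: measurable_fst].
  apply: measurable_funM.
    by apply: (measurableT_comp measurable_kk); exact: measurable_snd.
  apply: measurableT_comp; first exact: measurable_cos.
  apply: measurable_funM; last exact: measurable_fst.
  by apply: (measurableT_comp measurable_thdiff); exact: measurable_snd.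
have ih : Rintegrable (leb \x @leb2 R)%E h.
  apply: (@Rintegrable_prod _ _ _ _ _ leb (@leb2 R) h (fun b => L1 ^+ 2 * pk l b)) => //.
  - by move=> b; have := RintegrableZ (pk l b) (specnormE b).1.
  - move=> b; rewrite /h/=; under eq_Rintegral do rewrite normrM (ger0_norm (pk_ge0 _ l0)).
    have i := Rintegrable_norm (specnormE b).1.
    rewrite (RintegralZl _ measurableT i) mulrC ler_wpM2r ?pk_ge0// -integral_normkk.
    apply: le_Rintegral => //; first exact: Rintegrable_norm ikk.
    by move=> z _; rewrite [leLHS]normrM ler_piMr// normr_cos_le1.
  - exact: RintegrableZ (Rintegrable_pk l0).
have e b : \int[(@leb2 R)]_z h (b, z) = pk l b * specnorm k th b.
  by have [i ->] := specnormE b; rewrite -(RintegralZl _ measurableT i).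
split.
  by have := Rintegrable_fubini1 ih; apply: eq_integrable => // b _; rewrite /= e.
transitivity (\int[leb]_b \int[(@leb2 R)]_z h (b, z)).
  by apply: eq_Rintegral => b _; rewrite e.
rewrite -Rintegral_fubini1// Rintegral_fubini2//.
have iE := Rintegrable_kkexp l0.
rewrite -(RintegralZl _ measurableT iE); apply: eq_Rintegral => z _; rewrite /h/=.
transitivity (\int[leb]_b ((k z.1 * k z.2) * (cos ((th z.1 - th z.2) * b) * pk l b))).
  by apply: eq_Rintegral => b _; ring.
rewrite (RintegralZl _ measurableT (Rintegrable_cospk _ l0)).
by rewrite -/(cosint l (th z.1 - th z.2)) poisson_formula//; ring.
Qed.

End SpecNorm.
End Spectral.

(** * The total mass of a power spectrum *)
Section SpectrumMass.
Context (R : realType).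
Notation leb := (@lebesgue_measure R).

Lemma Rintegral_reflect (c : R) (h : R -> R) : measurable_fun setT h ->
  \int[leb]_x h (c - x) = \int[leb]_x h x.
Proof.
move=> mh; rewrite /Rintegral; congr fine; apply/esym.
by apply: (integral_reflect c); exact/measurable_EFinP.
Qed.

Lemma Rintegrable_reflect (c : R) (h : R -> R) : Rintegrable leb h ->
  Rintegrable leb (fun x : R => h (c - x)).
Proof.
move=> ih; have mh := Rintegrable_meas ih; apply/integrableP; split.
  apply/measurable_EFinP; apply: (measurableT_comp mh); exact: measurable_funB.
move/integrableP : ih => [_]; rewrite (integral_reflect c)//.
by apply: measurableT_comp => //; exact/measurable_EFinP.
Qed.

Lemma integral_exp_diff (l : R) (t : R) : 0 < l ->
  Rintegrable leb (fun s : R => expR (- l * `|t - s|)) /\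
  \int[leb]_s expR (- l * `|t - s|) = 2 / l.
Proof.
move=> l0; have i := Rintegrable_expabs l0; split.
  exact: (Rintegrable_reflect t i).
rewrite -(integral_expabs l0).
exact: (Rintegral_reflect t (Rintegrable_meas i)).
Qed.

(** Plancherel's inequality, with the square norm of [k] bounded by [Mk] times its [L1]
    norm: as [l] tends to infinity, [l * pk l b] increases to one, while [l] times the
    exponential weight has integral two and so cannot exceed [2 * Mk] against [k]. *)
Lemma specnorm_mass (k : R -> R) (q Mk : R) : Rintegrable leb k ->
  (forall t, `|k t| <= Mk) ->
  Rintegrable leb (specnorm k (fun t => q - t)) /\
  \int[leb]_b specnorm k (fun t => q - t) b <= 2 * pi * Mk * \int[leb]_t `|k t|.
Proof.
move=> ik kM; set th := fun t => q - t.
have mth : measurable_fun setT th by exact: measurable_funB.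
have mk := Rintegrable_meas ik.
have ink := Rintegrable_norm ik.
have Mk0 : 0 <= Mk := le_trans (normr_ge0 _) (kM 0).
have key (l : R) : 0 < l ->
    \int[@leb2 R]_z (k z.1 * k z.2 * expR (- l * `|th z.1 - th z.2|))
    <= 2 / l * Mk * \int[leb]_t `|k t|.
  move=> l0.
  pose h (z : R * R) := `|k z.1| * (`|k z.2| * expR (- l * `|z.1 - z.2|)).
  have ithe (z : R * R) : `|th z.1 - th z.2| = `|z.1 - z.2|.
    by rewrite /th -normrN; congr (`|_|); ring.
  have me : measurable_fun setT (fun z : R * R => expR (- l * `|z.1 - z.2|)).
    apply: measurableT_comp => //; apply: measurable_funM => //.
    apply: measurableT_comp => //.
    by apply: measurable_funB; [exact: measurable_fst|exact: measurable_snd].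
  have e01 (x : R) : 0 <= expR (- l * `|x|) <= 1.
    by rewrite expR_ge0 -expR0 ler_expR mulNr oppr_le0 mulr_ge0// ltW.
  have ikk := (Rintegral_mul ik ik).1.
  have inkk := (Rintegral_mul ink ink).1.
  have ih : Rintegrable (@leb2 R) h.
    have b1 (z : R * R) : `|expR (- l * `|z.1 - z.2|)| <= 1.
      by have /andP[e0 e1] := e01 (z.1 - z.2); rewrite ger0_norm.
    have := @Rintegrable_bounded _ _ _ (@leb2 R) 1 _ _ me b1 inkk.
    by apply: eq_integrable => // z _; rewrite /= /h; congr EFin; ring.
  have ikke : Rintegrable (@leb2 R) (fun z : R * R => k z.1 * k z.2 * expR (- l * `|th z.1 - th z.2|)).
    have b1 (z : R * R) : `|expR (- l * `|z.1 - z.2|)| <= 1.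
      by have /andP[e0 e1] := e01 (z.1 - z.2); rewrite ger0_norm.
    have := @Rintegrable_bounded _ _ _ (@leb2 R) 1 _ _ me b1 ikk.
    by apply: eq_integrable => // z _; rewrite /= ithe; congr EFin; ring.
  apply: (@le_trans _ _ (\int[@leb2 R]_z h z)).
    apply: le_Rintegral => // z _; rewrite ithe.
    apply: le_trans (ler_norm _) _; rewrite !normrM /h mulrA ler_wpM2l//.
    by rewrite ger0_norm// expR_ge0.
  rewrite /leb2 Rintegral_fubini1//.
  have -> : 2 / l * Mk * \int[leb]_t `|k t| = \int[leb]_t (2 / l * Mk * `|k t|).
    by rewrite RintegralZl.
  apply: le_Rintegral => //.
  - exact: Rintegrable_fubini1 ih.
  - exact: RintegrableZ ink.
  move=> t _; have [ie ee] := integral_exp_diff t l0.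
  have ike : Rintegrable leb (fun s : R => `|k s| * expR (- l * `|t - s|)).
    have mnk : measurable_fun setT (fun s : R => `|k s|) by exact: measurableT_comp.
    have nM s : `| `|k s| | <= Mk by rewrite normr_id.
    exact: (@Rintegrable_bounded _ _ _ leb Mk _ _ mnk nM ie).
  rewrite /h/= (RintegralZl _ measurableT ike) mulrC ler_wpM2r//.
  rewrite -ee mulrC -(RintegralZl _ measurableT ie).
  apply: le_Rintegral => //; first exact: RintegrableZ ie.
  by move=> s _; rewrite ler_wpM2r ?expR_ge0.
have l0 n : (0 : R) < n.+1%:R by [].
apply: (@Rintegrable_monotone R (fun n b => n.+1%:R * (pk n.+1%:R b * specnorm k th b))).
- by move=> n; exact: RintegrableZ (integral_pk_specnorm ik mth (l0 n)).1.
- by move=> n b; rewrite mulr_ge0// mulr_ge0 ?pk_ge0 ?specnorm_ge0.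
- move=> b m n mn; rewrite !mulrA ler_wpM2r ?specnorm_ge0// /pk ?mulrA.
  have lm : (m.+1%:R : R) <= n.+1%:R by rewrite ler_nat.
  have := l0 m; move: (m.+1%:R : R) (n.+1%:R : R) lm => x y xy x0.
  have y0 : 0 < y := lt_le_trans x0 xy.
  rewrite ler_pdivrMr ?pk_den_gt0// mulrAC ler_pdivlMr ?pk_den_gt0//.
  have : x ^+ 2 <= y ^+ 2 by rewrite lerXn2r// nnegrE ltW.
  by have := sqr_ge0 b; rewrite !expr2; nra.
- move=> b; rewrite -[X in _ --> X]mul1r.
  have -> : (fun n => n.+1%:R * (pk n.+1%:R b * specnorm k th b)) =
            (fun n => (1 + b ^+ 2 * (harmonic n * harmonic n))^-1 * specnorm k th b).
    apply/funext => n; rewrite mulrA; congr (_ * _); rewrite /pk/=.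
    have := l0 n; move: (n.+1%:R : R) => x x0; field.
    by rewrite !gt_eqF ?pk_den_gt0// ltr_pwDr// mulr_ge0// sqr_ge0.
  apply: cvgM; last exact: cvg_cst.
  rewrite -[X in _ --> X]invr1; apply: cvgV => //.
  rewrite -[X in _ --> X]addr0; apply: cvgD; first exact: cvg_cst.
  rewrite -[X in _ --> X](mulr0 (b ^+ 2)); apply: cvgM; first exact: cvg_cst.
  by rewrite -[X in _ --> X](mulr0 0); apply: cvgM; exact: cvg_harmonic.
- move=> n; have [i e] := integral_pk_specnorm ik mth (l0 n).
  rewrite (RintegralZl _ measurableT i) e.
  have := key _ (l0 n); rewrite -(ler_pM2l (pi_gt0 R)) -(ler_pM2l (l0 n)).
  move/le_trans; apply; rewrite le_eqVlt; apply/orP; left; apply/eqP.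
  have := l0 n; move: (n.+1%:R : R) => x x0; field.
  by rewrite gt_eqF.
Qed.
End SpectrumMass.

(** * The Gaussian density *)
Section GaussianDensity.
Context (R : realType).
Notation leb := (@lebesgue_measure R).

Definition gam (s : R) : R := (Num.sqrt (2 * pi))^-1 * expR (- s ^+ 2 / 2).

Lemma sqrt2pi_gt0 : 0 < Num.sqrt (2 * pi) :> R.
Proof. by rewrite sqrtr_gt0 mulr_gt0// pi_gt0. Qed.

Lemma gam_gt0 s : 0 < gam s.
Proof. by rewrite mulr_gt0 ?expR_gt0// invr_gt0 sqrt2pi_gt0. Qed.

Lemma gam_ge0 s : 0 <= gam s. Proof. exact: ltW (gam_gt0 s). Qed.

Lemma gam_le1 s : gam s <= 1.
Proof.
rewrite mulr_ile1 ?expR_ge0 ?invr_ge0 ?sqrtr_ge0//.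
  rewrite invf_le1 ?sqrt2pi_gt0// -[leLHS]sqrtr1 ler_wsqrtr//.
  by have := pi_ge2 R; lra.
by rewrite -expR0 ler_expR mulNr oppr_le0 divr_ge0// sqr_ge0.
Qed.

Lemma continuous_gam : continuous gam.
Proof.
move=> s; apply: cvgM; first exact: cvg_cst.
apply: (@continuous_comp _ _ _ (fun s : R => - s ^+ 2 / 2) expR); last exact: continuous_expR.
by apply: cvgM; [apply: cvgN; exact: exprn_continuous|exact: cvg_cst].
Qed.

Lemma measurable_gam : measurable_fun setT gam.
Proof. by apply: continuous_measurable_fun; exact: continuous_gam. Qed.

Lemma gam_normal q t : gam (q - t) = normal_pdf q 1 t.
Proof.
rewrite normal_pdfE ?oner_neq0// /normal_peak /normal_fun /gam expr1n.
have -> : 1 * pi *+ 2 = 2 * pi :> R by rewrite mul1r -mulr_natl.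
have -> : (t - q) ^+ 2 = (q - t) ^+ 2 by ring.
by [].
Qed.

Lemma Rintegrable_gam q : Rintegrable leb (fun t : R => gam (q - t)).
Proof.
apply: eq_integrable (integrable_normal_pdf q 1) => // t _.
by rewrite /= gam_normal.
Qed.

Lemma integral_gam q : \int[leb]_t gam (q - t) = 1.
Proof.
under eq_Rintegral do rewrite gam_normal.
by rewrite /Rintegral integral_normal_pdf.
Qed.

(** As a function of [x], the Gaussian is half of a normal density of standard deviation
    one half; its total mass is thus one half, not one. *)
Lemma gam2_normal x t : gam (2 * x - t) = 2^-1 * normal_pdf (t / 2) 2^-1 x.
Proof.
have h0 : (2^-1 : R) != 0 by rewrite invr_neq0.
rewrite normal_pdfE// /normal_peak /normal_fun /gam mulrA; congr (_ * expR _).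
  have -> : (2^-1 : R) ^+ 2 * pi *+ 2 = (2^-1) ^+ 2 * (2 * pi).
    by rewrite -mulr_natl; ring.
  have -> : Num.sqrt ((2^-1 : R) ^+ 2 * (2 * pi)) = 2^-1 * Num.sqrt (2 * pi).
    by rewrite (sqrtrM _ (sqr_ge0 _)) sqrtr_sqr ger0_norm ?invr_ge0.
  by rewrite invfM invrK mulrA mulVf ?mul1r.
by rewrite -mulr_natl; field.
Qed.

Lemma Rintegrable_gam2 t : Rintegrable leb (fun x : R => gam (2 * x - t)).
Proof.
have := RintegrableZ 2^-1 (integrable_normal_pdf (t / 2) 2^-1).
by apply: eq_integrable => // x _; rewrite /= gam2_normal.
Qed.

Lemma integral_gam2 t : \int[leb]_x gam (2 * x - t) = 2^-1.
Proof.
under eq_Rintegral do rewrite gam2_normal.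
rewrite RintegralZl//; last exact: (integrable_normal_pdf (t / 2) 2^-1).
by rewrite /Rintegral integral_normal_pdf mulr1.
Qed.

Lemma is_derive_gam2 (x t : R) :
  is_derive x (1 : R) (fun y => gam (2 * y - t)) (- (2 * (2 * x - t)) * gam (2 * x - t)).
Proof.
rewrite /gam; apply: is_derive_eq; rewrite /GRing.scale/=.
by field; rewrite gt_eqF// sqrt2pi_gt0.
Qed.

(** Completing the squares: under the exponential weight, two Gaussians with the common
    centre [x + x'] become Gaussians with the centres [2 * x] and [2 * x']. *)
Lemma gam_split (x x' t t' : R) :
  expR (- (x - x') ^+ 2) * (gam (x + x' - t) * gam (x + x' - t') * expR (- (x - x') * (t' - t)))
  = gam (2 * x - t) * gam (2 * x' - t').
Proof.
rewrite /gam; set c := (Num.sqrt _)^-1.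
transitivity (c * c * (expR (- (x - x') ^+ 2) * expR (- (x + x' - t) ^+ 2 / 2) * expR (- (x + x' - t') ^+ 2 / 2) * expR (- (x - x') * (t' - t)))).
  by ring.
transitivity (c * c * (expR (- (2 * x - t) ^+ 2 / 2) * expR (- (2 * x' - t') ^+ 2 / 2))); last by ring.
by congr (_ * _); rewrite -!expRD; congr expR; field.
Qed.

(** This is [gauss_conv h] at the real point [2 * x]; the factor [2] is that of
    [z + z^* = 2 * Re z], the argument of [Phi] in [K z z]. *)
Definition gtrans (h : R -> R) (x : R) : R := \int[leb]_t (h t * gam (2 * x - t)).

Lemma measurable_lt_nat d (T : measurableType d) (u v : T -> R) :
  measurable_fun setT u -> measurable_fun setT v ->
  measurable_fun setT (fun z => (u z < v z)%R%:R : R).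
Proof.
move=> mu mv; rewrite (_ : (fun z => _) = (fun z => if u z < v z then 1 else 0)); last first.
  by apply/funext => z; case: ifP.
by apply: measurable_fun_ifT => //; exact: measurable_fun_ltr.
Qed.
End GaussianDensity.

(** * The kernel of the Cauchy transform for a real weight *)
(** The approximants [x / (x ^+ 2 + e)] are continuous, and also converge at [0], where
    [0^-1 = 0]. *)
Lemma measurable_inv (R : realType) : measurable_fun setT (fun x : R => x^-1).
Proof.
apply: (@measurable_fun_cvg _ _ _ setT (fun n (x : R) => x / (x ^+ 2 + harmonic n))).
  move=> n; apply: continuous_measurable_fun => x; apply: cvgM; first exact: cvg_id.
  apply: cvgV; first by rewrite gt_eqF// ltr_wpDl ?sqr_ge0// /= invr_gt0.
  by apply: cvgD; [exact: exprn_continuous|exact: cvg_cst].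
move=> x _; have [->|x0] := eqVneq x 0.
  rewrite invr0 (_ : (fun n => _) = (fun=> 0)); first exact: cvg_cst.
  by apply/funext => n; rewrite mul0r.
have -> : x^-1 = x * (x ^+ 2)^-1 by rewrite expr2 invfM mulVKf.
apply: cvgM; first exact: cvg_cst.
apply: cvgV; first by rewrite sqrf_eq0.
rewrite -[X in _ --> X]addr0; apply: cvgD; first exact: cvg_cst.
exact: cvg_harmonic.
Qed.

Section CauchyKernel.
Context (R : realType).
Notation leb := (@lebesgue_measure R).
Variables (f : R -> R) (M : R).
Hypotheses (mf : measurable_fun setT f) (fM : forall t, `|f t| <= M).

Definition wgt (q t : R) : R := f t * gam (q - t).

Lemma bound_ge0 : 0 <= M. Proof. exact: le_trans (normr_ge0 _) (fM 0). Qed.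

Lemma Rintegrable_wgt q : Rintegrable leb (wgt q).
Proof. exact: (@Rintegrable_bounded _ _ _ leb M _ _ mf fM (Rintegrable_gam q)). Qed.

Lemma normr_wgt q t : `|wgt q t| <= M * gam (q - t).
Proof. by rewrite normrM (ger0_norm (gam_ge0 _)) ler_wpM2r// gam_ge0. Qed.

Lemma normr_wgt_le q t : `|wgt q t| <= M.
Proof.
by apply: le_trans (normr_wgt q t) _; rewrite ler_piMr ?gam_le1// bound_ge0.
Qed.

Lemma wgt_L1 q : \int[leb]_t `|wgt q t| <= M.
Proof.
rewrite -[leRHS]mulr1 -(integral_gam q) -RintegralZl//; last exact: Rintegrable_gam.
apply: le_Rintegral => //; first exact: Rintegrable_norm (Rintegrable_wgt q).
  exact: RintegrableZ (Rintegrable_gam q).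
by move=> t _; exact: normr_wgt.
Qed.

Lemma wgt_L1_ge0 q : 0 <= \int[leb]_t `|wgt q t|.
Proof. exact: Rintegral_ge0. Qed.

(** The squared modulus of [K z w] for [x = Re z], [x' = Re w] and [b = Im z - Im w]: the
    factor [expR (- b ^+ 2)] of the Ginibre kernel cancels the growth of [Phi] off the real
    line. *)
Definition spec (x x' b : R) : R :=
  expR (- (x - x') ^+ 2) * specnorm (wgt (x + x')) (fun t => x + x' - t) b.

Let mth (q : R) : measurable_fun setT (fun t : R => q - t).
Proof. exact: measurable_funB. Qed.

Lemma spec_ge0 x x' b : 0 <= spec x x' b.
Proof. by rewrite mulr_ge0 ?expR_ge0 ?specnorm_ge0. Qed.

Lemma spec_le x x' b : spec x x' b <= M ^+ 2 * expR (- (x - x') ^+ 2).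
Proof.
rewrite /spec mulrC ler_wpM2r ?expR_ge0//.
apply: le_trans (specnorm_le (Rintegrable_wgt _) (mth _) b) _.
by rewrite lerXn2r ?nnegrE ?wgt_L1_ge0 ?bound_ge0 ?wgt_L1.
Qed.

Lemma specN x x' b : spec x x' (- b) = spec x x' b.
Proof.
rewrite /spec /specnorm; congr (_ * (_ + _)).
  by under eq_Rintegral do rewrite mulrN cosN.
rewrite -[RHS]sqrrN; congr (_ ^+ 2).
have i := Rintegrable_ksin (Rintegrable_wgt (x + x')) (mth (x + x')) b.
rewrite -mulN1r -(RintegralZl _ measurableT i).
by apply: eq_Rintegral => t _; rewrite mulrN sinN; ring.
Qed.

Lemma measurable_spec x : measurable_fun setT (fun z : R * R => spec x z.1 z.2).
Proof.
apply: measurable_funM.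
  apply: measurableT_comp => //; apply: measurableT_comp => //; apply: measurable_funX.
  by apply: measurable_funB => //; exact: measurable_fst.
have m1 : measurable_fun setT (fun u : (R * R) * R => x + u.1.1 - u.2).
  apply: measurable_funB; last exact: measurable_snd.
  by apply: measurable_funD => //; apply: measurableT_comp; [exact: measurable_fst|exact: measurable_fst].
have m2 : measurable_fun setT (fun u : (R * R) * R => wgt (x + u.1.1) u.2).
  apply: measurable_funM; first by apply: (measurableT_comp mf); exact: measurable_snd.
  by apply: (measurableT_comp (@measurable_gam R)).
have m3 : measurable_fun setT (fun u : (R * R) * R => (x + u.1.1 - u.2) * u.1.2).
  by apply: measurable_funM => //; apply: measurableT_comp; [exact: measurable_snd|exact: measurable_fst].
apply: measurable_funD; apply: measurable_funX.
  apply: (@measurable_Rintegral _ _ _ _ R leb (fun u : (R * R) * R => wgt (x + u.1.1) u.2 * cos ((x + u.1.1 - u.2) * u.1.2))).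
  by apply: measurable_funM => //; apply: (measurableT_comp (@measurable_cos R)).
apply: (@measurable_Rintegral _ _ _ _ R leb (fun u : (R * R) * R => wgt (x + u.1.1) u.2 * sin ((x + u.1.1 - u.2) * u.1.2))).
by apply: measurable_funM => //; apply: (measurableT_comp (@measurable_sin R)).
Qed.

Lemma measurable_spec_at x y : measurable_fun setT (fun z : R * R => spec x z.1 (y - z.2)).
Proof.
have m : measurable_fun setT (fun z : R * R => (z.1, y - z.2)).
  by apply: measurable_fun_pair; [exact: measurable_fst|apply: measurable_funB => //; exact: measurable_snd].
exact: (measurableT_comp (measurable_spec x) m).
Qed.

Definition sqdist (x y : R) (z : R * R) : R := (x - z.1) ^+ 2 + (y - z.2) ^+ 2.

(** Up to the factor [(K z z)^-1], the real part of the Cauchy kernel at [z = x +i* y], as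
    a function of [w]; [im_kernel] is the opposite of the imaginary part. *)
Definition re_kernel x y (z : R * R) : R :=
  (x - z.1) / sqdist x y z * spec x z.1 (y - z.2).

Definition im_kernel x y (z : R * R) : R :=
  (y - z.2) / sqdist x y z * spec x z.1 (y - z.2).

Lemma measurable_sqdistV x y : measurable_fun setT (fun z => (sqdist x y z)^-1).
Proof.
apply: (measurableT_comp (@measurable_inv R)).
apply: measurable_funD; apply: measurable_funX; apply: measurable_funB => //.
Qed.

Lemma measurable_re_kernel x y : measurable_fun setT (re_kernel x y).
Proof.
apply: measurable_funM; last exact: measurable_spec_at.
by apply: measurable_funM; [apply: measurable_funB => //|exact: measurable_sqdistV].
Qed.

Lemma measurable_im_kernel x y : measurable_fun setT (im_kernel x y).
Proof.
apply: measurable_funM; last exact: measurable_spec_at.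
by apply: measurable_funM; [apply: measurable_funB => //|exact: measurable_sqdistV].
Qed.

Lemma cauchy_pk (a b : R) : a / (a ^+ 2 + b ^+ 2) = Num.sg a * pk `|a| b.
Proof. by rewrite /pk mulrA -numEsg real_normK ?num_real. Qed.

(** As a function of [Im w], [re_kernel] is a Poisson kernel times a power spectrum; the
    Poisson parameter is [`|x - x'|]. On the line [x' = x] the kernel is zero. *)
Lemma re_inner x y x' :
  [/\ Rintegrable leb (fun y' : R => re_kernel x y (x', y')),
      \int[leb]_y' `|re_kernel x y (x', y')| <= pi * M ^+ 2 * expR (- (x - x') ^+ 2) &
      \int[leb]_y' re_kernel x y (x', y') = pi * \int[@leb2 R]_z
        (Num.sg (x - x') * expR (- (x - x') ^+ 2) * (wgt (x + x') z.1 * wgt (x + x') z.2 *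
           expR (- `|x - x'| * `|x + x' - z.1 - (x + x' - z.2)|)))].
Proof.
set a := x - x'; set q := x + x'.
have E0 := expR_ge0 (- a ^+ 2).
have M0 := bound_ge0.
have reE y' : re_kernel x y (x', y') = Num.sg a * (pk `|a| (y - y') * spec x x' (y - y')).
  by rewrite /re_kernel /sqdist /= cauchy_pk -mulrA.
have [a0|a0] := eqVneq a 0.
  have re0 y' : re_kernel x y (x', y') = 0 by rewrite reE a0 sgr0 mul0r.
  split.
  - by apply: eq_integrable (integrable0 leb setT) => // y' _; rewrite /= re0.
  - under eq_Rintegral do rewrite re0 normr0.
    by rewrite Rintegral_cst// mul0r !mulr_ge0 ?exprn_ge0 ?pi_ge0.
  - under eq_Rintegral do rewrite re0.
    under [in RHS]eq_Rintegral do rewrite a0 sgr0 !mul0r.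
    by rewrite !Rintegral_cst// !mul0r mulr0.
have l0 : 0 < `|a| by rewrite normr_gt0.
have [i e] := integral_pk_specnorm (Rintegrable_wgt q) (mth q) l0.
have i1 : Rintegrable leb (fun b : R => pk `|a| b * spec x x' b).
  apply: eq_integrable (RintegrableZ (expR (- a ^+ 2)) i) => // b _.
  by rewrite /= /spec -/a -/q; congr EFin; ring.
have i2 : Rintegrable leb (fun y' : R => pk `|a| (y - y') * spec x x' (y - y')).
  exact: (Rintegrable_reflect y i1).
have e2 : \int[leb]_y' (pk `|a| (y - y') * spec x x' (y - y')) = \int[leb]_b (pk `|a| b * spec x x' b).
  exact: (Rintegral_reflect y (Rintegrable_meas i1)).
split.
- by apply: eq_integrable (RintegrableZ (Num.sg a) i2) => // y' _; rewrite /= reE.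
- have nE y' : `|re_kernel x y (x', y')| = pk `|a| (y - y') * spec x x' (y - y').
    rewrite reE normrM normr_sg a0 mul1r ger0_norm// mulr_ge0 ?pk_ge0 ?spec_ge0//.
  under eq_Rintegral do rewrite nE.
  rewrite e2 -mulrA -(integral_pk l0) mulrC -RintegralZl//; last exact: Rintegrable_pk.
  apply: le_Rintegral => //; first exact: RintegrableZ (Rintegrable_pk l0).
  by move=> b _; rewrite mulrC ler_wpM2r ?pk_ge0// spec_le.
- under eq_Rintegral do rewrite reE.
  rewrite (RintegralZl _ measurableT i2) e2.
  have -> : \int[leb]_b (pk `|a| b * spec x x' b) = expR (- a ^+ 2) * \int[leb]_b (pk `|a| b * specnorm (wgt q) (fun t => q - t) b).
    rewrite -(RintegralZl _ measurableT i); apply: eq_Rintegral => b _.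
    by rewrite /spec -/a -/q; ring.
  rewrite e (RintegralZl _ measurableT (Rintegrable_kkexp (Rintegrable_wgt q) (mth q) l0)).
  by ring.
Qed.
End CauchyKernel.

(** * Symmetries of integrals over the line and the plane *)
Section PlaneSymmetries.
Context (R : realType).
Notation leb := (@lebesgue_measure R).

(** The positive and negative parts have the same integral; when it is infinite, [fine] of
    [+oo - +oo] is zero as well. *)
Lemma Rintegral_odd (h : R -> R) : measurable_fun setT h ->
  (forall b, h (- b) = - h b) -> \int[leb]_b h b = 0.
Proof.
move=> mh hN; have mE : measurable_fun setT (EFin \o h) by exact/measurable_EFinP.
rewrite /Rintegral integralE.
have -> : (\int[leb]_b ((fun b => (h b)%:E)^\- b) = \int[leb]_b ((fun b => (h b)%:E)^\+ b))%E.
  rewrite (integral_reflect 0); last exact: measurable_funeneg.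
  by apply: eq_integral => b _; rewrite sub0r funenegE funeposE hN EFinN oppeK.
by case: (\int[leb]_b _)%E => [r| |] //=; rewrite subrr.
Qed.

Lemma Rintegrable_swap (h : R * R -> R) : Rintegrable (@leb2 R) h ->
  Rintegrable (@leb2 R) (fun z : R * R => h (z.2, z.1)).
Proof.
move=> ih; have mh := Rintegrable_meas ih.
have mh' : measurable_fun setT (fun z : R * R => h (z.2, z.1)).
  by apply: (measurableT_comp mh); apply: measurable_fun_pair; [exact: measurable_snd|exact: measurable_fst].
apply/integrable21ltyP; first exact/measurable_EFinP.
have mE : measurable_fun setT (EFin \o h) by exact/measurable_EFinP.
have h12 := (@integrable12ltyP _ _ _ _ _ leb leb _ mE).1 ih.
exact: h12.
Qed.

Lemma Rintegral_swap (h : R * R -> R) : Rintegrable (@leb2 R) h ->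
  \int[@leb2 R]_z h (z.2, z.1) = \int[@leb2 R]_z h z.
Proof.
move=> ih; rewrite /leb2 (Rintegral_fubini2 (Rintegrable_swap ih)).
by rewrite (Rintegral_fubini1 ih).
Qed.

Lemma measurable_lt12 : measurable_fun setT (fun z : R * R => (z.1 < z.2)%R%:R : R).
Proof. exact: (measurable_lt_nat (@measurable_fst _ _ R R) (@measurable_snd _ _ R R)). Qed.

Lemma measurable_lt21 : measurable_fun setT (fun z : R * R => (z.2 < z.1)%R%:R : R).
Proof. exact: (measurable_lt_nat (@measurable_snd _ _ R R) (@measurable_fst _ _ R R)). Qed.

Lemma Rintegral_diagonal (h : R * R -> R) : Rintegrable (@leb2 R) h ->
  \int[@leb2 R]_z ((z.1 == z.2)%:R * h z) = 0.
Proof.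
move=> ih; have mh := Rintegrable_meas ih.
have md : measurable_fun setT (fun z : R * R => (z.1 == z.2)%:R : R).
  rewrite (_ : (fun z => _) = (fun z : R * R => 1 - ((z.1 < z.2)%R%:R + (z.2 < z.1)%R%:R))); last first.
    by apply/funext => z /=; case: (ltgtP z.1 z.2) => _ /=; lra.
  apply: measurable_funB => //; apply: measurable_funD; [exact: measurable_lt12|exact: measurable_lt21].
have b1 (z : R * R) : `|(z.1 == z.2)%:R : R| <= 1 by case: eqP; rewrite ?normr1 ?normr0.
have ih' := @Rintegrable_bounded _ _ _ (@leb2 R) 1 _ _ md b1 ih.
rewrite /leb2 (Rintegral_fubini1 ih').
have -> : \int[leb]_x \int[leb]_y ((x == y)%:R * h (x, y)) = \int[leb]_(x in setT) (fun=> 0) x.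
  apply: eq_Rintegral => x _.
  rewrite (@Rintegral_ae _ _ _ leb _ (fun=> 0))//.
  - by rewrite Rintegral_cst// mul0r.
  - exact: (measurableT_comp (Rintegrable_meas ih') (pair1_measurable x)).
  - exists [set x]; split; [exact: measurable_set1|exact: lebesgue_measure_set1|].
    by move=> y /=; have [->//|xy] := eqVneq x y; rewrite mul0r.
by rewrite Rintegral_cst// mul0r.
Qed.

Lemma normr_nat_le1 (b : bool) : `|b%:R : R| <= 1.
Proof. by case: b; rewrite ?normr1 ?normr0. Qed.

(** The diagonal is negligible, and the two half planes it bounds contribute equally. *)
Lemma Rintegral_half (h : R * R -> R) : Rintegrable (@leb2 R) h ->
  (forall z, h (z.2, z.1) = h z) ->
  \int[@leb2 R]_z h z = \int[@leb2 R]_z (2 * ((z.1 < z.2)%R%:R * h z)) /\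
  \int[@leb2 R]_z h z = \int[@leb2 R]_z (2 * ((z.2 < z.1)%R%:R * h z)).
Proof.
move=> ih hs.
have i12 := @Rintegrable_bounded _ _ _ (@leb2 R) 1 _ _ measurable_lt12 (fun z => normr_nat_le1 _) ih.
have i21 := @Rintegrable_bounded _ _ _ (@leb2 R) 1 _ _ measurable_lt21 (fun z => normr_nat_le1 _) ih.
have e : \int[@leb2 R]_z ((z.2 < z.1)%R%:R * h z) = \int[@leb2 R]_z ((z.1 < z.2)%R%:R * h z).
  by rewrite -[LHS](Rintegral_swap i21); apply: eq_Rintegral => z _; rewrite /= hs.
have i0 : Rintegrable (@leb2 R) (fun z : R * R => (z.1 == z.2)%:R * h z).
  have := RintegrableB ih (RintegrableD i12 i21).
  apply: eq_integrable => // z _; rewrite /=; congr EFin.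
  by case: (ltgtP z.1 z.2) => _ /=; lra.
have s : \int[@leb2 R]_z h z = \int[@leb2 R]_z ((z.1 < z.2)%R%:R * h z)
     + \int[@leb2 R]_z ((z.2 < z.1)%R%:R * h z).
  rewrite -(RintegralD measurableT i12 i21).
  transitivity (\int[@leb2 R]_z ((z.1 < z.2)%R%:R * h z + (z.2 < z.1)%R%:R * h z + (z.1 == z.2)%:R * h z)).
    by apply: eq_Rintegral => z _; case: (ltgtP z.1 z.2) => _ /=; lra.
  by rewrite (RintegralD measurableT (RintegrableD i12 i21) i0) Rintegral_diagonal// addr0.
by rewrite !RintegralZl// s e; split; lra.
Qed.
End PlaneSymmetries.

(** * Integrability of the kernel *)
Section CauchyKernelIntegrability.
Context (R : realType).
Notation leb := (@lebesgue_measure R).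
Variables (f : R -> R) (M : R).
Hypotheses (mf : measurable_fun setT f) (fM : forall t, `|f t| <= M).

Lemma Rintegrable_gauss_shift (x : R) : Rintegrable leb (fun x' : R => expR (- (x - x') ^+ 2)).
Proof.
have i := Rintegrable_gauss (@ltr01 R).
have := Rintegrable_reflect x i; apply: eq_integrable => // x' _.
by rewrite /= mul1r.
Qed.

Lemma Rintegrable_re_kernel x y : Rintegrable (@leb2 R) (re_kernel f x y).
Proof.
apply: (@Rintegrable_prod _ _ _ _ _ leb leb _ (fun x' => pi * M ^+ 2 * expR (- (x - x') ^+ 2))).
- exact: measurable_re_kernel.
- by move=> x'; have [] := re_inner mf fM x y x'.
- by move=> x'; have [] := re_inner mf fM x y x'.
- exact: RintegrableZ (Rintegrable_gauss_shift x).
Qed.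

Lemma Rintegrable_spec_at x y : Rintegrable (@leb2 R) (fun z : R * R => spec f x z.1 (y - z.2)).
Proof.
have M0 := bound_ge0 fM.
apply: (@Rintegrable_prod _ _ _ _ _ leb leb _ (fun x' => 2 * pi * M * M * expR (- (x - x') ^+ 2))).
- exact: measurable_spec_at.
- move=> x' /=.
  have [i _] := specnorm_mass (x + x') (Rintegrable_wgt mf fM (x + x')) (normr_wgt_le fM (x + x')).
  exact: (Rintegrable_reflect y (RintegrableZ (expR (- (x - x') ^+ 2)) i)).
- move=> x' /=.
  have [i e] := specnorm_mass (x + x') (Rintegrable_wgt mf fM (x + x')) (normr_wgt_le fM (x + x')).
  have is_ : Rintegrable leb (spec f x x') := RintegrableZ (expR (- (x - x') ^+ 2)) i.
  under eq_Rintegral do rewrite ger0_norm ?spec_ge0//.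
  rewrite (Rintegral_reflect y (Rintegrable_meas is_)) /spec (RintegralZl _ measurableT i) mulrC.
  rewrite ler_wpM2r ?expR_ge0//; apply: le_trans e _.
  rewrite ler_wpM2l ?mulr_ge0 ?pi_ge0//; exact: wgt_L1.
- exact: RintegrableZ (Rintegrable_gauss_shift x).
Qed.

(** Integrated first in [Re w], this is a Poisson kernel of parameter [`|y - z.2|], of
    mass at most [pi]; the Gaussian then makes it integrable in the other variable. *)
Lemma Rintegrable_near_singularity x y : Rintegrable (@leb2 R)
  (fun z : R * R => expR (1 - (y - z.2) ^+ 2) * (`|y - z.2| / sqdist x y z)).
Proof.
have mn : measurable_fun setT (fun z : R * R => `|y - z.2|).
  by apply: measurableT_comp => //; apply: measurable_funB => //; exact: measurable_snd.
have m2 : measurable_fun setT (fun z : R * R => expR (1 - (y - z.2) ^+ 2)).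
  apply: measurableT_comp => //; apply: measurable_funB => //; apply: measurable_funX.
  by apply: measurable_funB => //; exact: measurable_snd.
pose E (b : R) := expR (1 - b ^+ 2).
have inner y' : Rintegrable leb (fun x' : R => `|y - y'| / sqdist x y (x', y')) /\
   \int[leb]_x' (`|y - y'| / sqdist x y (x', y')) <= pi.
  have [->|yy] := eqVneq y y'.
    split.
      by apply: eq_integrable (integrable0 leb setT) => // x' _; rewrite /= subrr normr0 mul0r.
    under eq_Rintegral do rewrite subrr normr0 mul0r.
    by rewrite Rintegral_cst// mul0r pi_ge0.
  have l0 : 0 < `|y - y'| by rewrite normr_gt0 subr_eq0.
  have e x' : `|y - y'| / sqdist x y (x', y') = pk `|y - y'| (x - x').
    by rewrite /pk /sqdist/= real_normK ?num_real//; congr (_ / _); exact: addrC.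
  have i := Rintegrable_pk l0.
  split.
    by apply: eq_integrable (Rintegrable_reflect x i) => // x' _; rewrite /= e.
  under eq_Rintegral do rewrite e.
  by rewrite (Rintegral_reflect x (Rintegrable_meas i)) integral_pk.
have sq0 z : 0 <= `|y - z.2| / sqdist x y z.
  by rewrite divr_ge0// addr_ge0// sqr_ge0.
apply: (@Rintegrable_prod2 _ _ _ _ _ leb leb _ (fun y' => pi * expR 1 * expR (- (y - y') ^+ 2))).
- apply: measurable_funM => //; apply: measurable_funM => //; exact: measurable_sqdistV.
- by move=> y'; have := RintegrableZ (expR (1 - (y - y') ^+ 2)) (inner y').1.
- move=> y' /=.
  have nE x' : `|expR (1 - (y - y') ^+ 2) * (`|y - y'| / sqdist x y (x', y'))| =
               expR (1 - (y - y') ^+ 2) * (`|y - y'| / sqdist x y (x', y')).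
    by rewrite ger0_norm// mulr_ge0 ?expR_ge0//; exact: (sq0 (x', y')).
  under eq_Rintegral do rewrite nE.
  rewrite (RintegralZl _ measurableT (inner y').1) expRD mulrC -[leRHS]mulrA.
  by rewrite ler_wpM2r ?mulr_ge0 ?expR_ge0// (inner y').2.
- exact: RintegrableZ (Rintegrable_gauss_shift y).
Qed.

(** Where [1 <= `|y - Im w|] the kernel is dominated by the spectrum, which has finite mass
    by [specnorm_mass]; elsewhere the spectrum is bounded, and the singularity is that of
    [Rintegrable_near_singularity]. *)
Lemma Rintegrable_im_kernel x y : Rintegrable (@leb2 R) (im_kernel f x y).
Proof.
have i := RintegrableD (Rintegrable_spec_at x y) (RintegrableZ (M ^+ 2) (Rintegrable_near_singularity x y)).
apply: (@Rintegrable_le _ _ _ (@leb2 R) _ _ _ _ i); first exact: measurable_im_kernel.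
move=> z; rewrite /im_kernel normrM (ger0_norm (spec_ge0 _ _ _ _)) normrM normfV.
have s0 := spec_ge0 f x z.1 (y - z.2).
have d0 : 0 <= sqdist x y z by rewrite addr_ge0// sqr_ge0.
have q0 : 0 <= `|y - z.2| / sqdist x y z by rewrite divr_ge0.
rewrite [`|sqdist _ _ _|]ger0_norm//.
have [b1|b1] := leP 1 `|y - z.2|.
  apply: (@le_trans _ _ (spec f x z.1 (y - z.2))); last first.
    by rewrite lerDl mulr_ge0 ?sqr_ge0// mulr_ge0 ?expR_ge0.
  rewrite ler_piMl//.
  have b2 : `|y - z.2| <= sqdist x y z.
    rewrite /sqdist -[(y - z.2) ^+ 2]real_normK ?num_real//.
    have := sqr_ge0 (x - z.1); move: b1; rewrite !expr2; nra.
  rewrite ler_pdivrMr ?mul1r//; lra.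
have h1 : spec f x z.1 (y - z.2) <= M ^+ 2 * expR (1 - (y - z.2) ^+ 2).
  apply: le_trans (spec_le mf fM _ _ _) _; rewrite ler_wpM2l ?sqr_ge0// ler_expR.
  have : (y - z.2) ^+ 2 <= 1.
    by rewrite -[(y - z.2) ^+ 2]real_normK ?num_real// expr2; have := normr_ge0 (y - z.2); nra.
  by have := sqr_ge0 (x - z.1); lra.
apply: (@le_trans _ _ (M ^+ 2 * (expR (1 - (y - z.2) ^+ 2) * (`|y - z.2| / sqdist x y z)))); last by rewrite lerDr.
by rewrite mulrA mulrC ler_wpM2r.
Qed.

(** The spectrum is even in [Im z - Im w], so the kernel is odd in it. *)
Lemma integral_im_kernel x y : \int[@leb2 R]_z im_kernel f x y z = 0.
Proof.
rewrite /leb2 (Rintegral_fubini1 (Rintegrable_im_kernel x y)).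
have inner x' : \int[leb]_y' im_kernel f x y (x', y') = 0.
  pose h b := b / ((x - x') ^+ 2 + b ^+ 2) * spec f x x' b.
  have mh : measurable_fun setT h.
    have := measurableT_comp (measurable_im_kernel mf x 0) (pair1_measurable x').
    move=> m; have := measurableT_comp m (@oppr_measurable R setT).
    congr (measurable_fun _ _); apply/funext => b.
    by rewrite /= /im_kernel /sqdist /h /= sub0r opprK.
  rewrite -[LHS]/(\int[leb]_y' h (y - y')) Rintegral_reflect//.
  apply: Rintegral_odd => // b.
  by rewrite /h (specN mf fM) sqrrN !mulNr.
under eq_Rintegral do rewrite inner.
by rewrite Rintegral_cst// mul0r.
Qed.
End CauchyKernelIntegrability.

(** * Masses of Gaussians on half-lines *)
Section HalfLines.
Context (R : realType).
Notation leb := (@lebesgue_measure R).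

Lemma measurable_ltc (c : R) : measurable_fun setT (fun s : R => (s < c)%R%:R : R).
Proof. exact: (measurable_lt_nat (@measurable_id _ R setT) (@measurable_cst _ _ R R setT c)). Qed.

Lemma measurable_cgt (c : R) : measurable_fun setT (fun s : R => (c < s)%R%:R : R).
Proof. exact: (measurable_lt_nat (@measurable_cst _ _ R R setT c) (@measurable_id _ R setT)). Qed.

Definition lower_mass (x t : R) : R := \int[leb]_y ((y < x)%R%:R * gam (2 * y - t)).
Definition upper_mass (x t : R) : R := \int[leb]_y ((x < y)%R%:R * gam (2 * y - t)).

Lemma Rintegrable_lower (x t : R) : Rintegrable leb (fun y : R => (y < x)%R%:R * gam (2 * y - t)).
Proof.
exact: (@Rintegrable_bounded _ _ _ leb 1 _ _ (measurable_ltc x) (fun y => normr_nat_le1 _ _) (Rintegrable_gam2 t)).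
Qed.

Lemma Rintegrable_upper (x t : R) : Rintegrable leb (fun y : R => (x < y)%R%:R * gam (2 * y - t)).
Proof.
exact: (@Rintegrable_bounded _ _ _ leb 1 _ _ (measurable_cgt x) (fun y => normr_nat_le1 _ _) (Rintegrable_gam2 t)).
Qed.

Lemma ae_neq (c : R) (P : R -> Prop) : (forall s, s != c -> P s) -> {ae leb, forall s, P s}.
Proof.
move=> h; exists [set c]; split; [exact: measurable_set1|exact: lebesgue_measure_set1|].
by move=> s /= nP; have [//|sc] := eqVneq s c; exfalso; apply: nP; exact: h.
Qed.

Lemma lower_upper (x t : R) : lower_mass x t + upper_mass x t = 2^-1.
Proof.
rewrite -(RintegralD measurableT (Rintegrable_lower x t) (Rintegrable_upper x t)).
rewrite -(integral_gam2 t); apply: Rintegral_ae.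
- exact: Rintegrable_meas (RintegrableD (Rintegrable_lower x t) (Rintegrable_upper x t)).
- exact: Rintegrable_meas (Rintegrable_gam2 t).
- by apply: (@ae_neq x) => y; case: ltgtP => // _ _; rewrite mul0r mul1r ?add0r ?addr0.
Qed.

Lemma is_derive_lower (x t : R) : is_derive x (1 : R) (fun y => lower_mass y t) (gam (2 * x - t)).
Proof.
have -> : (fun y => lower_mass y t) = (fun y => \int[leb]_(s in [set` `]-oo, y]]) gam (2 * s - t)).
  apply/funext => y; rewrite Rintegral_mkcond /lower_mass.
  have cg : continuous (fun s : R => gam (2 * s - t)).
    by move=> s; exact: continuous_derive (is_derive_gam2 s t).
  apply: Rintegral_ae.
  - exact: Rintegrable_meas (Rintegrable_lower y t).
  - apply/(measurable_restrictT _ _).1 => //.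
    by apply: measurable_funTS; exact: continuous_measurable_fun.
  - apply: (@ae_neq y) => s sy; rewrite patchE mem_setE in_itv/= le_eqVlt (negPf sy)/=.
    by case: ifP; rewrite ?mul1r ?mul0r.
have [||||d1 d2] := @continuous_FTC1 R (fun s => gam (2 * s - t)) -oo%O x (x + 1); rewrite ?ltrDl ?ltNyr//.
- apply: integrableS (Rintegrable_gam2 t) => //.
- exact: continuous_derive (is_derive_gam2 x t).
- by apply: DeriveDef => //; rewrite -derive1E.
Qed.

Lemma gam_le_exp (s : R) : gam s <= expR (- s ^+ 2 / 2).
Proof.
rewrite ler_piMl ?expR_ge0// invf_le1 ?sqrt2pi_gt0// -[leLHS]sqrtr1 ler_wsqrtr//.
by have := pi_ge2 R; lra.
Qed.

Definition tail_const (x : R) : R := expR (4 * x ^+ 2) * \int[leb]_y expR (- (2 * y ^+ 2)).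

(** For [s < 0] the difference is [- upper_mass x s], so both cases are tails: masses of the
    Gaussian centred at [s / 2] on a half-line that lies, up to a segment between [0] and
    [x], on the other side of zero. *)
Lemma tail_bound (x s : R) :
  `|lower_mass x s - 2^-1 * (s < 0)%R%:R| <= tail_const x * expR (- (4^-1 * s ^+ 2)).
Proof.
have ig := @Rintegrable_gauss R 2 (ltr0Sn _ _).
have key (b : R -> bool) : (forall y, b y -> - (2 * y - s) ^+ 2 / 2 <= 4 * x ^+ 2 - 2 * y ^+ 2 - 4^-1 * s ^+ 2) ->
    Rintegrable leb (fun y : R => (b y)%:R * gam (2 * y - s)) ->
    0 <= \int[leb]_y ((b y)%:R * gam (2 * y - s)) <= tail_const x * expR (- (4^-1 * s ^+ 2)).
  move=> hb ib; rewrite Rintegral_ge0/=; last by move=> y _; rewrite mulr_ge0 ?gam_ge0.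
  rewrite /tail_const mulrAC -expRD -RintegralZl//.
  apply: le_Rintegral => //; first exact: RintegrableZ ig.
  move=> y _; rewrite -expRD; case: (boolP (b y)) => [by_|_]; last by rewrite mul0r expR_ge0.
  rewrite mul1r; apply: le_trans (gam_le_exp _) _; rewrite ler_expR.
  by have := hb _ by_; lra.
have [s0|s0] := ltP s 0; rewrite /= ?mulr1n ?mulr0n.
  have -> : lower_mass x s - 2^-1 * 1 = - upper_mass x s by rewrite -(lower_upper x s); lra.
  rewrite normrN; have := key (fun y => x < y) _ (Rintegrable_upper x s).
  rewrite -/(upper_mass x s) => /(_ _)/andP[|h0 h1]; last by rewrite ger0_norm.
  move=> y xy; have [y0|y0] := leP 0 y; first by have := sqr_ge0 x; rewrite !expr2; nra.
  have := sqr_ge0 (s - 4 * y); have : y ^+ 2 <= x ^+ 2 by rewrite !expr2; nra.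
  by rewrite !expr2; nra.
rewrite mulr0 subr0; have := key (fun y => y < x) _ (Rintegrable_lower x s).
rewrite -/(lower_mass x s) => /(_ _)/andP[|h0 h1]; last by rewrite ger0_norm.
move=> y xy; have [y0|y0] := leP y 0; first by have := sqr_ge0 x; rewrite !expr2; nra.
have := sqr_ge0 (s - 4 * y); have : y ^+ 2 <= x ^+ 2 by rewrite !expr2; nra.
by rewrite !expr2; nra.
Qed.
End HalfLines.

(** * The primitive of the weight and the potential *)
Section Potential.
Context (R : realType).
Notation leb := (@lebesgue_measure R).
Variables (f : R -> R) (M : R).
Hypotheses (mf : measurable_fun setT f) (fM : forall t, `|f t| <= M).

Definition step (t s : R) : R := (s < t)%R%:R - (s < 0)%R%:R.

(** The primitive of [f] vanishing at [0]: as a function of [s], [step t s] is the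
    signed indicator of the interval from [0] to [t]. *)
Definition prim (t : R) : R := \int[leb]_s (f s * step t s).

Lemma step_itv (s t u : R) : s <= t -> step t u - step s u = (u \in `[s, t[)%:R.
Proof.
move=> st; rewrite /step in_itv/=.
by case: (ltP u t) => ut; case: (ltP u s) => us; case: (ltP u 0) => u0 /=; lra.
Qed.

Lemma Rintegrable_indic_itvco (s t : R) : Rintegrable leb (fun u : R => (u \in `[s, t[)%:R).
Proof.
have := @integrable_indic_itv R s t true true.
apply: eq_integrable => // u _.
by rewrite /= indicE mem_setE.
Qed.

Lemma Rintegrable_step t : Rintegrable leb (step t).
Proof.
have [t0|t0] := leP 0 t.
  apply: eq_integrable (Rintegrable_indic_itvco 0 t) => // u _.
  by rewrite /= -step_itv// /step subrr subr0.
have := RintegrableZ (-1) (Rintegrable_indic_itvco t 0).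
apply: eq_integrable => // u _.
by rewrite /= -step_itv ?ltW// /step subrr sub0r mulN1r opprK.
Qed.

Lemma Rintegrable_fstep t : Rintegrable leb (fun s => f s * step t s).
Proof. exact: (@Rintegrable_bounded _ _ _ leb M _ _ mf fM (Rintegrable_step t)). Qed.

Lemma Rintegrable_fitv (s t : R) : Rintegrable leb (fun u : R => f u * (u \in `[s, t[)%:R).
Proof. exact: (@Rintegrable_bounded _ _ _ leb M _ _ mf fM (Rintegrable_indic_itvco s t)). Qed.

Lemma primB (s t : R) : s <= t -> prim t - prim s = \int[leb]_u (f u * (u \in `[s, t[)%:R).
Proof.
move=> st; rewrite -(RintegralB measurableT (Rintegrable_fstep t) (Rintegrable_fstep s)).
by apply: eq_Rintegral => u _; rewrite -mulrBr step_itv.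
Qed.

Lemma integral_indic_itvco (s t : R) : s <= t -> \int[leb]_u (u \in `[s, t[)%:R = t - s.
Proof.
move=> st; rewrite /Rintegral (_ : (\int[leb]_u _)%E = (t - s)%:E)//.
transitivity (\int[leb]_u (\1_`[s, t[%classic u)%:E)%E.
  by apply: eq_integral => u _; rewrite indicE mem_setE.
rewrite integral_indic// setIT.
have := lebesgue_measure_itv `[s, t[; rewrite /= lte_fin => ->.
case: ltP => h; first by rewrite EFinB.
by congr EFin; lra.
Qed.

Lemma prim_lip (s t : R) : s <= t -> `|prim t - prim s| <= M * (t - s).
Proof.
move=> st; rewrite primB// -(integral_indic_itvco st).
rewrite -RintegralZl//; last exact: Rintegrable_indic_itvco.
apply: le_trans (le_normr_Rintegral measurableT (Rintegrable_fitv s t)) _.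
apply: le_Rintegral => //.
- exact: Rintegrable_norm (Rintegrable_fitv s t).
- exact: RintegrableZ (Rintegrable_indic_itvco s t).
- move=> u _; rewrite normrM [X in _ * X]ger0_norm// ler_wpM2r//.
Qed.

Lemma prim0 : prim 0 = 0.
Proof.
rewrite /prim; under eq_Rintegral do rewrite /step subrr mulr0.
by rewrite Rintegral_cst// mul0r.
Qed.

Lemma prim_le t : `|prim t| <= M * `|t|.
Proof.
have [t0|t0] := leP 0 t.
  by have := prim_lip t0; rewrite prim0 !subr0 (ger0_norm t0).
by have := prim_lip (ltW t0); rewrite prim0 !sub0r normrN (ltr0_norm t0).
Qed.

Lemma continuous_prim : continuous prim.
Proof.
move=> t; apply/cvgrPdist_le => e e0.
have M0 := bound_ge0 fM.
have d0 : 0 < e / (M + 1) by rewrite divr_gt0// ltr_wpDl.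
have lip a b : `|prim a - prim b| <= M * `|a - b|.
  have [ab|/ltW ba] := leP a b.
    by rewrite distrC (distrC a); have := prim_lip ab; rewrite [`|b - a|]ger0_norm ?subr_ge0.
  by have := prim_lip ba; rewrite [`|a - b|]ger0_norm ?subr_ge0.
exists (e / (M + 1)) => //= s /= ts.
apply: le_trans (lip _ _) _; apply: (@le_trans _ _ (M * (e / (M + 1)))).
  by rewrite ler_wpM2l// ltW.
rewrite mulrA ler_pdivrMr ?ltr_wpDl//; nra.
Qed.

Lemma measurable_prim : measurable_fun setT prim.
Proof. by apply: continuous_measurable_fun; exact: continuous_prim. Qed.

(** Formally the integral of [2 * f s * lower_mass x s]; the term in [s < 0], independent of
    [x], is subtracted to make it converge. *)
Definition pot (x : R) : R := \int[leb]_s (2 * (f s * (lower_mass x s - 2^-1 * (s < 0)%R%:R))).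

Lemma measurable_lower x : measurable_fun setT (fun s : R => lower_mass x s).
Proof.
apply: (@measurable_Rintegral _ _ _ _ R leb (fun u : R * R => (u.2 < x)%R%:R * gam (2 * u.2 - u.1))).
apply: measurable_funM.
  by apply: (measurableT_comp (measurable_ltc x)); exact: measurable_snd.
apply: (measurableT_comp (@measurable_gam R)); apply: measurable_funB; last exact: measurable_fst.
by apply: measurable_funM => //; exact: measurable_snd.
Qed.

Lemma Rintegrable_tail x : Rintegrable leb (fun s : R => lower_mass x s - 2^-1 * (s < 0)%R%:R).
Proof.
have c0 : (0 : R) < 4^-1 by rewrite invr_gt0.
apply: (@Rintegrable_le _ _ _ leb _ _ _ (tail_bound x) (RintegrableZ _ (Rintegrable_gauss c0))).
apply: measurable_funB; first exact: measurable_lower.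
by apply: measurable_funM => //; exact: measurable_ltc.
Qed.

Lemma Rintegrable_pot x : Rintegrable leb (fun s : R => 2 * (f s * (lower_mass x s - 2^-1 * (s < 0)%R%:R))).
Proof.
exact: RintegrableZ (@Rintegrable_bounded _ _ _ leb M _ _ mf fM (Rintegrable_tail x)).
Qed.

Lemma gam_dom (a x s : R) : `|x| <= a -> gam (2 * x - s) <= expR (2 * a ^+ 2) * expR (- (4^-1 * s ^+ 2)).
Proof.
move=> xa; apply: le_trans (gam_le_exp _) _; rewrite -expRD ler_expR.
have := sqr_ge0 (4 * x - s).
have : x ^+ 2 <= a ^+ 2.
  rewrite -(real_normK (num_real x)) lerXn2r ?nnegrE//; exact: le_trans xa.
by rewrite !expr2; nra.
Qed.

Lemma normr_near (a x : R) : a - 1 < x < a + 1 -> `|x| <= `|a| + 1.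
Proof.
move=> /andP[h1 h2]; have h3 := ler_norm a; have h4 := ler_norm (- a).
by rewrite normrN in h4; rewrite ler_norml; apply/andP; split; lra.
Qed.

Lemma is_derive_pot (a : R) : is_derive a (1 : R) pot (2 * gtrans f a).
Proof.
have M0 := bound_ge0 fM.
have c0 : (0 : R) < 4^-1 by rewrite invr_gt0.
have -> : 2 * gtrans f a = \int[leb]_s (2 * (f s * gam (2 * a - s))).
  rewrite RintegralZl//; exact: (Rintegrable_wgt mf fM (2 * a)).
apply: (@is_derive_Rintegral _ _ R leb
  (fun x s => 2 * (f s * (lower_mass x s - 2^-1 * (s < 0)%R%:R)))
  (fun x s => 2 * (f s * gam (2 * x - s)))
  (fun s => 2 * M * expR (2 * (`|a| + 1) ^+ 2) * expR (- (4^-1 * s ^+ 2)))).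
- exact: Rintegrable_pot.
- move=> x s.
  have h : is_derive x (1 : R) (fun x => lower_mass x s - 2^-1 * (s < 0)%R%:R) (gam (2 * x - s)).
    by have := is_deriveB (is_derive_lower x s) (is_derive_cst (2^-1 * (s < 0)%R%:R : R) x (1 : R)); rewrite subr0.
  have h1 : is_derive x (1 : R) (f s *: (fun x => lower_mass x s - 2^-1 * (s < 0)%R%:R)) (f s *: gam (2 * x - s)).
    exact: is_deriveZ.
  have h2 : is_derive x (1 : R) (2 *: (f s *: (fun x => lower_mass x s - 2^-1 * (s < 0)%R%:R))) (2 *: (f s *: gam (2 * x - s))).
    exact: is_deriveZ.
  exact: h2.
- by move=> s; rewrite !mulr_ge0 ?expR_ge0.
- exact: RintegrableZ (Rintegrable_gauss c0).
- move=> x s /normr_near xa; rewrite normrM normrM (ger0_norm (gam_ge0 _)) ger0_norm// -!mulrA ler_wpM2l//.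
  by rewrite ler_pM ?gam_ge0// gam_dom.
Qed.
End Potential.

(** * Symmetrization of the kernel *)
Section Symmetrization.
Context (R : realType).
Notation leb := (@lebesgue_measure R).
Variables (f : R -> R) (M : R).
Hypotheses (mf : measurable_fun setT f) (fM : forall t, `|f t| <= M).

(** Only pairs with [x - x'] and [z.2 - z.1] of the same sign count: for these
    [`|x - x'| * `|z.2 - z.1|] is the product [(x - x') * (z.2 - z.1)]. *)
Definition order_sign (x x' : R) (z : R * R) : R :=
  (x' < x)%R%:R * (z.1 < z.2)%R%:R - (x < x')%R%:R * (z.2 < z.1)%R%:R.

(** The integrand after symmetrization: the squares are completed, so [x'] enters only
    through [order_sign] and one Gaussian. *)
Definition kappa (x x' : R) (z : R * R) : R :=
  2 * (wgt f (2 * x) z.1 * (f z.2 * (order_sign x x' z * gam (2 * x' - z.2)))).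

Definition pair_weight (x x' : R) (z : R * R) : R :=
  expR (- (x - x') ^+ 2) * (wgt f (x + x') z.1 * wgt f (x + x') z.2 *
    expR (- `|x - x'| * `|x + x' - z.1 - (x + x' - z.2)|)).

Lemma kappaE x x' z : kappa x x' z = 2 * (order_sign x x' z * pair_weight x x' z).
Proof.
have e : x + x' - z.1 - (x + x' - z.2) = z.2 - z.1 by ring.
rewrite /kappa /pair_weight e /order_sign /wgt.
case: (ltgtP x' x) => xx; case: (ltgtP z.1 z.2) => zz; rewrite /= ?(oppr0, mulr0, mul0r, subr0, sub0r, mulr1, mul1r, mulN1r, mulrN)//.
- rewrite (gtr0_norm (_ : 0 < x - x')) ?subr_gt0// (gtr0_norm (_ : 0 < z.2 - z.1)) ?subr_gt0//.
  by have := gam_split x x' z.1 z.2; move: (expR _) (expR _) => a b h; transitivity (2 * (f z.1 * f z.2 * (gam (2 * x - z.1) * gam (2 * x' - z.2)))); [ring|rewrite -h; ring].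
- have -> : - `|x - x'| * `|z.2 - z.1| = - (x - x') * (z.2 - z.1).
    by rewrite !ltr0_norm ?subr_lt0//; ring.
  by have := gam_split x x' z.1 z.2; move: (expR _) (expR _) => a b h; transitivity (- (2 * (f z.1 * f z.2 * (gam (2 * x - z.1) * gam (2 * x' - z.2))))); [ring|rewrite -h; ring].
Qed.

Lemma normr_order_sign x x' z : `|order_sign x x' z| <= 1.
Proof.
rewrite /order_sign; case: (ltgtP x' x) => _; case: (ltgtP z.1 z.2) => _ /=;
 by rewrite ?(mulr0, mul0r, subr0, sub0r, mulr1, normrN, normr0, normr1).
Qed.

Let mth (q : R) : measurable_fun setT (fun t : R => q - t).
Proof. exact: measurable_funB. Qed.

Lemma Rintegrable_pair_weight x x' : x != x' -> Rintegrable (@leb2 R) (pair_weight x x').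
Proof.
move=> xx; have l0 : 0 < `|x - x'| by rewrite normr_gt0 subr_eq0.
exact: (RintegrableZ _ (Rintegrable_kkexp (Rintegrable_wgt mf fM (x + x')) (mth (x + x')) l0)).
Qed.

(** Exchanging the two integration variables replaces the symmetric weight by
    twice its restriction to a half plane, where the squares can be completed. *)
Lemma symmetrize x x' :
  \int[@leb2 R]_z (Num.sg (x - x') * expR (- (x - x') ^+ 2) *
    (wgt f (x + x') z.1 * wgt f (x + x') z.2 * expR (- `|x - x'| * `|x + x' - z.1 - (x + x' - z.2)|)))
  = \int[@leb2 R]_z kappa x x' z.
Proof.
under eq_Rintegral do rewrite -mulrA -/(pair_weight x x' _).
under [RHS]eq_Rintegral do rewrite kappaE.
have sym z : pair_weight x x' (z.2, z.1) = pair_weight x x' z.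
  rewrite /pair_weight /=.
  have -> : `|x + x' - z.2 - (x + x' - z.1)| = `|x + x' - z.1 - (x + x' - z.2)|.
    by rewrite -normrN; congr (`|_|); ring.
  by ring.
have [xx|xx|<-] := ltgtP x x'; last first.
- apply: eq_Rintegral => z _; rewrite subrr sgr0 /order_sign ltxx !mul0r subr0 mul0r mulr0 //.
- have i := Rintegrable_pair_weight (negbT (gt_eqF xx)).
  rewrite gtr0_sg ?subr_gt0//; under eq_Rintegral do rewrite mul1r.
  rewrite (Rintegral_half i sym).1; apply: eq_Rintegral => z _.
  by rewrite /order_sign xx (ltNge x) (ltW xx) mul1r mul0r subr0.
- have i := Rintegrable_pair_weight (negbT (lt_eqF xx)).
  rewrite ltr0_sg ?subr_lt0// (RintegralZl _ measurableT i) (Rintegral_half i sym).2.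
  have i21 := @Rintegrable_bounded _ _ _ (@leb2 R) 1 _ _ (@measurable_lt21 R) (fun z => normr_nat_le1 _ _) i.
  rewrite -(RintegralZl _ measurableT (RintegrableZ 2 i21)); apply: eq_Rintegral => z _.
  by rewrite /order_sign xx (ltNge x') (ltW xx) mul1r mul0r sub0r; ring.
Qed.

Lemma measurable_order_sign x : measurable_fun setT (fun u : R * (R * R) => order_sign x u.1 u.2).
Proof.
apply: measurable_funB; apply: measurable_funM.
- by apply: (measurableT_comp (measurable_ltc x)); exact: measurable_fst.
- by apply: (measurableT_comp (@measurable_lt12 R)); exact: measurable_snd.
- by apply: (measurableT_comp (measurable_cgt x)); exact: measurable_fst.
- by apply: (measurableT_comp (@measurable_lt21 R)); exact: measurable_snd.
Qed.

Lemma measurable_kappa x : measurable_fun setT (fun u : R * (R * R) => kappa x u.1 u.2).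
Proof.
have m22 : measurable_fun setT (fun u : R * (R * R) => u.2.2).
  by apply: measurableT_comp; [exact: measurable_snd|exact: measurable_snd].
have m21 : measurable_fun setT (fun u : R * (R * R) => u.2.1).
  by apply: measurableT_comp; [exact: measurable_fst|exact: measurable_snd].
apply: measurable_funM => //; apply: measurable_funM.
  exact: (measurableT_comp (Rintegrable_meas (Rintegrable_wgt mf fM (2 * x))) m21).
apply: measurable_funM; first exact: (measurableT_comp mf m22).
apply: measurable_funM; first exact: measurable_order_sign.
apply: (measurableT_comp (@measurable_gam R)); apply: measurable_funB => //.
by apply: measurable_funM => //; exact: measurable_fst.
Qed.

(** The completed squares hide the decay in [x']; it is visible on [pair_weight], to which
    [kappaE] returns. *)
Lemma Rintegrable_kappa x : Rintegrable (leb \x @leb2 R)%E (fun u : R * (R * R) => kappa x u.1 u.2).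
Proof.
have M0 := bound_ge0 fM.
have inner x' : Rintegrable (@leb2 R) (kappa x x') /\
    \int[@leb2 R]_z `|kappa x x' z| <= 2 * M ^+ 2 * expR (- (x - x') ^+ 2).
  have mk : measurable_fun setT (kappa x x').
    exact: (measurableT_comp (measurable_kappa x) (pair1_measurable x')).
  have iw := Rintegrable_wgt mf fM (x + x').
  have [iww eww] := Rintegral_mul (Rintegrable_norm iw) (Rintegrable_norm iw).
  have ib := RintegrableZ (2 * expR (- (x - x') ^+ 2)) iww.
  have kb z : `|kappa x x' z| <= 2 * expR (- (x - x') ^+ 2) * (`|wgt f (x + x') z.1| * `|wgt f (x + x') z.2|).
    rewrite kappaE normrM ger0_norm// -mulrA ler_wpM2l// normrM.
    apply: (@le_trans _ _ (1 * `|pair_weight x x' z|)).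
      by rewrite ler_wpM2r// normr_order_sign.
    rewrite mul1r /pair_weight !normrM !(ger0_norm (expR_ge0 _)) ler_wpM2l ?expR_ge0//.
    by rewrite ler_piMr ?mulr_ge0// -expR0 ler_expR mulNr oppr_le0 mulr_ge0.
  have ik := @Rintegrable_le _ _ _ (@leb2 R) _ _ mk kb ib.
  split => //.
  apply: (@le_trans _ _ (\int[@leb2 R]_z (2 * expR (- (x - x') ^+ 2) * (`|wgt f (x + x') z.1| * `|wgt f (x + x') z.2|)))).
    by apply: le_Rintegral => //; exact: Rintegrable_norm ik.
  rewrite (RintegralZl _ measurableT iww) /leb2 eww [leRHS]mulrAC ler_wpM2l ?mulr_ge0 ?expR_ge0//.
  by rewrite expr2 ler_pM ?wgt_L1_ge0 ?wgt_L1.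
apply: (@Rintegrable_prod _ _ _ _ _ leb (@leb2 R) _ (fun x' => 2 * M ^+ 2 * expR (- (x - x') ^+ 2))).
- exact: measurable_kappa.
- by move=> x'; exact: (inner x').1.
- by move=> x'; exact: (inner x').2.
- exact: RintegrableZ (Rintegrable_gauss_shift x).
Qed.
End Symmetrization.

(** * The Gaussian transform and the Cauchy transform *)
Section GaussTransform.
Context (R : realType).
Notation leb := (@lebesgue_measure R).

(** A class of functions on which the Gaussian transform converges. It contains the
    bounded functions and is stable under the product by [t], hence under all that
    differentiating [gtrans] produces. *)
Definition exp_growth (h : R -> R) : Prop :=
  exists A B, forall t, `|h t| <= A * expR (B * `|t|).

Lemma exp_growthM h1 h2 : exp_growth h1 -> exp_growth h2 -> exp_growth (fun t => h1 t * h2 t).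
Proof.
move=> [A1 [B1 e1]] [A2 [B2 e2]]; exists (A1 * A2), (B1 + B2) => t.
rewrite normrM mulrDl expRD mulrACA ler_pM//.
Qed.

Lemma exp_growth_bounded h M : (forall t, `|h t| <= M) -> exp_growth h.
Proof. by move=> hM; exists M, 0 => t; rewrite mul0r expR0 mulr1. Qed.

Lemma abs_le_exp (t : R) : `|t| <= expR `|t|.
Proof. by apply: le_trans (expR_ge1Dx _); rewrite lerDr. Qed.

Lemma exp_growth_le h A : (forall t, `|h t| <= A * expR `|t|) -> exp_growth h.
Proof. by move=> hA; exists A, 1 => t; rewrite mul1r. Qed.

Lemma exp_growth_linear h M : (forall t, `|h t| <= M * `|t|) -> exp_growth h.
Proof.
move=> hM; apply: (@exp_growth_le _ `|M|) => t; apply: le_trans (hM t) _.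
apply: (@le_trans _ _ (`|M| * `|t|)); first by rewrite ler_wpM2r// ler_norm.
by rewrite ler_wpM2l// abs_le_exp.
Qed.

Lemma Rintegrable_gtrans h x : measurable_fun setT h -> exp_growth h ->
  Rintegrable leb (fun t : R => h t * gam (2 * x - t)).
Proof.
move=> mh [A [B hB]]; have c0 : (0 : R) < 4^-1 by rewrite invr_gt0.
apply: (@Rintegrable_le _ _ _ leb _ _ _ _
  (RintegrableZ (A * expR (2 * `|x| ^+ 2)) (Rintegrable_gauss_exp B c0))).
  apply: measurable_funM => //; apply: (measurableT_comp (@measurable_gam R)).
  exact: measurable_funB.
move=> t; rewrite normrM (ger0_norm (gam_ge0 _)).
apply: le_trans (ler_pM _ _ (hB t) (gam_dom t (lexx `|x|))) _; rewrite ?gam_ge0//.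
by rewrite expRD; set e1 := expR _; set e2 := expR _; set e3 := expR _; rewrite le_eqVlt; apply/orP; left; apply/eqP; ring.
Qed.

Lemma measurable_mulid h : measurable_fun setT h -> measurable_fun setT (fun t : R => t * h t).
Proof. by move=> mh; exact: measurable_funM. Qed.

Lemma exp_growth_mulid h : exp_growth h -> exp_growth (fun t => t * h t).
Proof.
by apply: (@exp_growthM (fun t => t)); apply: (@exp_growth_linear _ 1) => t; rewrite mul1r.
Qed.

Lemma is_derive_gtrans h a : measurable_fun setT h -> exp_growth h ->
  is_derive a (1 : R) (gtrans h) (- 4 * a * gtrans h a + 2 * gtrans (fun t => t * h t) a).
Proof.
move=> mh gh; have i1 := Rintegrable_gtrans a mh gh.
have i2 := Rintegrable_gtrans a (measurable_mulid mh) (exp_growth_mulid gh).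
have -> : - 4 * a * gtrans h a + 2 * gtrans (fun t => t * h t) a =
    \int[leb]_t (h t * (- (2 * (2 * a - t)) * gam (2 * a - t))).
  rewrite /gtrans -(RintegralZl _ measurableT i1) -(RintegralZl _ measurableT i2).
  rewrite -(RintegralD measurableT (RintegrableZ _ i1) (RintegrableZ _ i2)).
  by apply: eq_Rintegral => t _; ring.
have [A [B hB]] := gh; have c0 : (0 : R) < 4^-1 by rewrite invr_gt0.
have A0 : 0 <= A.
  have := hB 0; rewrite normr0 mulr0 expR0 mulr1; exact: le_trans.
set b := `|a| + 1.
have b0 : 0 <= b by rewrite addr_ge0.
apply: (@is_derive_Rintegral _ _ R leb
  (fun x t => h t * gam (2 * x - t))
  (fun x t => h t * (- (2 * (2 * x - t)) * gam (2 * x - t)))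
  (fun t => A * (2 * (2 * b + 1)) * expR (2 * b ^+ 2) * expR ((B + 1) * `|t| - 4^-1 * t ^+ 2))).
- by move=> x; exact: Rintegrable_gtrans.
- move=> x t.
  have h2 : is_derive x (1 : R) (h t *: (fun x : R => gam (2 * x - t))) (h t *: (- (2 * (2 * x - t)) * gam (2 * x - t))).
    by apply: is_deriveZ; exact: is_derive_gam2.
  exact: h2.
- by move=> t; rewrite !mulr_ge0 ?expR_ge0// addr_ge0// mulr_ge0.
- exact: RintegrableZ (Rintegrable_gauss_exp (B + 1) c0).
- move=> x t /normr_near; rewrite -/b => xb.
  rewrite normrM [X in _ * X]normrM normrN normrM (ger0_norm (gam_ge0 _)) (ger0_norm (_ : 0 <= 2))//.
  have h1 : `|2 * x - t| <= (2 * b + 1) * expR `|t|.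
    apply: le_trans (ler_normB _ _) _; rewrite normrM (ger0_norm (_ : 0 <= 2))//.
    have e1 : 1 <= expR `|t| by rewrite -expR0 ler_expR.
    by have := abs_le_exp t; nra.
  have h3 := gam_dom t xb.
  apply: (@le_trans _ _ (A * expR (B * `|t|) * (2 * ((2 * b + 1) * expR `|t|) * (expR (2 * b ^+ 2) * expR (- (4^-1 * t ^+ 2)))))).
    by rewrite ler_pM ?mulr_ge0 ?gam_ge0// ler_pM ?mulr_ge0 ?gam_ge0// ler_wpM2l.
  have -> : expR ((B + 1) * `|t| - 4^-1 * t ^+ 2) =
      expR (B * `|t|) * expR `|t| * expR (- (4^-1 * t ^+ 2)).
    by rewrite -!expRD; congr expR; ring.
  by rewrite le_eqVlt; apply/orP; left; apply/eqP; ring.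
Qed.
End GaussTransform.

Section CauchyTransformIntegral.
Context (R : realType).
Notation leb := (@lebesgue_measure R).
Variables (f : R -> R) (M : R).
Hypotheses (mf : measurable_fun setT f) (fM : forall t, `|f t| <= M).

Definition fprim (t : R) : R := f t * prim f t.

Lemma measurable_fprim : measurable_fun setT fprim.
Proof. by apply: measurable_funM => //; exact: measurable_prim mf fM. Qed.

Lemma exp_growth_fprim : exp_growth fprim.
Proof.
apply: exp_growthM; first exact: exp_growth_bounded fM.
exact: exp_growth_linear (prim_le mf fM).
Qed.

Definition reduced_kappa (x : R) (z : R * R) : R :=
  wgt f (2 * x) z.1 * (2 * (f z.2 * ((z.1 < z.2)%R%:R * lower_mass x z.2 - (z.2 < z.1)%R%:R * upper_mass x z.2))).

Lemma integral_kappa_x x z : \int[leb]_x' kappa f x x' z = reduced_kappa x z.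
Proof.
have i1 := RintegrableZ (z.1 < z.2)%R%:R (Rintegrable_lower x z.2).
have i2 := RintegrableZ (z.2 < z.1)%R%:R (Rintegrable_upper x z.2).
transitivity (\int[leb]_x' (wgt f (2 * x) z.1 * 2 * f z.2 *
   ((z.1 < z.2)%R%:R * ((x' < x)%R%:R * gam (2 * x' - z.2)) -
    (z.2 < z.1)%R%:R * ((x < x')%R%:R * gam (2 * x' - z.2))))).
  by apply: eq_Rintegral => x' _; rewrite /kappa /order_sign; ring.
rewrite (RintegralZl _ measurableT (RintegrableB i1 i2)) (RintegralB measurableT i1 i2).
rewrite (RintegralZl _ measurableT (Rintegrable_lower x z.2)) (RintegralZl _ measurableT (Rintegrable_upper x z.2)).
by rewrite -/(lower_mass x z.2) -/(upper_mass x z.2) /reduced_kappa; ring.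
Qed.

(** Since the lower and the upper mass add up to [2^-1], the bracket in [reduced_kappa] is
    [lower_mass x s - 2^-1 * (s < t)]; times [2 * f s], it is the integrand of [pot] minus
    that of [prim]. *)
Lemma integral_reduced_kappa x t :
  \int[leb]_s reduced_kappa x (t, s) = wgt f (2 * x) t * (pot f x - prim f t).
Proof.
have ip := Rintegrable_pot mf fM x.
have is_ := Rintegrable_fstep mf fM t.
have ib := RintegrableB ip is_.
rewrite /pot /prim -(RintegralB measurableT ip is_) -(RintegralZl _ measurableT ib).
apply: Rintegral_ae.
- rewrite /reduced_kappa /=; apply: measurable_funM => //; apply: measurable_funM => //.
  apply: measurable_funM => //; apply: measurable_funB; apply: measurable_funM.
  + exact: measurable_cgt.
  + exact: measurable_lower.
  + exact: measurable_ltc.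
  + have -> : upper_mass x = fun s => 2^-1 - lower_mass x s.
      by apply/funext => s; rewrite -(lower_upper x s); ring.
    by apply: measurable_funB => //; exact: measurable_lower.
- exact: Rintegrable_meas (RintegrableZ _ ib).
- apply: (@ae_neq R t) => s st; rewrite /reduced_kappa /step /=; congr (_ * _).
  have -> : upper_mass x s = 2^-1 - lower_mass x s by rewrite -(lower_upper x s); ring.
  by move: st; case: (ltgtP t s) => //= ts _; case: (s < 0) => /=; lra.
Qed.

(** Fubini twice: the integral over the plane is first taken along the lines [Re w = x'],
    where [re_inner] and [symmetrize] apply; then [x'] is integrated out first. *)
Lemma integral_re_kernel x y : \int[@leb2 R]_z re_kernel f x y z =
  pi * (pot f x * gtrans f x - gtrans fprim x).
Proof.
have ik := Rintegrable_kappa mf fM x.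
rewrite /leb2 (Rintegral_fubini1 (Rintegrable_re_kernel mf fM x y)).
transitivity (\int[leb]_x' (pi * \int[@leb2 R]_z kappa f x x' z)).
  apply: eq_Rintegral => x' _; have [_ _ ->] := re_inner mf fM x y x'.
  by rewrite (symmetrize mf fM).
rewrite (RintegralZl _ measurableT (Rintegrable_fubini1 ik)); congr (_ * _).
rewrite -(Rintegral_fubini1 ik) (Rintegral_fubini2 ik) /=.
under eq_Rintegral do rewrite integral_kappa_x.
have ir : Rintegrable (@leb2 R) (reduced_kappa x).
  apply: eq_integrable (Rintegrable_fubini2 ik) => // z _.
  by rewrite /= integral_kappa_x.
rewrite /leb2 (Rintegral_fubini1 ir).
under eq_Rintegral do rewrite integral_reduced_kappa.
have i1 := Rintegrable_gtrans x mf (exp_growth_bounded fM).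
have i2 := Rintegrable_gtrans x measurable_fprim exp_growth_fprim.
rewrite /gtrans -(RintegralZl _ measurableT i1) -(RintegralB measurableT (RintegrableZ _ i1) i2).
by apply: eq_Rintegral => t _; rewrite /wgt /fprim; ring.
Qed.
End CauchyTransformIntegral.

(** * Rigidity *)
Section Rigidity.
Context (R : realType).
Notation leb := (@lebesgue_measure R).

Lemma gam_factor (x t : R) : gam (2 * x - t) = gam (2 * x) * (expR (2 * x * t) * expR (- (t ^+ 2 / 2))).
Proof.
by rewrite /gam -[RHS]mulrA -!expRD; congr (_ * expR _); field.
Qed.

(** Up to the factor [gam (2 * x)], the Gaussian transform of [h] at [x] is the Laplace
    transform of [expR (- (t ^+ 2 / 2)) * h t] at [2 * x]. *)
Lemma gtrans_inj (h : R -> R) : measurable_fun setT h -> exp_growth h ->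
  (forall x, gtrans h x = 0) -> {ae leb, forall t, h t = 0}.
Proof.
move=> mh [A [B hB]] h0.
pose H t := expR (- (t ^+ 2 / 2)) * h t.
have mH : measurable_fun setT H.
  apply: measurable_funM => //; apply: measurableT_comp => //; apply: measurableT_comp => //.
  by apply: measurable_funM => //; exact: measurable_funX.
have HB t : `|H t| <= A * expR (B * `|t| - t ^+ 2 / 2).
  rewrite /H normrM (ger0_norm (expR_ge0 _)) expRD mulrCA mulrC mulrA ler_wpM2r ?expR_ge0//.
  by rewrite mulrC.
have L0 tau : \int[leb]_t (expR (tau * t) * H t) = 0.
  have := h0 (tau / 2); rewrite /gtrans.
  have i := Rintegrable_gtrans (tau / 2) mh (ex_intro _ A (ex_intro _ B hB)).
  have e2 : 2 * (tau / 2) = tau by field.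
  have g0 := gam_gt0 tau.
  have e t : expR (tau * t) * H t = (gam tau)^-1 * (h t * gam (2 * (tau / 2) - t)).
    by rewrite gam_factor e2 /H; field; rewrite gt_eqF.
  move=> z; under eq_Rintegral do rewrite e.
  by rewrite (RintegralZl _ measurableT i) z mulr0.
have := laplace_inj mH HB L0.
apply: (@filterS _ _ (ae_filter_ringOfSetsType leb)) => t /eqP.
by rewrite mulf_eq0 gt_eqF ?expR_gt0//= => /eqP.
Qed.

Section SlopeOne.
Variable g : R -> R.
Hypotheses (cg : continuous g)
  (slope1 : forall u v, u < v -> (forall w, u < w < v -> g w != 0) -> g v - g u = v - u).

(** Let [u] be the first point after [s] where [g <= 0]. Between [s] and [u] there is no
    zero, so the slope is one and [g s < g u]. *)
Lemma slope_one_pos s t : 0 < g s -> s <= t -> 0 < g t.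
Proof.
move=> gs st; rewrite ltNge; apply/negP => gt.
pose A := [set v : R | s <= v /\ g v <= 0].
have A0 : A t by [].
have lbA : has_lbound A by exists s => v [].
have hA : has_inf A by split; [exists t|].
pose u := inf A.
have su : s <= u by apply: lb_le_inf; [exists t|move=> v []].
have gu : g u <= 0.
  rewrite leNgt; apply/negP => gu.
  have cgu : g @ u --> g u := cg (x := u).
  move/cvgrPdist_lt : cgu => /(_ _ gu)[e /= e0 he].
  have := inf_adherent e0 hA => -[v [sv gv] vu].
  have uv : u <= v by apply: ge_inf.
  have : `|u - v| < e by rewrite distrC ger0_norm ?subr_ge0//; rewrite ltrBlDl.
  by move/he; rewrite ltr_norml => /andP[_]; lra.
have su' : s < u by rewrite lt_neqAle su andbT; apply/eqP => e; rewrite -e in gu; lra.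
have nz w : s < w < u -> g w != 0.
  move=> /andP[sw wu]; apply/negP => /eqP gw.
  have : u <= w by apply: ge_inf => //; split; [exact: ltW|rewrite gw].
  by rewrite leNgt wu.
by have := slope1 su' nz; lra.
Qed.
End SlopeOne.

(** A function that increases off its zero set stays positive once positive and, by the
    symmetry [t |-> - g (- t)], was negative before being negative. *)
Lemma slope_one_interval (g : R -> R) : continuous g ->
  (forall u v, u < v -> (forall w, u < w < v -> g w != 0) -> g v - g u = v - u) ->
  is_interval [set t | g t = 0].
Proof.
move=> cg sg a b /= ga gb w /andP[aw wb].
pose g' t := - g (- t).
have cg' : continuous g'.
  move=> t; apply: cvgN; apply: continuous_comp; [exact: oppr_continuous|exact: cg].
have sg' u v : u < v -> (forall w, u < w < v -> g' w != 0) -> g' v - g' u = v - u.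
  move=> uv h; have vu : - v < - u by rewrite ltrN2.
  have nz w' : - v < w' < - u -> g w' != 0.
    move=> /andP[vx xu]; have := h (- w'); rewrite /g' opprK oppr_eq0; apply.
    by apply/andP; split; lra.
  by have := sg _ _ vu nz; rewrite /g'; lra.
have neg s t : g t < 0 -> s <= t -> g s < 0.
  move=> gt st; have := @slope_one_pos g' cg' sg' (- t) (- s).
  by rewrite /g' !opprK !oppr_gt0; apply => //; rewrite lerN2.
have [gw|gw|//] := ltgtP (g w) 0.
- by have := neg a w gw aw; rewrite ga ltxx.
- by have := slope_one_pos cg sg gw wb; rewrite gb ltxx.
Qed.

Section Primitive.
Variables (f : R -> R) (M : R).
Hypotheses (mf : measurable_fun setT f) (fM : forall t, `|f t| <= M).

Lemma prim_eq_ae0 (u v : R) : u < v -> {ae leb, forall t, u < t < v -> f t = 0} ->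
  prim f v = prim f u.
Proof.
move=> uv f0; apply/eqP; rewrite -subr_eq0 (primB mf fM (ltW uv)).
rewrite (@Rintegral_ae _ _ _ leb _ (fun=> 0)) ?Rintegral_cst ?mul0r//.
  exact: Rintegrable_meas (Rintegrable_fitv mf fM u v).
have := @ae_neq R u (fun t => t != u) (fun s h => h).
move: f0; apply: (@filterS2 _ _ (ae_filter_ringOfSetsType leb)) => t ft tu.
rewrite in_itv/=; have [/andP[ut tv]|] := boolP (u <= t < v); last by rewrite mulr0.
by rewrite ft ?mul0r// tv andbT lt_neqAle ut eq_sym tu.
Qed.

(** Lebesgue differentiation, for the primitive with base point [t - 1], which differs from
    [prim f] by a constant near [t]. *)
Lemma is_derive_prim_ae : {ae leb, forall t, is_derive t (1 : R) (prim f) (f t)}.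
Proof.
have lf : locally_integrable [set: R] f.
  split => //; first exact: openT.
  move=> K _ cK; apply: (@le_lt_trans _ _ (\int[leb]_(t in K) M%:E)%E).
    apply: ge0_le_integral => //.
    - exact: compact_measurable.
    - by apply: measurable_funTS; do 2 apply: measurableT_comp => //.
    - by move=> t _; rewrite lee_fin.
  rewrite integral_cst//; last exact: compact_measurable.
  rewrite lte_mul_pinfty ?lee_fin ?(bound_ge0 fM)//.
  exact: compact_finite_measure.
have := lebesgue_differentiation lf.
apply: (@filterS _ _ (ae_filter_ringOfSetsType leb)) => t lt.
have ifv (a b : R) : leb.-integrable `[a, b] (EFin \o f).
  apply/integrableP; split.
    by apply/measurable_EFinP; exact: measurable_funTS.
  case: lf => _ _ /(_ `[a, b]%classic) h; apply: h => //.
  exact: segment_compact.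
pose G y := \int[leb]_(s in [set` Interval (BLeft (t - 1)) (BRight y)]) f s.
have near_e : \forall y \near t, G y + prim f (t - 1) = prim f y.
  have : \forall y \near t, t - 1 < y by apply: lt_nbhsr; lra.
  apply: filterS => y ty.
  suff -> : G y = prim f y - prim f (t - 1) by rewrite subrK.
  rewrite (primB mf fM (ltW ty)) /G Rintegral_mkcond; apply: Rintegral_ae.
  - by apply/(measurable_restrictT _ _).1 => //; exact: measurable_funTS.
  - exact: Rintegrable_meas (Rintegrable_fitv mf fM _ _).
  - apply: (@ae_neq R y) => s sy; rewrite patchE mem_setE !in_itv/=.
    by rewrite [s <= y]le_eqVlt (negPf sy)/=; case: ifP; rewrite ?mulr1 ?mulr0.
apply: (near_eq_is_derive near_e).
have tu : t < t + 1 by rewrite ltrDl.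
have [|d1 d2] := FTC1_lebesgue_pt tu (ifv (t - 1) (t + 1)) _ lt.
  by rewrite /= lte_fin; lra.
have h1 : is_derive t (1 : R) G (f t) by apply: DeriveDef => //; rewrite -derive1E.
by have := is_deriveD h1 (is_derive_cst (prim f (t - 1)) t (1 : R)); rewrite addr0.
Qed.
End Primitive.
End Rigidity.

Section WardOnTheLine.
Context (R : realType).
Notation leb := (@lebesgue_measure R).
Variables (f : R -> R) (M : R).
Hypotheses (mf : measurable_fun setT f) (fM : forall t, `|f t| <= M).

Let cp : continuous (prim f) := continuous_prim mf fM.

(** Ward's equation is equivalent to the vanishing of [f * gap c] for some [c]. *)
Definition gap (c t : R) : R := t - c - prim f t.

Lemma continuous_gap c : continuous (gap c).
Proof.
move=> t; apply: cvgB; last exact: cp.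
by apply: cvgB; [exact: cvg_id|exact: cvg_cst].
Qed.

(** Where [gap] has no zero the weight vanishes, so [prim f] is constant. *)
Lemma gap_slope c : {ae leb, forall t, f t * gap c t = 0} ->
  forall u v, u < v -> (forall w, u < w < v -> gap c w != 0) -> gap c v - gap c u = v - u.
Proof.
move=> h u v uv nz; have -> : gap c v - gap c u = v - u - (prim f v - prim f u) by rewrite /gap; ring.
rewrite (prim_eq_ae0 mf fM uv) ?subrr ?subr0//.
move: h; apply: (@filterS _ _ (ae_filter_ringOfSetsType leb)) => t /eqP.
by rewrite mulf_eq0 => /orP[/eqP -> //|/eqP g0] /nz; rewrite g0 eqxx.
Qed.

(** A set has at most one greatest element. With the next lemma, almost every point of an
    interval is interior. *)
Lemma ae_not_max (I : set R) : {ae leb, forall t, I t -> exists2 b, I b & t < b}.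
Proof.
have [[x Ix mx]|nmax] := pselect (exists2 x, I x & forall b, I b -> b <= x).
  by apply: (@ae_neq R x) => t tx It; exists x => //; rewrite lt_neqAle tx mx.
apply: (@ae_neq R 0) => t _ It; apply: contrapT => nb; apply: nmax.
exists t => // b Ib; rewrite leNgt; apply/negP => tb; apply: nb; exists b => //.
Qed.

Lemma ae_not_min (I : set R) : {ae leb, forall t, I t -> exists2 a, I a & a < t}.
Proof.
have [[x Ix mx]|nmax] := pselect (exists2 x, I x & forall b, I b -> x <= b).
  by apply: (@ae_neq R x) => t tx It; exists x => //; rewrite lt_neqAle eq_sym tx mx.
apply: (@ae_neq R 0) => t _ It; apply: contrapT => nb; apply: nmax.
exists t => // b Ib; rewrite leNgt; apply/negP => tb; apply: nb; exists b => //.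
Qed.

(** The slope of [gap] forces its zero set to be an interval. Inside it [prim f] is
    [t - c], so its derivative, almost everywhere [f], is one; outside it [f] vanishes. *)
Lemma rigidity c : {ae leb, forall t, f t * gap c t = 0} ->
  is_interval [set t | gap c t = 0] /\
  {ae leb, forall t, f t = \1_[set t | gap c t = 0] t}.
Proof.
move=> h; have iI := slope_one_interval (@continuous_gap c) (gap_slope h).
split => //; set I := [set t | gap c t = 0] in iI *.
have hd := is_derive_prim_ae mf fM; have hM := ae_not_max I; have hm := ae_not_min I.
have F := ae_filter_ringOfSetsType leb.
apply: filterS2 (filterI h hd) (filterI hM hm) => t [ht dt] [Mt mt].
rewrite indicE; have [tI|tI] := boolP (t \in I); last first.
  by move/eqP: ht; rewrite mulf_eq0 => /orP[/eqP ->//|gt]; move: tI; rewrite notin_setE /I/= => /(_ (eqP gt)).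
rewrite inE in tI; have [b Ib tb] := Mt tI; have [a Ia at_] := mt tI.
have ne : \forall y \near t, y - c = prim f y.
  have : \forall y \near t, a < y < b.
    by near=> y; apply/andP; split; near: y; [exact: lt_nbhsr|exact: lt_nbhsl].
  apply: filterS => y /andP[ay yb].
  have : I y by apply: (iI _ _ Ia Ib); rewrite (ltW ay) (ltW yb).
  by rewrite /I /gap/= => /eqP; rewrite subr_eq0 => /eqP.
have d1 : is_derive t (1 : R) (fun y : R => y - c) 1.
  by have := is_deriveB (is_derive_id t (1 : R)) (is_derive_cst c t (1 : R)); rewrite subr0.
have d2 := near_eq_is_derive ne d1.
by rewrite -(@derive_val _ _ _ _ _ _ _ dt) (@derive_val _ _ _ _ _ _ _ d2).
Unshelve. all: by end_near. Qed.

(** * Ward's equation on the real line *)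

Definition tmoment (t : R) : R := t * f t.
Let gf : exp_growth f := exp_growth_bounded fM.
Let mt : measurable_fun setT tmoment := measurable_mulid mf.
Let gt : exp_growth tmoment := exp_growth_mulid gf.

(** The derivatives of the Gaussian transforms of [f], of [f * prim f] and of [t * f t]. *)
Definition dphi (x : R) : R := - 4 * x * gtrans f x + 2 * gtrans tmoment x.
Definition dN (x : R) : R := - 4 * x * gtrans (fprim f) x + 2 * gtrans (fun t => t * fprim f t) x.
Definition dT (x : R) : R := - 4 * x * gtrans tmoment x + 2 * gtrans (fun t => t * tmoment t) x.

Lemma is_derive_phi x : is_derive x (1 : R) (gtrans f) (dphi x).
Proof. exact: is_derive_gtrans. Qed.

Lemma is_derive_N x : is_derive x (1 : R) (gtrans (fprim f)) (dN x).
Proof. by apply: is_derive_gtrans; [exact: measurable_fprim mf fM|exact: exp_growth_fprim mf fM]. Qed.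

Lemma is_derive_T x : is_derive x (1 : R) (gtrans tmoment) (dT x).
Proof. exact: is_derive_gtrans. Qed.

Lemma gtrans_gap c x : gtrans (fun t => f t * gap c t) x =
  gtrans tmoment x - c * gtrans f x - gtrans (fprim f) x.
Proof.
have i1 := Rintegrable_gtrans x mt gt.
have i2 := Rintegrable_gtrans x mf gf.
have i3 := Rintegrable_gtrans x (measurable_fprim mf fM) (exp_growth_fprim mf fM).
rewrite /gtrans -(RintegralZl _ measurableT i2).
rewrite -(RintegralB measurableT i1 (RintegrableZ _ i2)).
rewrite -(RintegralB measurableT (RintegrableB i1 (RintegrableZ _ i2)) i3).
by apply: eq_Rintegral => t _; rewrite /gap /tmoment /fprim; ring.
Qed.

Lemma is_derive_quot (u v : R -> R) (x du dv : R) : v x != 0 ->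
  is_derive x (1 : R) u du -> is_derive x (1 : R) v dv ->
  is_derive x (1 : R) (fun y => u y / v y) ((du * v x - u x * dv) / v x ^+ 2).
Proof.
move=> v0 du_ dv_.
have h1 : is_derive x (1 : R) (fun y => (v y)^-1) (- (v x) ^- 2 *: dv) by exact: is_deriveV.
have h2 := is_deriveM du_ h1.
by apply: (is_derive_eq h2); rewrite /GRing.scale/=; field.
Qed.

Hypothesis phi_gt0 : forall x, 0 < gtrans f x.

(** The derivative of [u / gtrans f] when [du] is that of [u]. *)
Definition dquot (u du : R -> R) (x : R) : R := (du x * gtrans f x - u x * dphi x) / gtrans f x ^+ 2.

Lemma is_derive_quot_phi (u du : R -> R) x : is_derive x (1 : R) u (du x) ->
  is_derive x (1 : R) (fun y => u y / gtrans f y) (dquot u du x).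
Proof.
by move=> h; apply: is_derive_quot h (is_derive_phi x); rewrite gt_eqF.
Qed.

(** The Cauchy transform at points of real part [x]; the factor [pi] of [integral_re_kernel]
    cancels the normalization of [dA]. *)
Definition cauchy_re (x : R) : R := (pot f x * gtrans f x - gtrans (fprim f) x) / gtrans f x.

Lemma is_derive_cauchy_re x : is_derive x (1 : R) cauchy_re
  (2 * gtrans f x - dquot (gtrans (fprim f)) dN x).
Proof.
have -> : cauchy_re = (fun y => pot f y - gtrans (fprim f) y / gtrans f y).
  by apply/funext => y; rewrite /cauchy_re mulrBl mulfK// gt_eqF.
exact: (is_deriveB (is_derive_pot mf fM x) (is_derive_quot_phi (is_derive_N x))).
Qed.

Lemma is_derive_ln_phi x : is_derive x (1 : R) (fun y => ln (gtrans f y)) (dphi x / gtrans f x).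
Proof.
have h := is_derive1_ln (phi_gt0 x).
have := @is_derive1_comp R (@ln R) (gtrans f) x _ _ h (is_derive_phi x).
by rewrite mulrC.
Qed.

Lemma is_derive_dlog x : is_derive x (1 : R) (fun y => dphi y / gtrans f y)
  (- 4 + 2 * dquot (gtrans tmoment) dT x).
Proof.
have -> : (fun y => dphi y / gtrans f y) = (fun y => (- 4) *: y + 2 *: (gtrans tmoment y / gtrans f y)).
  apply/funext => y; rewrite /dphi /GRing.scale/=; field.
  by rewrite gt_eqF.
have h1 := is_deriveZ (- 4) (is_derive_id x (1 : R)).
have h2 := is_deriveZ 2 (is_derive_quot_phi (is_derive_T x)).
have := is_deriveD h1 h2.
by rewrite /GRing.scale/= mulr1.
Qed.

(** Ward's equation at points of real part [x]: on functions of [Re z], [dbar] is half of the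
    derivative and the Laplacian a quarter of the second derivative. *)
Definition ward_eq (x : R) : Prop :=
  (2 * gtrans f x - dquot (gtrans (fprim f)) dN x) / 2 =
  gtrans f x - 1 - (- 4 + 2 * dquot (gtrans tmoment) dT x) / 4.

(** The terms [gtrans f] and [1] cancel: the first comes from the derivative of [pot], the
    second from that of [- 4 * x] in the logarithmic derivative of [gtrans f]. *)
Lemma ward_eqP x : ward_eq x <-> dquot (gtrans (fprim f)) dN x = dquot (gtrans tmoment) dT x.
Proof. by rewrite /ward_eq; split; lra. Qed.

(** The two quotients differ by a constant, say [c]; clearing denominators, the Gaussian
    transform of [f * gap c] vanishes. *)
Lemma ward_gap : (forall x, ward_eq x) -> exists c, {ae leb, forall t, f t * gap c t = 0}.
Proof.
move=> hw.
pose w x := gtrans tmoment x / gtrans f x - gtrans (fprim f) x / gtrans f x.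
have dw x : is_derive x (1 : R) w 0.
  have := is_deriveB (is_derive_quot_phi (is_derive_T x)) (is_derive_quot_phi (is_derive_N x)).
  by rewrite ((ward_eqP x).1 (hw x)) subrr.
exists (w 0); apply: gtrans_inj.
- by apply: measurable_funM => //; apply: continuous_measurable_fun; exact: continuous_gap.
- apply: exp_growthM => //.
  apply: (@exp_growth_le _ _ (1 + `|w 0| + M)) => t.
  have := prim_le mf fM t; have := bound_ge0 fM; rewrite /gap => M0 hp.
  apply: le_trans (ler_normB _ _) _; apply: (@le_trans _ _ (`|t| + `|w 0| + M * `|t|)).
    by rewrite lerD// ler_normB.
  have e1 : 1 <= expR `|t| by rewrite -expR0 ler_expR.
  by have := abs_le_exp t; have := normr_ge0 (w 0); nra.
- move=> x; rewrite gtrans_gap.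
  have := @is_derive_0_is_cst R w 0 x dw => ->.
  by rewrite /w; field; rewrite gt_eqF.
Qed.

Lemma gap_ward c : (forall t, f t * gap c t = 0) -> forall x, ward_eq x.
Proof.
move=> h x; apply/ward_eqP.
have e y : gtrans (fprim f) y / gtrans f y = gtrans tmoment y / gtrans f y - c.
  have := gtrans_gap c y; rewrite /gtrans; under eq_Rintegral do rewrite h mul0r.
  rewrite Rintegral_cst// mul0r -/(gtrans _ _) => e0.
  have g0 := phi_gt0 y; rewrite -[c](@mulfK _ (gtrans f y)) ?gt_eqF// -mulrBl; congr (_ / _).
  by move: e0; rewrite -!/(gtrans _ _); lra.
have h1 := is_derive_quot_phi (is_derive_N x).
have h2 := is_deriveB (is_derive_quot_phi (is_derive_T x)) (is_derive_cst c x (1 : R)).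
rewrite -(@derive_val _ _ _ _ _ _ _ h1) -[RHS]subr0 -(@derive_val _ _ _ _ _ _ _ h2).
by congr ('D_ _ _ _); apply/funext => y; exact: e.
Qed.
End WardOnTheLine.

(** * The kernels in real coordinates *)
Section ComplexArithmetic.
Context (R : realType).
Implicit Types a b c d : R.

Lemma conjE a b : (a +i* b)^* = a -i* b. Proof. by []. Qed.
Lemma mulcE a b c d : (a +i* b) * (c +i* d) = (a * c - b * d) +i* (a * d + b * c).
Proof. by []. Qed.
Lemma addcE a b c d : (a +i* b) + (c +i* d) = (a + c) +i* (b + d). Proof. by []. Qed.
Lemma oppcE a b : - (a +i* b) = (- a) +i* (- b). Proof. by []. Qed.
Lemma invcE a b : (a +i* b)^-1 = (a / (a ^+ 2 + b ^+ 2)) -i* (b / (a ^+ 2 + b ^+ 2)).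
Proof. by []. Qed.
Lemma halfcE a b : (a +i* b) / 2 = (a / 2) +i* (b / 2).
Proof.
have -> : (2 : R[i])^-1 = (2^-1)%:C by rewrite fmorphV rmorph_nat.
by rewrite mulcE !mulr0 subr0 add0r.
Qed.
Lemma mulrcE a c d : a%:C * (c +i* d) = (a * c) +i* (a * d).
Proof. by rewrite mulcE !mul0r subr0 addr0. Qed.
Lemma normc2E a b : `|a +i* b| ^+ 2 = (a ^+ 2 + b ^+ 2)%:C.
Proof. by rewrite -add_Re2_Im2. Qed.

Lemma gaussE (q b t : R) : gauss ((q +i* b) - t%:C) =
  (expR (b ^+ 2 / 2) * (gam (q - t) * cos ((q - t) * b))) +i*
  (- (expR (b ^+ 2 / 2) * (gam (q - t) * sin ((q - t) * b)))).
Proof.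
rewrite /gauss (oppcE t 0) addcE oppr0 addr0 expr2 mulcE oppcE halfcE.
rewrite /=.
have -> : - ((q - t) * (q - t) - b * b) / 2 = b ^+ 2 / 2 + - (q - t) ^+ 2 / 2 by field.
have -> : - ((q - t) * b + b * (q - t)) / 2 = - ((q - t) * b) by field.
rewrite cosN sinN expRD /gam.
by congr (_ +i* _); ring.
Qed.

Lemma gauss_mul (q b t h : R) :
  gauss ((q +i* b) - t%:C) * h%:C =
  (expR (b ^+ 2 / 2) * (h * gam (q - t) * cos ((q - t) * b))) +i*
  (- (expR (b ^+ 2 / 2) * (h * gam (q - t) * sin ((q - t) * b)))).
Proof. by rewrite gaussE -[h%:C]/(h +i* 0) mulcE; congr (_ +i* _); ring. Qed.

Lemma normr_cexp2 (a b : R) : `|cexp (a +i* b)| ^+ 2 = (expR (2 * a))%:C.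
Proof.
rewrite /cexp/= mulrcE normc2E; congr (_%:C).
rewrite !exprMn -mulrDr cos2Dsin2 mulr1 expr2 -expRD; congr expR; ring.
Qed.

Lemma ginibre_norm2 (x y x' y' : R) :
  `|ginibre (x +i* y) (x' +i* y')| ^+ 2 = (expR (- ((x - x') ^+ 2 + (y - y') ^+ 2)))%:C.
Proof.
rewrite /ginibre (normc2E x y) (normc2E x' y') (halfcE (x ^+ 2 + y ^+ 2) 0) (halfcE (x' ^+ 2 + y' ^+ 2) 0).
rewrite -[X in cexp X]/((x * x' - y * - y' - (x ^+ 2 + y ^+ 2) / 2 - (x' ^+ 2 + y' ^+ 2) / 2)
  +i* (x * - y' + y * x' - 0 / 2 - 0 / 2)) normr_cexp2.
by congr (_%:C); congr expR; field.
Qed.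

Lemma ginibre_diag (x y : R) : ginibre (x +i* y) (x +i* y) = 1.
Proof.
rewrite /ginibre (normc2E x y) (halfcE (x ^+ 2 + y ^+ 2) 0).
rewrite -[X in cexp X]/((x * x - y * - y - (x ^+ 2 + y ^+ 2) / 2 - (x ^+ 2 + y ^+ 2) / 2)
  +i* (x * - y + y * x - 0 / 2 - 0 / 2)).
have -> : (x * x - y * - y - (x ^+ 2 + y ^+ 2) / 2 - (x ^+ 2 + y ^+ 2) / 2) = 0 by field.
have -> : (x * - y + y * x - 0 / 2 - 0 / 2) = 0 by ring.
by rewrite /cexp/= expR0 cos0 sin0 mul1r.
Qed.
End ComplexArithmetic.

Section FunctionsOfRealPart.
Context (R : realType).

Lemma derive1_is_derive (g : R -> R) (x d : R) : is_derive x (1 : R) g d -> derive1 g x = d.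
Proof. by move=> h; rewrite derive1E; exact: derive_val. Qed.

Lemma re_function (F : R[i] -> R[i]) (g : R -> R) (z : R[i]) (d : R) :
  (forall u, F u = (g (Re u))%:C) -> is_derive (Re z) (1 : R) g d ->
  pderivable F z /\ pdx F z = d%:C /\ pdy F z = 0.
Proof.
move=> Fg gd; have F1 (t s : R) : F (t +i* s) = (g t)%:C by rewrite Fg.
have eR : (fun t : R => Re (F (t +i* Im z))) = g by apply/funext => t; rewrite F1.
have eI : (fun t : R => Im (F (t +i* Im z))) = cst 0 by apply/funext => t; rewrite F1.
have fR : (fun t : R => Re (F (Re z +i* t))) = cst (g (Re z)) by apply/funext => t; rewrite F1.
have fI : (fun t : R => Im (F (Re z +i* t))) = cst 0 by apply/funext => t; rewrite F1.
split; [split|split].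
- by rewrite eR; apply: ex_derive.
- by rewrite eI; exact: derivable_cst.
- by rewrite fR; exact: derivable_cst.
- by rewrite fI; exact: derivable_cst.
- by rewrite /pdx eR eI (derive1_is_derive gd) derive1_cst.
- by rewrite /pdy fR fI !derive1_cst.
Qed.

Lemma dbar_re_function (F : R[i] -> R[i]) (g : R -> R) (z : R[i]) (d : R) :
  (forall u, F u = (g (Re u))%:C) -> is_derive (Re z) (1 : R) g d ->
  dbar F z = (d / 2)%:C /\ dpartial F z = (d / 2)%:C.
Proof.
move=> Fg gd; have [_ [ex ey]] := re_function Fg gd.
by rewrite /dbar /dpartial ex ey mulr0 subr0 addr0 (halfcE d 0) mul0r.
Qed.
End FunctionsOfRealPart.

(** * The equation for a real weight *)
Section WardRealWeight.
Context (R : realType).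
Notation leb := (@lebesgue_measure R).
Variables (h : R -> R) (M : R) (Phi : R[i] -> R[i]).
Hypotheses (mh : measurable_fun setT h) (hM : forall t, `|h t| <= M).
Hypothesis hPhi : forall z, Phi z = gauss_conv (fun t => (h t)%:C) z.

Let mth (q : R) : measurable_fun setT (fun t : R => q - t).
Proof. exact: measurable_funB. Qed.

Lemma PhiE (q b : R) : Phi (q +i* b) =
  (expR (b ^+ 2 / 2) * \int[leb]_t (wgt h q t * cos ((q - t) * b))) +i*
  (- (expR (b ^+ 2 / 2) * \int[leb]_t (wgt h q t * sin ((q - t) * b)))).
Proof.
have ic := Rintegrable_kcos (Rintegrable_wgt mh hM q) (mth q) b.
have is_ := Rintegrable_ksin (Rintegrable_wgt mh hM q) (mth q) b.
rewrite hPhi /gauss_conv /cintegral; congr (_ +i* _).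
  rewrite -(RintegralZl _ measurableT ic); apply: eq_Rintegral => t _.
  by rewrite gauss_mul.
rewrite -mulNr -(RintegralZl _ measurableT is_); apply: eq_Rintegral => t _.
by rewrite gauss_mul /= mulNr.
Qed.

(** The factor [expR (b ^+ 2)] is cancelled by the Ginibre kernel in [K_norm2]. *)
Lemma Phi_norm2 (q b : R) : `|Phi (q +i* b)| ^+ 2 =
  (expR (b ^+ 2) * specnorm (wgt h q) (fun t => q - t) b)%:C.
Proof.
rewrite PhiE normc2E; congr (_%:C); rewrite sqrrN !exprMn -mulrDr; congr (_ * _).
by rewrite expr2 -expRD; congr expR; field.
Qed.

Lemma Phi_real (x : R) : Phi ((2 * x) +i* 0) = (gtrans h x)%:C.
Proof.
have E1 : expR (0 ^+ 2 / 2) = 1 :> R by rewrite expr0n/= mul0r expR0.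
have E2 : \int[leb]_t (wgt h (2 * x) t * cos ((2 * x - t) * 0)) = gtrans h x.
  by apply: eq_Rintegral => t _; rewrite mulr0 cos0 mulr1.
have E3 : \int[leb]_t (wgt h (2 * x) t * sin ((2 * x - t) * 0)) = 0.
  under eq_Rintegral do rewrite mulr0 sin0 mulr0.
  by rewrite Rintegral_cst// mul0r.
by rewrite PhiE E1 E2 E3 mulr0 oppr0 mul1r.
Qed.

Let K (z w : R[i]) : R[i] := ginibre z w * Phi (z + w^*).

Lemma K_diag z : K z z = (gtrans h (Re z))%:C.
Proof.
case: z => x y; rewrite /K ginibre_diag mul1r conjE addcE subrr.
have -> : x + x = 2 * x by ring.
exact: Phi_real.
Qed.

Lemma K_norm2 z w : `|K z w| ^+ 2 = (spec h (Re z) (Re w) (Im z - Im w))%:C.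
Proof.
case: z => x y; case: w => x' y'; rewrite /K normrM exprMn ginibre_norm2 conjE addcE Phi_norm2.
rewrite -rmorphM; congr (_%:C); rewrite /spec /= mulrA -expRD; congr (expR _ * _).
by ring.
Qed.

Lemma cauchy_kernelE (x y : R) (u : R * R) : cauchy_kernel K (x +i* y) (u.1 +i* u.2) =
  ((gtrans h x)^-1 * re_kernel h x y u) +i* (- (gtrans h x)^-1 * im_kernel h x y u).
Proof.
rewrite /cauchy_kernel /berezin K_norm2 K_diag /= -fmorphV -rmorphM.
rewrite -[X in _ / X]/((x - u.1) +i* (y - u.2)) invcE mulrcE.
by rewrite /re_kernel /im_kernel /sqdist; congr (_ +i* _); ring.
Qed.

Lemma dA_integrable_cauchy_kernel z : dA_integrable (cauchy_kernel K z).
Proof.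
case: z => x y; split.
  have := RintegrableZ (gtrans h x)^-1 (Rintegrable_re_kernel mh hM x y).
  by apply: eq_integrable => // u _; rewrite cauchy_kernelE.
have := RintegrableZ (- (gtrans h x)^-1) (Rintegrable_im_kernel mh hM x y).
by apply: eq_integrable => // u _; rewrite cauchy_kernelE.
Qed.

Lemma cauchy_transformE z : cauchy_transform K z = (cauchy_re h (Re z))%:C.
Proof.
case: z => x y; rewrite /cauchy_transform /dA_integral /cintegral.
have -> : \int[@leb2 R]_u Re (cauchy_kernel K (x +i* y) (u.1 +i* u.2)) =
    (gtrans h x)^-1 * (pi * (pot h x * gtrans h x - gtrans (fprim h) x)).
  rewrite -(integral_re_kernel mh hM x y) -(RintegralZl _ measurableT (Rintegrable_re_kernel mh hM x y)).
  by apply: eq_Rintegral => u _; rewrite cauchy_kernelE.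
have -> : \int[@leb2 R]_u Im (cauchy_kernel K (x +i* y) (u.1 +i* u.2)) = 0.
  transitivity (- (gtrans h x)^-1 * \int[@leb2 R]_u im_kernel h x y u).
    rewrite -(RintegralZl _ measurableT (Rintegrable_im_kernel mh hM x y)).
    by apply: eq_Rintegral => u _; rewrite cauchy_kernelE.
  by rewrite (integral_im_kernel mh hM) mulr0.
rewrite complexr0 -fmorphV -rmorphM /cauchy_re /=; congr (_%:C).
have := pi_gt0 R; move: (pi : R) => p p0.
have pU : p != 0 by rewrite gt_eqF.
move: (gtrans h x)^-1 => q.
by field.
Qed.

Lemma log_densityE z : log_density K z = (ln (gtrans h (Re z)))%:C.
Proof. by rewrite /log_density K_diag. Qed.

(** Every function of [z] in the definition depends on [Re z] only, so the differential
    operators reduce to derivatives on the line. Integrability and differentiability hold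
    once [gtrans h] is positive. *)
Lemma solves_ward_real : solves_ward K <->
  (forall x, 0 < gtrans h x) /\ (forall x, ward_eq h x).
Proof.
have K0 (x : R) : (0 < K x%:C x%:C) = (0 < gtrans h x) by rewrite K_diag ltcR.
have side (p0 : forall x, 0 < gtrans h x) :
  [/\ forall z, pderivable (cauchy_transform K) z,
      laplacian_exists (log_density K) &
      forall z, (dbar (cauchy_transform K) z = K z z - 1 - laplace (log_density K) z) <->
        ward_eq h (Re z)].
  have C1 z := re_function cauchy_transformE (is_derive_cauchy_re mh hM p0 (Re z)).
  have C2 z := dbar_re_function cauchy_transformE (is_derive_cauchy_re mh hM p0 (Re z)).
  have L1 z := re_function log_densityE (is_derive_ln_phi mh hM p0 (Re z)).
  have L2 z : dbar (log_density K) z = (2^-1 * (dphi h (Re z) / gtrans h (Re z)))%:C.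
    have [-> _] := dbar_re_function log_densityE (is_derive_ln_phi mh hM p0 (Re z)).
    by rewrite mulrC.
  have dL x : is_derive x (1 : R) (fun y => 2^-1 * (dphi h y / gtrans h y))
     (2^-1 * (- 4 + 2 * dquot h (gtrans (tmoment h)) (dT h) x)).
    have := is_deriveZ 2^-1 (is_derive_dlog mh hM p0 x); exact.
  have L3 z := re_function (g := fun y => 2^-1 * (dphi h y / gtrans h y)) L2 (dL (Re z)).
  have L4 z := dbar_re_function (g := fun y => 2^-1 * (dphi h y / gtrans h y)) L2 (dL (Re z)).
  split.
  - by move=> z; exact: (C1 z).1.
  - by move=> z; split; [exact: (L1 z).1|exact: (L3 z).1].
  - move=> z; rewrite (C2 z).1 /laplace (L4 z).2 K_diag /ward_eq.
    rewrite -[1 : R[i]]/(1%:C) -!rmorphB; split => [/complexI|] e.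
      by rewrite e; field.
    by congr (_%:C); rewrite e; field.
split=> [[Kp [_ _ _ we]]|[p0 we]].
  have p0 x : 0 < gtrans h x by rewrite -K0 Kp.
  have [_ _ hw] := side p0; split=> // x.
  exact: ((hw x%:C).1 (we x%:C)).
have [c1 c2 hw] := side p0; split; first by move=> z; rewrite K_diag ltcR.
split => //; first exact: dA_integrable_cauchy_kernel.
by move=> z; apply/hw.
Qed.
End WardRealWeight.

(** * Reality of the weight *)
Section GaussConv.
Context (R : realType).
Notation leb := (@lebesgue_measure R).

Lemma mulc_re (z w : R[i]) : Re (z * w) = Re z * Re w - Im z * Im w.
Proof. by case: z w => a b [c d]. Qed.

Lemma mulc_im (z w : R[i]) : Im (z * w) = Re z * Im w + Im z * Re w.
Proof. by case: z w => a b [c d]. Qed.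

Lemma measurable_gauss (z : R[i]) :
  measurable_fun setT (fun t : R => Re (gauss (z - t%:C))) /\
  measurable_fun setT (fun t : R => Im (gauss (z - t%:C))).
Proof.
case: z => q b.
have mq : measurable_fun setT (fun t : R => q - t) by exact: measurable_funB.
have mb : measurable_fun setT (fun t : R => (q - t) * b) by exact: measurable_funM.
have mg : measurable_fun setT (fun t : R => gam (q - t)).
  exact: measurableT_comp (@measurable_gam R) mq.
split.
  rewrite (_ : (fun t => _) = fun t => expR (b ^+ 2 / 2) * (gam (q - t) * cos ((q - t) * b))).
    apply: measurable_funM => //; apply: measurable_funM => //.
    by apply: (measurableT_comp _ mb); apply: continuous_measurable_fun; exact: continuous_cos.
  by apply/funext => t; rewrite gaussE.
rewrite (_ : (fun t => _) = fun t => - (expR (b ^+ 2 / 2) * (gam (q - t) * sin ((q - t) * b)))).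
  apply: measurableT_comp => //.
  apply: measurable_funM => //; apply: measurable_funM => //.
  by apply: (measurableT_comp _ mb); apply: continuous_measurable_fun; exact: continuous_sin.
by apply/funext => t; rewrite gaussE.
Qed.

Definition cmeasurable (f : R -> R[i]) :=
  measurable_fun setT (fun t => Re (f t)) /\ measurable_fun setT (fun t => Im (f t)).

Lemma cmeasurable_real (h : R -> R) : measurable_fun setT h -> cmeasurable (fun t => (h t)%:C).
Proof. by move=> mh; split=> //; exact: measurable_cst. Qed.

Lemma gauss_conv_ae (f g : R -> R[i]) (z : R[i]) : cmeasurable f -> cmeasurable g ->
  {ae leb, forall t, f t = g t} -> gauss_conv f z = gauss_conv g z.
Proof.
move=> [fr fi] [gr gi] fg; have [mr mi] := measurable_gauss z.
have mre (u : R -> R[i]) : cmeasurable u ->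
    measurable_fun setT (fun t : R => Re (gauss (z - t%:C) * u t)).
  case=> ur ui; under eq_fun do rewrite mulc_re.
  by apply: measurable_funB; apply: measurable_funM.
have mim (u : R -> R[i]) : cmeasurable u ->
    measurable_fun setT (fun t : R => Im (gauss (z - t%:C) * u t)).
  case=> ur ui; under eq_fun do rewrite mulc_im.
  by apply: measurable_funD; apply: measurable_funM.
rewrite /gauss_conv /cintegral; congr (_ +i* _).
  by apply: Rintegral_ae; [exact: mre|exact: mre|move: fg; apply: (@filterS _ _ (ae_filter_ringOfSetsType leb)) => t ->].
by apply: Rintegral_ae; [exact: mim|exact: mim|move: fg; apply: (@filterS _ _ (ae_filter_ringOfSetsType leb)) => t ->].
Qed.

Lemma im_gauss_conv (f : R -> R[i]) (x : R) :
  Im (gauss_conv f ((2 * x) +i* 0)) = gtrans (fun t => Im (f t)) x.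
Proof.
rewrite /gauss_conv /cintegral/=; apply: eq_Rintegral => t _.
by rewrite mulc_im gaussE /= mulr0 cos0 sin0 !(mulr0, oppr0, mul0r, addr0) expr0n/= mul0r
  expR0 mul1r mulr1 mulrC.
Qed.

(** At [x] real, [K x x = Phi (2 * x)] is positive, so its imaginary part, the Gaussian
    transform of the imaginary part of [f], vanishes. *)
Lemma ward_real_weight (Phi : R[i] -> R[i]) (f : R -> R[i]) :
  bounded_borel f -> (forall z, Phi z = gauss_conv f z) ->
  solves_ward (fun z w : R[i] => ginibre z w * Phi (z + w^*)) ->
  {ae leb, forall t, f t = (Re (f t))%:C}.
Proof.
move=> [fr fi [M fM]] Phif [Kp _].
have imM t : `|Im (f t)| <= M.
  have := fM t; case: (f t) => a b; rewrite normc_def lecR; apply: le_trans.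
  by rewrite -(sqrtr_sqr b) ler_sqrt ?lerDr ?addr_ge0 ?sqr_ge0.
have := gtrans_inj fi (exp_growth_bounded imM); case.
  move=> x; rewrite -im_gauss_conv -Phif.
  have := Kp x%:C; rewrite /= -[x%:C]/(x +i* 0) ginibre_diag mul1r conjE addcE subrr.
  have -> : x + x = 2 * x by ring.
  by rewrite ltcE/= => /andP[/eqP].
move=> A [mA A0 hA]; exists A; split=> // t ht; apply: hA => /= e; apply: ht => /=.
by move: e; case: (f t) => a b /= ->.
Qed.
End GaussConv.

(** * Intervals *)
Section Indicators.
Context (R : realType).
Notation leb := (@lebesgue_measure R).
Variable I : set R.
Hypotheses (cI : is_interval I) (I0 : (0 < leb I)%E).

Let h : R -> R := \1_I.

Lemma interval_measurable : measurable I.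
Proof. exact: is_interval_measurable. Qed.

Lemma indic_le1 t : `|h t| <= 1.
Proof. by rewrite /h indicE; case: (_ \in _); rewrite ?normr1 ?normr0 ?ler01. Qed.

Lemma measurable_indic_itv : measurable_fun setT h.
Proof. exact: measurable_indic interval_measurable. Qed.

Lemma indicC t : \1_I t = (h t)%:C :> R[i].
Proof. by rewrite /h !indicE; case: (_ \in _). Qed.

Lemma indic_not_ae0 : ~ {ae leb, forall t, h t = 0}.
Proof.
move=> [A [mA A0 hA]]; move: I0; rewrite ltNge; apply/negP; rewrite negbK -A0.
apply: le_measure; rewrite ?inE//; first exact: interval_measurable.
by move=> t It; apply: hA => /=; rewrite /h indicE mem_set// => /eqP; rewrite oner_eq0.
Qed.

Lemma gtrans_indic_gt0 x : 0 < gtrans h x.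
Proof.
have mh := measurable_indic_itv.
have p0 t : 0 <= h t * gam (2 * x - t) by rewrite mulr_ge0// ?gam_ge0// /h indicE.
have ge0 : 0 <= gtrans h x by apply: Rintegral_ge0 => t _; exact: p0.
rewrite lt_neqAle ge0 andbT; apply/eqP => e; apply: indic_not_ae0.
have ih := Rintegrable_gtrans x mh (exp_growth_bounded indic_le1).
have : (\int[leb]_t `|(h t * gam (2 * x - t))%:E| = 0)%E.
  transitivity (\int[leb]_t (h t * gam (2 * x - t))%:E)%E.
    by apply: eq_integral => t _; rewrite abse_EFin ger0_norm.
  have := fineK (integrable_fin_num measurableT ih).
  by rewrite -[fine _]/(gtrans h x) -e => /esym.
move/(ae_eq_integral_abs leb measurableT (measurable_int _ ih)).1.
apply: (@filterS _ _ (ae_filter_ringOfSetsType leb)) => t /(_ Logic.I) [/eqP].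
by rewrite mulf_eq0 (gt_eqF (gam_gt0 _)) orbF => /eqP.
Qed.

(** The constant [t0 - prim h t0] is the one for which [gap] vanishes at [t0]; inside the
    interval [prim h] has slope one, and outside [h] is zero. *)
Lemma gap_indic t0 t : I t0 -> h t * gap h (t0 - prim h t0) t = 0.
Proof.
move=> It0; have mh := measurable_indic_itv.
rewrite {1}/h indicE; case: (boolP (t \in I)); last by rewrite mul0r.
rewrite inE => It; rewrite mul1r.
have slope a b : I a -> I b -> a <= b -> prim h b - prim h a = b - a.
  move=> Ia Ib ab; rewrite (primB mh indic_le1 ab) -(integral_indic_itvco ab).
  apply: eq_Rintegral => u _; case: (boolP (u \in `[a, b[)); last by rewrite mulr0.
  rewrite in_itv/= => /andP[au ub]; rewrite mulr1 /h indicE mem_set//.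
  by apply: (cI Ia Ib); rewrite au ltW.
by have [h1|/ltW h1] := leP t0 t; [have := slope _ _ It0 It h1|have := slope _ _ It It0 h1];
  rewrite /gap; lra.
Qed.
End Indicators.

Section Characterization.
Context (R : realType).
Notation leb := (@lebesgue_measure R).
Variables (Phi : R[i] -> R[i]).
Let K (z w : R[i]) : R[i] := ginibre z w * Phi (z + w^*).

Lemma ward_of_interval (I : set R) : connected I -> (0 < leb I)%E ->
  (forall z, Phi z = gauss_conv \1_I z) -> solves_ward K.
Proof.
move=> /connected_intervalP cI I0 PhiI.
have mI := measurable_indic_itv cI; have b1 := @indic_le1 _ I.
have PhiI' z : Phi z = gauss_conv (fun t => (\1_I t : R)%:C) z.
  by rewrite PhiI; congr gauss_conv; apply/funext => t; rewrite indicC.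
apply/(solves_ward_real mI b1 PhiI').
have [t0 It0] : I !=set0.
  by apply/set0P/eqP => e; move: I0; rewrite e measure0 ltxx.
split; first exact: gtrans_indic_gt0.
apply: (@gap_ward _ _ _ mI b1 (gtrans_indic_gt0 cI I0)) => t.
exact: gap_indic It0.
Qed.

(** The set has positive measure because otherwise the weight would vanish almost
    everywhere, and with it the diagonal of the kernel. *)
Lemma interval_of_ward (f : R -> R[i]) : bounded_borel f ->
  (forall z, Phi z = gauss_conv f z) -> solves_ward K ->
  exists I : set R, [/\ connected I, (0 < leb I)%E & forall z, Phi z = gauss_conv \1_I z].
Proof.
move=> bf Phif Kw; have f_re := ward_real_weight bf Phif Kw.
have [fr fi [M fM]] := bf; pose h t := Re (f t).
have hM t : `|h t| <= M.
  have := fM t; rewrite /h; case: (f t) => a b; rewrite normc_def lecR; apply: le_trans.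
  by rewrite -(sqrtr_sqr a) ler_sqrt ?lerDl ?addr_ge0 ?sqr_ge0.
have Phih z : Phi z = gauss_conv (fun t => (h t)%:C) z.
  by rewrite Phif; apply: gauss_conv_ae f_re; [split|exact: cmeasurable_real].
have [p0 we] := (solves_ward_real fr hM Phih).1 Kw.
have [c hc] := ward_gap fr hM p0 we.
have [iI hI] := rigidity fr hM hc.
set I := [set t | gap h c t = 0] in iI hI; exists I.
have mI := measurable_indic_itv iI.
split; first exact/connected_intervalP.
- rewrite lt0e measure_ge0 andbT; apply/eqP => I0.
  have := p0 0; suff -> : gtrans h 0 = 0 by rewrite ltxx.
  have nI : {ae leb, forall t, ~ I t}.
    by exists I; split=> //; [exact: interval_measurable|move=> t /= /contrapT].
  transitivity (\int[leb]_t (0 : R)); last by rewrite Rintegral_cst// mul0r.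
  apply: Rintegral_ae => //.
    exact: Rintegrable_meas (Rintegrable_gtrans 0 fr (exp_growth_bounded hM)).
  move: hI nI; apply: (@filterS2 _ _ (ae_filter_ringOfSetsType leb)) => t ht nIt.
  by rewrite /h ht indicE memNset// mul0r.
- move=> z; rewrite Phih.
  rewrite (_ : \1_I = fun t => (\1_I t : R)%:C :> R[i]); last by apply/funext => t; rewrite indicC.
  apply: gauss_conv_ae; [exact: cmeasurable_real..|].
  by move: hI; apply: (@filterS _ _ (ae_filter_ringOfSetsType leb)) => t; rewrite /h => ->.
Qed.
End Characterization.

Unset Implicit Arguments.

Theorem theorem5 (R : realType) (Phi : R[i] -> R[i]) (f : R -> R[i])
    (hPhi : entire Phi) (hf : bounded_borel f)
    (hPhif : forall z : R[i], Phi z = gauss_conv f z) :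
  solves_ward (fun z w : R[i] => ginibre z w * Phi (z + w^*)) <->
  exists I : set R,
    [/\ connected I, (0 < lebesgue_measure I)%E &
        forall z : R[i], Phi z = gauss_conv \1_I z].
Proof.
split=> [|[I [cI I0 PhiI]]]; first exact: interval_of_ward hf hPhif.
exact: ward_of_interval cI I0 PhiI.
Qed.
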